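(* The set of principal nilpotent pairs in a complex semisimple Lie algebra $\mathfrak g$ is a finite union of orbits of the diagonal adjoint action of $G$ on $\mathfrak g\oplus\mathfrak g$.
   Context: Let $\mathfrak g$ be a complex semisimple Lie algebra with adjoint group $G$; $\mathfrak z(x_1,x_2)$ denotes the simultaneous centralizer in $\mathfrak g$. A principal nilpotent pair is a pair $\mathbf e=(e_1,e_2)\in\mathfrak g\oplus\mathfrak g$ with $[e_1,e_2]=0$, $\dim\mathfrak z(e_1,e_2)=\operatorname{rk}\mathfrak g$, and such that for every $(t_1,t_2)\in(\mathbb C^* )^2$ there is $g\in G$ with $\operatorname{Ad}g(e_i)=t_ie_i$ ($i=1,2$). *)

(* Defs.v *)
From HB Require Import structures.
From mathcomp Require Import all_boot all_order all_algebra.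
From mathcomp Require Import complex.
From mathcomp Require Import reals.
Set Implicit Arguments. Unset Strict Implicit. Unset Printing Implicit Defensive.
Import Order.TTheory GRing.Theory Num.Theory.
Local Open Scope ring_scope.

(* The complex numbers: C := complex R for a (Dedekind complete) realType R.
   A finite-dimensional complex Lie algebra g is modelled on 'rV[C]_n with a
   bracket br. Linear maps act on row vectors on the right (v *m A). *)

Section LieDefs.
Variable R : realType.
Local Notation C := (complex R).
Variable n : nat.
Local Notation V := 'rV[C]_n.
Variable br : V -> V -> V.

Definition is_lie_bracket : Prop :=
  [/\ (forall (a : C) (x y z : V), br (a *: x + y) z = a *: br x z + br y z),
      (forall (a : C) (x y z : V), br x (a *: y + z) = a *: br x y + br x z),
      (forall x : V, br x x = 0)
    & (forall x y z : V, br x (br y z) + br y (br z x) + br z (br x y) = 0)].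

Definition adm (x : V) : 'M[C]_n := lin1_mx (br x).

(* subspaces are represented by matrices whose rows span them (mxalgebra) *)
Definition is_ideal m (I : 'M[C]_(m, n)) : Prop :=
  forall x y : V, (y <= I)%MS -> (br x y <= I)%MS.

Definition derived (I : 'M[C]_n) : 'M[C]_n :=
  (\sum_(i < n) \sum_(j < n) <<br (row i I) (row j I)>>)%MS.

Definition solvable_sub (I : 'M[C]_n) : Prop :=
  exists k, (iter k derived I == (0 : 'M[C]_n))%MS.

Definition semisimple : Prop :=
  forall I : 'M[C]_n, is_ideal I -> solvable_sub I -> (I == (0 : 'M[C]_n))%MS.

Definition dim_z2 (x1 x2 : V) : nat := \rank (kermx (row_mx (adm x1) (adm x2))).
Definition dim_z (x : V) : nat := \rank (kermx (adm x)).

Definition is_lie_rank (r : nat) : Prop :=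
  (exists x : V, dim_z x = r) /\ (forall x : V, (r <= dim_z x)%N).

(* exp (ad x) for ad-nilpotent x (the series is finite) *)
Definition exp_ad (x : V) : 'M[C]_n :=
  \sum_(k < n.+1) ((k`!)%:R^-1 *: (adm x) ^+ k).

Definition ad_nilpotent (x : V) : Prop := (adm x) ^+ n = 0.

(* The adjoint group G: the group of automorphisms of g generated by the
   exp(ad x), x ad-nilpotent (closed under inverses since
   exp(ad x)^-1 = exp(ad (-x))). *)
Definition in_adjoint_group (g : 'M[C]_n) : Prop :=
  exists s : seq V, (forall x, x \in s -> ad_nilpotent x) /\
                    g = \prod_(x <- s) exp_ad x.

Definition principal_nilpotent_pair (e1 e2 : V) : Prop :=
  [/\ br e1 e2 = 0,
      (exists r, is_lie_rank r /\ dim_z2 e1 e2 = r)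
    & (forall t1 t2 : C, t1 != 0 -> t2 != 0 ->
         exists g, in_adjoint_group g /\ e1 *m g = t1 *: e1 /\ e2 *m g = t2 *: e2)].

Definition in_diag_orbit (e f : V * V) : Prop :=
  exists g, in_adjoint_group g /\ f.1 = e.1 *m g /\ f.2 = e.2 *m g.

End LieDefs.

(* Main.v *)
Require Import Defs.
From HB Require Import structures.
From mathcomp Require Import all_boot all_order all_algebra.
From mathcomp Require Import complex.
From mathcomp Require Import reals.
From mathcomp Require Import closed_field boolp ring zify.
From mathcomp Require sequences exp.
Set Implicit Arguments. Unset Strict Implicit. Unset Printing Implicit Defensive.
Import Order.TTheory GRing.Theory Num.Theory.
Local Open Scope ring_scope.

(** A principal nilpotent pair [(e1, e2)] has a grading element: some [g] in [G]
    multiplies [e1], [e2] by [exp 1], [exp (sqrt 2)]; the logarithms of the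
    absolute values of the eigenvalues of [g] define a derivation, hence an [h]
    with [[h, e1] = e1], [[h, e2] = sqrt 2 e2] and [ad h] real diagonalizable.
    As [1] and [sqrt 2] are independent over the rationals, the eigenvalues
    [a + b sqrt 2] of [ad h] record a bigrading.

    Let [r] be the rank. Adding up the Koszul complexes
    [g(a,b) -> g(a+1,b) + g(a,b+1) -> g(a+1,b+1)] over [a, b >= 0], the dimensions
    telescope to the Euler characteristic [dim z(h) >= r]. Their [H^0] and (by
    the Killing form) [H^2] are parts of [z(e1, e2)] in the disjoint ranges of
    bidegrees [(>= 0, >= 0)] and [(<= -1, <= -1)], of total dimension at most [r].
    So [dim z(h) = r], the middle cohomology vanishes, and [z(e1, e2)] lives in
    these bidegrees. It follows that the triple [(h, e1, e2)] is rigid: the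
    tangent space at the triple to the solutions of
    [[h, e1] = e1], [[h, e2] = sqrt 2 e2], [[e1, e2] = 0] is that of its orbit,
    and the stabilizer in [g] is zero.

    A polynomial system has only finitely many orbits of such points. Otherwise
    arbitrarily many of them are transversal to the same coordinate slices;
    by quantifier elimination the projection of each of these orbits contains
    a nonempty principal open set, so one slice meets all of them. This yields
    arbitrarily many nondegenerate zeros of systems differing only in their
    constant terms, whereas their number is bounded: each coordinate is
    algebraic over the functions of the system. *)

(** * Nondegenerate zeros of polynomial maps *)

Section PolynomialExpressions.
Variable K : numClosedFieldType.

(** The pair alone has an [r]-dimensional infinitesimal stabilizer; adding [h] brings it down to 0.
    The orbit of a triple therefore has [n] independent directions, and a product of [n]
    exponentials of nilpotent elements is a polynomial family inside it with injective differential
    at the triple. Such a family may miss much of the orbit, but only an open piece of its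
    projection to coordinates is used. The bound on zeros must be uniform in the constant terms,
    because the position of the common slice depends on the orbits that it has to meet.

    The vanishing of the stabilizer exploits that the bidegree restriction on [z(e1, e2)] holds for
    every [h] with the given action on [e1] and [e2], diagonalizable or not: if [x] centralizes the
    triple and [ad x] is not nilpotent, a suitable complex multiple of [x] added to [h] yields a
    nonreal degree, which the restriction forbids. Nilpotent [x] are excluded by the Killing form,
    since [z(h)] is abelian, having the minimal dimension [r]. *)

Inductive pexp (N : nat) : Type :=
  | PConst of K
  | PVar of 'I_N
  | PAdd of pexp N & pexp N
  | PMul of pexp N & pexp N.
Arguments PConst {N}.
Arguments PVar {N}.

(** The ring varies: the same expression is evaluated at points over [K] and, with [c := polyC],
    along polynomial arcs. *)
Fixpoint pev (A : comNzRingType) (c : K -> A) N (x : 'I_N -> A) (t : pexp N) : A :=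
  match t with
  | PConst a => c a
  | PVar i => x i
  | PAdd t1 t2 => pev c x t1 + pev c x t2
  | PMul t1 t2 => pev c x t1 * pev c x t2
  end.

Lemma eq_pev (A : comNzRingType) (c : K -> A) N (x y : 'I_N -> A) t :
  x =1 y -> pev c x t = pev c y t.
Proof. by move=> xy; elim: t => //= t1 -> t2 ->. Qed.

Fixpoint pdiff N (i : 'I_N) (t : pexp N) : pexp N :=
  match t with
  | PConst a => PConst 0
  | PVar j => PConst (i == j)%:R
  | PAdd t1 t2 => PAdd (pdiff i t1) (pdiff i t2)
  | PMul t1 t2 => PAdd (PMul (pdiff i t1) t2) (PMul t1 (pdiff i t2))
  end.

(** The increment [e] is a ring element, so [e = 'X ^+ k.+1] yields congruences modulo powers of
    ['X]. *)
Lemma pev_taylor (A : comNzRingType) (c : {rmorphism K -> A}) N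
    (x v : 'I_N -> A) (e : A) (t : pexp N) :
  exists r, pev c (fun i => x i + e * v i) t =
    pev c x t + e * (\sum_i v i * pev c x (pdiff i t)) + e ^+ 2 * r.
Proof.
elim: t => [a|j|t1 [r1 IH1] t2 [r2 IH2]|t1 [r1 IH1] t2 [r2 IH2]] /=.
- exists 0; rewrite big1 ?mulr0 ?addr0 // => i _.
  by rewrite rmorph0 mulr0.
- exists 0; rewrite (bigD1 j) //= eqxx rmorph1 mulr1 big1.
    by rewrite mulr0 !addr0.
  by move=> i /negPf ->; rewrite rmorph0 mulr0.
- exists (r1 + r2); rewrite IH1 IH2.
  have -> : \sum_i v i * (pev c x (pdiff i t1) + pev c x (pdiff i t2)) =
    \sum_i v i * pev c x (pdiff i t1) + \sum_i v i * pev c x (pdiff i t2).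
    by rewrite -big_split; apply: eq_bigr => i _; rewrite mulrDr.
  by ring.
rewrite IH1 IH2.
set s1 := \sum_i _; set s2 := \sum_i v i * pev c x (pdiff i t2).
have -> : \sum_i v i * (pev c x (pdiff i t1) * pev c x t2 +
            pev c x t1 * pev c x (pdiff i t2)) =
          s1 * pev c x t2 + pev c x t1 * s2.
  rewrite big_distrl big_distrr -big_split /=; apply: eq_bigr => i _.
  by ring.
exists (pev c x t1 * r2 + r1 * pev c x t2 + s1 * s2 + e * (s1 * r2 + r1 * s2) + e ^+ 2 * r1 * r2).
by ring.
Qed.

Lemma pev_cong (A : comNzRingType) (c : {rmorphism K -> A}) N
    (x v : 'I_N -> A) (e : A) (t : pexp N) :
  exists r, pev c (fun i => x i + e * v i) t = pev c x t + e * r.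
Proof.
have [r ->] := pev_taylor c x v e t.
by exists (\sum_i v i * pev c x (pdiff i t) + e * r); ring.
Qed.

Lemma pev_horner N (u : 'I_N -> {poly K}) (s : K) t :
  (pev (@polyC K) u t).[s] = pev id (fun i => (u i).[s]) t.
Proof.
elim: t => [a|j|t1 IH1 t2 IH2|t1 IH1 t2 IH2] //=.
- by rewrite hornerC.
- by rewrite hornerD IH1 IH2.
- by rewrite hornerM IH1 IH2.
Qed.

Lemma poly_ext0 (p : {poly K}) : (forall s : K, p.[s] = 0) -> p = 0.
Proof.
move=> p0; case: (eqVneq p 0) => // pn0.
have ua : uniq [seq (i%:R : K) | i <- iota 0 (size p)].
  by rewrite map_inj_uniq ?iota_uniq // => a b /eqP; rewrite eqr_nat => /eqP.
have ra : all (root p) [seq (i%:R : K) | i <- iota 0 (size p)].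
  by apply/allP => x /mapP[i _ ->]; rewrite /root p0.
by have := max_poly_roots pn0 ra ua; rewrite size_map size_iota ltnn.
Qed.

(* Newton iteration along a polynomial arc, modulo X^(k+1). *)
Lemma arc_lifting N (T : 'I_N -> pexp N) (p b : 'I_N -> K) (k : nat) :
  (\matrix_(i, j) pev id p (pdiff i (T j)) : 'M[K]_N) \in unitmx ->
  exists u : 'I_N -> {poly K}, (forall i, (u i).[0] = p i) /\
   forall j, exists r, pev (@polyC K) u (T j) =
     (pev id p (T j))%:P + 'X * (b j)%:P + 'X ^+ k.+1 * r.
Proof.
set J := \matrix_(i, j) _ => uJ.
have modX (q : {poly K}) : exists r, q = (q.[0])%:P + 'X * r.
  have /factor_theorem [r hr] : root (q - (q.[0])%:P) 0.
    by rewrite /root hornerD hornerN hornerC subrr.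
  exists r; rewrite -[LHS](subrK (q.[0])%:P) hr subr0.
  by rewrite addrC mulrC.
elim: k => [|k [u [u0 IH]]].
  (* Modulo ['X] the constant arc suffices: the term ['X * (b j)%:P] is absorbed by the
     remainder. *)
  exists (fun i => (p i)%:P); split=> [i|j]; first by rewrite hornerC.
  have [r hr] := modX (pev (@polyC K) (fun i => (p i)%:P) (T j)).
  exists (r - (b j)%:P); rewrite hr expr1 pev_horner.
  rewrite (@eq_pev _ _ _ _ p); last by move=> i; rewrite hornerC.
  by ring.
have [r hr] := choice IH.
(* Moving the arc by ['X ^+ k.+1 * v] changes the error at that order by [v *m J], which is made to
   cancel the constant terms of [r]. *)
pose v := - (\row_j (r j).[0]) *m invmx J.
have vJ : v *m J = - \row_j (r j).[0] by rewrite mulmxKV.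
exists (fun i => u i + 'X ^+ k.+1 * (v 0 i)%:P); split=> [i|j].
  by rewrite !(hornerE, horner_exp) u0 expr0n /= mul0r addr0.
have [r2 ->] := pev_taylor (@polyC K) u (fun i => (v 0 i)%:P) ('X ^+ k.+1) (T j).
rewrite hr.
set S := \sum_i _.
have S0 : S.[0] = - (r j).[0].
  have /matrixP/(_ 0 j) := vJ; rewrite !mxE => <-.
  rewrite /S horner_sum; apply: eq_bigr => i _.
  rewrite hornerM hornerC pev_horner !mxE; congr (_ * _).
  by apply: eq_pev => l; rewrite u0.
have [rS ->] := modX S; have [rr ->] := modX (r j).
rewrite S0 polyCN; exists (rr + rS + 'X ^+ k * r2).
rewrite !exprS; ring.
Qed.

(** Polynomials enter as functions. The field is infinite, so [exists x, f x != 0] expresses that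
    the polynomial is nonzero. *)
Definition polyfun N (f : 'rV[K]_N -> K) : Prop :=
  exists t, forall x, f x = pev id (x 0) t.

Definition polymap N M (f : 'rV[K]_N -> 'rV[K]_M) : Prop :=
  forall j, polyfun (fun x => f x 0 j).

Lemma polyfun_cst N a : @polyfun N (fun=> a).
Proof. by exists (PConst a). Qed.

Lemma polyfun_coord N i : @polyfun N (fun x => x 0 i).
Proof. by exists (PVar i). Qed.

Lemma polyfunD N (f g : 'rV[K]_N -> K) :
  polyfun f -> polyfun g -> polyfun (fun x => f x + g x).
Proof. by move=> [t ft] [u gu]; exists (PAdd t u) => x /=; rewrite ft gu. Qed.

Lemma polyfunM N (f g : 'rV[K]_N -> K) :
  polyfun f -> polyfun g -> polyfun (fun x => f x * g x).
Proof. by move=> [t ft] [u gu]; exists (PMul t u) => x /=; rewrite ft gu. Qed.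

Lemma eq_polyfun N (f g : 'rV[K]_N -> K) : f =1 g -> polyfun f -> polyfun g.
Proof. by move=> fg [t ft]; exists t => x; rewrite -fg. Qed.

Lemma polyfun_sum N I (r : seq I) (f : I -> 'rV[K]_N -> K) :
  (forall i, polyfun (f i)) -> polyfun (fun x => \sum_(i <- r) f i x).
Proof.
move=> pf; elim: r => [|i r IH].
  by apply: (eq_polyfun _ (polyfun_cst _ 0)) => x; rewrite big_nil.
by apply: (eq_polyfun _ (polyfunD (pf i) IH)) => x; rewrite big_cons.
Qed.

Lemma polyfun_prod N I (r : seq I) (f : I -> 'rV[K]_N -> K) :
  (forall i, polyfun (f i)) -> polyfun (fun x => \prod_(i <- r) f i x).
Proof.
move=> pf; elim: r => [|i r IH].
  by apply: (eq_polyfun _ (polyfun_cst _ 1)) => x; rewrite big_nil.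
by apply: (eq_polyfun _ (polyfunM (pf i) IH)) => x; rewrite big_cons.
Qed.

Lemma polyfunX N (f : 'rV[K]_N -> K) k :
  polyfun f -> polyfun (fun x => f x ^+ k).
Proof.
move=> pf; elim: k => [|k IH].
  by apply: (eq_polyfun _ (polyfun_cst _ 1)) => x.
by apply: (eq_polyfun _ (polyfunM pf IH)) => x; rewrite exprS.
Qed.

Lemma polyfun_comp N M (f : 'rV[K]_M -> K) (g : 'rV[K]_N -> 'rV[K]_M) :
  polyfun f -> polymap g -> polyfun (fun x => f (g x)).
Proof.
move=> [t ft] pg.
apply: (@eq_polyfun _ (fun x => pev id (g x 0) t)) => [x|]; first by rewrite ft.
elim: t {ft} => [a|i|t1 IH1 t2 IH2|t1 IH1 t2 IH2] /=.
- exact: polyfun_cst.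
- exact: pg.
- exact: polyfunD.
- exact: polyfunM.
Qed.

Lemma polyfun_det N M (f : 'rV[K]_N -> 'M[K]_M) :
  (forall i j, polyfun (fun x => f x i j)) -> polyfun (fun x => \det (f x)).
Proof.
move=> pf; apply: polyfun_sum => s; apply: polyfunM; first exact: polyfun_cst.
exact: polyfun_prod.
Qed.

Lemma polyfun_line N (f : 'rV[K]_N -> K) (a v : 'rV[K]_N) :
  polyfun f -> exists p : {poly K}, forall s, p.[s] = f (a + s *: v).
Proof.
move=> [t ft].
exists (pev (@polyC K) (fun i => (a 0 i)%:P + 'X * (v 0 i)%:P) t) => s.
rewrite pev_horner ft; apply: eq_pev => i.
by rewrite !hornerE !mxE.
Qed.

Lemma poly_nonroot (p : {poly K}) : p != 0 -> exists s, p.[s] != 0.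
Proof.
move=> pn0; apply: contrapT => h; case/eqP: pn0; apply: poly_ext0 => s.
by apply/eqP; apply: contrapT => /negP hs; apply: h; exists s.
Qed.

(** On the line joining a nonzero of [f] to a nonzero of [g] both become nonzero polynomials in one
    variable, whose product is nonzero. *)
Lemma polyfun_mul_neq0 N (f g : 'rV[K]_N -> K) :
  polyfun f -> polyfun g -> (exists x, f x != 0) -> (exists x, g x != 0) ->
  exists x, f x * g x != 0.
Proof.
move=> pf pg [a fa] [b gb].
have [p hp] := polyfun_line a (b - a) pf.
have [q hq] := polyfun_line a (b - a) pg.
have pn0 : p != 0.
  by apply: contra_neq fa => p0; have := hp 0; rewrite p0 horner0 scale0r addr0.
have qn0 : q != 0.
  apply: contra_neq gb => q0; have := hq 1.
  by rewrite q0 horner0 scale1r addrC subrK.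
have [s] := poly_nonroot (mulf_neq0 pn0 qn0).
by rewrite hornerM hp hq => ?; exists (a + s *: (b - a)).
Qed.

Lemma polyfun_prod_neq0 N M (f : 'I_M -> 'rV[K]_N -> K) :
  (forall i, polyfun (f i)) -> (forall i, exists x, f i x != 0) ->
  exists x, forall i, f i x != 0.
Proof.
move=> pf nf.
suff [x hx] : exists x, \prod_i f i x != 0.
  by exists x => i; move/prodf_neq0: hx; apply.
elim: (index_enum _) => [|i r [x IH]].
  by exists 0; rewrite big_nil oner_neq0.
have [y hy] := polyfun_mul_neq0 (pf i) (polyfun_prod r pf) (nf i) (ex_intro _ x IH).
by exists y; rewrite big_cons.
Qed.

(** * Quantifier elimination and generic truth values *)

Fixpoint pexp_of_term k (t : GRing.term K) : pexp k :=
  match t with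
  | GRing.Var i => if insub i is Some j then PVar j else PConst 0
  | GRing.Const a => PConst a
  | GRing.NatConst m => PConst m%:R
  | GRing.Add t1 t2 => PAdd (pexp_of_term k t1) (pexp_of_term k t2)
  | GRing.Opp t1 => PMul (PConst (-1)) (pexp_of_term k t1)
  | GRing.NatMul t1 m => PMul (PConst m%:R) (pexp_of_term k t1)
  | GRing.Mul t1 t2 => PMul (pexp_of_term k t1) (pexp_of_term k t2)
  | GRing.Inv t1 => PConst 0
  | GRing.Exp t1 m => iter m (PMul (pexp_of_term k t1)) (PConst 1)
  end.

Fixpoint term_of_pexp N (v : 'I_N -> nat) (t : pexp N) : GRing.term K :=
  match t with
  | PConst a => GRing.Const a
  | PVar i => GRing.Var K (v i)
  | PAdd t1 t2 => GRing.Add (term_of_pexp v t1) (term_of_pexp v t2)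
  | PMul t1 t2 => GRing.Mul (term_of_pexp v t1) (term_of_pexp v t2)
  end.

Definition env k (y : 'rV[K]_k) : seq K := codom (y 0).

Lemma nth_env k (y : 'rV[K]_k) (i : 'I_k) s : nth 0 (env y ++ s) i = y 0 i.
Proof.
rewrite nth_cat size_codom card_ord ltn_ord.
by rewrite (nth_map i) ?size_enum_ord // nth_ord_enum.
Qed.

(** [GRing.rterm] excludes inverses, which are sent to a default; variables beyond [k] become 0
    because [env y] returns 0 there. *)
Lemma pev_of_term k (y : 'rV[K]_k) (t : GRing.term K) :
  GRing.rterm t -> pev id (y 0) (pexp_of_term k t) = GRing.eval (env y) t.
Proof.
elim: t => //=.
- move=> i _; case: insubP => [j _ <-|] /=.
    by rewrite -(nth_env y j [::]) cats0.
  by rewrite -leqNgt => ki; rewrite nth_default // size_codom card_ord.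
- by move=> t1 IH1 t2 IH2 /andP[/IH1 -> /IH2 ->].
- by move=> t IH /IH ->; rewrite mulN1r.
- by move=> t IH m /IH ->; rewrite mulr_natl.
- by move=> t1 IH1 t2 IH2 /andP[/IH1 -> /IH2 ->].
- move=> t IH m /IH {}IH; elim: m => //= m ->; by rewrite IH exprS.
Qed.

Lemma eval_of_pexp N (v : 'I_N -> nat) (e : seq K) t :
  GRing.eval e (term_of_pexp v t) = pev id (fun i => e`_(v i)) t.
Proof. by elim: t => //= t1 -> t2 ->. Qed.

Lemma rterm_of_pexp N (v : 'I_N -> nat) t : GRing.rterm (term_of_pexp v t).
Proof. by elim: t => //= t1 -> t2 ->. Qed.

(** Each atomic equation is an identity or fails off a hypersurface. Off the union of these
    hypersurfaces every atom has a fixed truth value, hence so has the formula. *)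
Lemma qf_generic k (f : GRing.formula K) :
  GRing.qf_form f -> GRing.rformula f ->
  exists q : 'rV[K]_k -> K, [/\ polyfun q, exists y, q y != 0 &
   exists b, forall y, q y != 0 -> GRing.qf_eval (env y) f = b].
Proof.
have comb (f1 f2 : GRing.formula K) (o : bool -> bool -> bool) :
  (exists q : 'rV[K]_k -> K, [/\ polyfun q, exists y, q y != 0 &
   exists b, forall y, q y != 0 -> GRing.qf_eval (env y) f1 = b]) ->
  (exists q : 'rV[K]_k -> K, [/\ polyfun q, exists y, q y != 0 &
   exists b, forall y, q y != 0 -> GRing.qf_eval (env y) f2 = b]) ->
  exists q : 'rV[K]_k -> K, [/\ polyfun q, exists y, q y != 0 &
   exists b, forall y, q y != 0 ->
     o (GRing.qf_eval (env y) f1) (GRing.qf_eval (env y) f2) = b].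
  move=> [q1 [pq1 nq1 [b1 h1]]] [q2 [pq2 nq2 [b2 h2]]].
  exists (fun y => q1 y * q2 y); split; first exact: polyfunM.
    exact: polyfun_mul_neq0.
  by exists (o b1 b2) => y; rewrite mulf_eq0 negb_or => /andP[/h1 -> /h2 ->].
elim: f => //=.
- move=> b _ _; exists (fun=> 1); split; first exact: polyfun_cst.
    by exists 0; rewrite oner_neq0.
  by exists b.
- move=> t1 t2 _ /andP[r1 r2].
  pose q (y : 'rV[K]_k) := GRing.eval (env y) t1 - GRing.eval (env y) t2.
  have pq : polyfun q.
    exists (PAdd (pexp_of_term k t1) (PMul (PConst (-1)) (pexp_of_term k t2))).
    by move=> y /=; rewrite !pev_of_term // mulN1r.
  case: (pselect (exists y, q y != 0)) => [nq|nq].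
    exists q; split=> //; exists false => y; rewrite /q subr_eq0.
    by move/negPf.
  exists (fun=> 1); split; first exact: polyfun_cst.
    by exists 0; rewrite oner_neq0.
  exists true => y _; apply: contrapT => /negP h; apply: nq; exists y.
  by rewrite /q subr_eq0.
- by move=> f1 IH1 f2 IH2 /andP[q1 q2] /andP[r1 r2]; apply: comb; auto.
- by move=> f1 IH1 f2 IH2 /andP[q1 q2] /andP[r1 r2]; apply: comb; auto.
- by move=> f1 IH1 f2 IH2 /andP[q1 q2] /andP[r1 r2]; apply: (comb f1 f2 implb); auto.
- move=> f IH qf rf; have [q [pq nq [b hb]]] := IH qf rf.
  by exists q; split=> //; exists (~~ b) => y /hb ->.
Qed.

(** The quantified variables are numbered from [size e] on, so assigning them in turn appends to the
    environment. *)
Lemma holds_exists_iota (f : GRing.formula K) n (e : seq K) :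
  GRing.holds e (foldr GRing.Exists f (iota (size e) n)) <->
  exists2 s : seq K, size s = n & GRing.holds (e ++ s) f.
Proof.
have snth (e' : seq K) x : set_nth 0 e' (size e') x = rcons e' x.
  by elim: e' => //= a e' ->.
elim: n e => [|n IH] e /=.
  split=> [h|[s /size0nil -> ]]; last by rewrite cats0.
  by exists [::]; rewrite ?cats0.
split=> [[x]|[[|x s] //= [sz] h]].
  rewrite snth -(size_rcons e x) => /IH[s ss h].
  by exists (x :: s); rewrite /= ?ss // -cat_rcons.
exists x; rewrite snth -(size_rcons e x); apply/IH.
by exists s => //; rewrite cat_rcons.
Qed.

(** A weak form of Chevalley's theorem. The formula [G] says that [y] is the image of some [x] with
    [d x != 0]; its generic truth value decides whether the image contains a principal open set or
    lies in a hypersurface. *)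
Lemma image_generic N k (T : 'rV[K]_N -> 'rV[K]_k) (d : 'rV[K]_N -> K) :
  polymap T -> polyfun d ->
  exists q : 'rV[K]_k -> K, [/\ polyfun q, exists y, q y != 0 &
    (forall y, q y != 0 -> exists2 x, T x = y & d x != 0) \/
    (forall x, d x != 0 -> q (T x) = 0)].
Proof.
move=> pT [td hd]; have [tT hT] := choice pT.
pose v (i : 'I_N) := (k + i)%N.
pose F0 : GRing.formula K := GRing.Not (GRing.Equal (term_of_pexp v td) (GRing.Const 0)).
pose F : GRing.formula K :=
  foldr GRing.And F0
   [seq GRing.Equal (term_of_pexp v (tT j)) (GRing.Var K j) | j <- enum 'I_k].
have rF : GRing.rformula F.
  rewrite /F; elim: (enum 'I_k) => [|j r IH] /=; first by rewrite rterm_of_pexp.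
  by rewrite rterm_of_pexp.
pose G := foldr GRing.Exists F (iota k N).
have rG : GRing.rformula G by rewrite /G; elim: (iota k N).
have holdsF y x : GRing.holds (env y ++ env x) F <-> T x = y /\ d x != 0.
  have ev t : GRing.eval (env y ++ env x) (term_of_pexp v t) = pev id (x 0) t.
    rewrite eval_of_pexp; apply: eq_pev => i.
    rewrite /v nth_cat size_codom card_ord ltnNge leq_addr /= addKn.
    by rewrite -(nth_env x i [::]) cats0.
  have -> : GRing.holds (env y ++ env x) F <->
     (forall j, j \in enum 'I_k -> T x 0 j = y 0 j) /\ d x != 0.
    rewrite /F; elim: (enum 'I_k) => [|j r IH] /=.
      rewrite ev -hd; split=> [h|[_ /eqP//]]; split=> //.
      by apply/eqP.
    rewrite ev -hT nth_env; split.
      case=> h /IH[h1 h2]; split=> // i; rewrite inE => /predU1P[->//|]; exact: h1.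
    case=> h1 h2; split; first by apply: h1; rewrite mem_head.
    by apply/IH; split=> // i ir; apply: h1; rewrite inE ir orbT.
  split=> [[h1 h2]|[<- h2]]; split=> //.
  by apply/rowP => j; apply: h1; rewrite mem_enum.
have holdsG y : GRing.holds (env y) G <-> exists2 x, T x = y & d x != 0.
  have sy : size (env y) = k by rewrite size_codom card_ord.
  rewrite /G -[in iota k N]sy holds_exists_iota; split.
    case=> s ss; have -> : s = env (\row_i s`_i : 'rV_N).
      apply: (@eq_from_nth _ 0); first by rewrite size_codom card_ord.
      move=> i; rewrite ss => iN.
      by have := nth_env (\row_(i < N) s`_i) (Ordinal iN) [::]; rewrite cats0 mxE.
    by move/holdsF => [? ?]; eexists; eauto.
  case=> x h1 h2; exists (env x); first by rewrite size_codom card_ord.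
  exact/holdsF.
pose QG := GRing.quantifier_elim (@ClosedFieldQE.ex_elim K) G.
have solve := @solve_monicpoly K.
have QGP e : reflect (GRing.holds e G) (GRing.qf_eval e QG).
  apply: GRing.quantifier_elim_rformP => //.
  - exact: ClosedFieldQE.wf_ex_elim.
  - exact: ClosedFieldQE.holds_ex_elim.
have /andP[qQ rQ] : GRing.qf_form QG && GRing.rformula QG.
  by apply: GRing.quantifier_elim_wf => //; exact: ClosedFieldQE.wf_ex_elim.
have [q [pq nq [b hb]]] := qf_generic k qQ rQ.
exists q; split=> //; case: b hb => hb; [left|right].
  by move=> y /hb /QGP /holdsG.
move=> x dx; apply/eqP; apply: contrapT => /negP /hb /QGP; apply.
by apply/holdsG; exists x.
Qed.

(** * Images of maps with invertible Jacobian *)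

Definition evmap N M (T : 'I_M -> pexp N) (x : 'rV[K]_N) : 'rV[K]_M :=
  \row_j pev id (x 0) (T j).

Definition jac N M (T : 'I_M -> pexp N) (x : 'rV[K]_N) : 'M[K]_(N, M) :=
  \matrix_(i, j) pev id (x 0) (pdiff i (T j)).

Lemma polymap_evmap N M (T : 'I_M -> pexp N) : polymap (evmap T).
Proof. by move=> j; exists (T j) => x; rewrite mxE. Qed.

Lemma polyfun_jac N M (T : 'I_M -> pexp N) i j : polyfun (fun x => jac T x i j).
Proof. by exists (pdiff i (T j)) => x; rewrite mxE. Qed.

(** If [q y != 0], the restriction [L] of [q] to the line from [evmap T p] to [y] is nonzero. Lift
    the line to an arc through [p], up to an order beyond the size of [L]: then [L] is congruent to
    [q] along the image of the arc, which is 0, and this forces [L = 0]. *)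
Lemma dominant N (T : 'I_N -> pexp N) (p : 'rV[K]_N) (d q : 'rV[K]_N -> K) :
  jac T p \in unitmx -> polyfun d -> d p != 0 -> polyfun q ->
  (forall x, d x != 0 -> q (evmap T x) = 0) -> forall y, q y = 0.
Proof.
move=> uJ [td hd] dp [tq hq] h y; apply/eqP; apply: contrapT => /negP qy.
pose a := evmap T p; pose b := y - a.
pose l i : {poly K} := (a 0 i)%:P + 'X * (b 0 i)%:P.
pose L := pev (@polyC K) l tq.
have L1 : L.[1] = q y.
  rewrite pev_horner hq; apply: eq_pev => i.
  by rewrite !hornerE [b 0 i]mxE [X in _ + (_ + X)]mxE addrC subrK.
have Ln0 : L != 0 by apply: contra_neq qy => L0; rewrite -L1 L0 horner0.
have [u [u0 hu]] := arc_lifting (b 0) (size L) uJ.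
have [r hr] := choice hu.
(* At parameter 0 the arc is at [p], where [d] is nonzero; so [d] is a nonzero polynomial along the
   arc and can be cancelled. *)
have P0 : pev (@polyC K) (fun j => pev (@polyC K) u (T j)) tq = 0.
  have : pev (@polyC K) (fun j => pev (@polyC K) u (T j)) tq *
    pev (@polyC K) u td = 0.
    apply: poly_ext0 => s; rewrite hornerM !pev_horner.
    pose us : 'rV[K]_N := \row_i (u i).[s].
    have -> : pev id (fun i => (u i).[s]) td = d us.
      by rewrite hd; apply: eq_pev => i; rewrite mxE.
    have -> : pev id (fun i => (pev (@polyC K) u (T i)).[s]) tq = q (evmap T us).
      rewrite hq; apply: eq_pev => i; rewrite mxE pev_horner.
      by apply: eq_pev => j; rewrite mxE.
    by have [->|/h->] := eqVneq (d us) 0; rewrite ?mulr0 ?mul0r.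
  move/eqP; rewrite mulf_eq0 => /orP[/eqP//|/eqP d0]; case/eqP: dp.
  have := congr1 (fun P => P.[0]) d0; rewrite /= pev_horner horner0 hd => <-.
  by apply: eq_pev => i; rewrite u0.
have [r' hr'] := pev_cong (@polyC K) l r ('X ^+ (size L).+1) tq.
have : L = - ('X ^+ (size L).+1 * r').
  apply/eqP; rewrite -addr_eq0 -/L -[X in _ == X]P0 -hr'; apply/eqP/eq_pev => j.
  by rewrite hr /l /a mxE.
move=> LE; have rn0 : r' != 0.
  by apply: contra_neq Ln0 => r0; rewrite LE r0 mulr0 oppr0.
have : (size L >= (size L).+1)%N.
  rewrite {2}LE size_polyN mulrC size_mulXn //; exact: leq_addr.
by rewrite ltnn.
Qed.

Lemma image_open N (T : 'I_N -> pexp N) (p : 'rV[K]_N) (d : 'rV[K]_N -> K) :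
  jac T p \in unitmx -> polyfun d -> d p != 0 ->
  exists q : 'rV[K]_N -> K, [/\ polyfun q, exists y, q y != 0 &
    forall y, q y != 0 -> exists2 x, evmap T x = y & d x != 0].
Proof.
move=> uJ pd dp.
have [q [pq [y qy] [h|h]]] := image_generic (polymap_evmap T) pd.
  by exists q; split=> //; exists y.
by move: qy; rewrite (dominant uJ pd dp pq h) eqxx.
Qed.

(** * A uniform bound on the number of nondegenerate zeros *)

Definition degle N c (f : 'rV[K]_N -> K) : Prop :=
  exists k : {ffun 'I_N -> 'I_c.+1} -> K,
  forall x, f x = \sum_a k a * \prod_i x 0 i ^+ a i.

(** Bounding the degree in each variable separately makes the exponent vectors a finite function
    type, easy to count. Indices with equal exponent vectors are collected here. *)
Lemma degle_sum N c (I : finType) (g : I -> K) (e : I -> 'I_N -> nat)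
    (f : 'rV[K]_N -> K) :
  (forall i j, (e i j <= c)%N) ->
  (forall x, f x = \sum_i g i * \prod_j x 0 j ^+ e i j) -> degle c f.
Proof.
move=> le_e hf.
pose F i : {ffun 'I_N -> 'I_c.+1} := [ffun j => inord (e i j)].
exists (fun a => \sum_(i | F i == a) g i) => x.
rewrite hf (partition_big F xpredT) //=; apply: eq_bigr => a _.
rewrite big_distrl /=; apply: eq_bigr => i /eqP <-; congr (_ * _).
by apply: eq_bigr => j _; rewrite ffunE inordK // ltnS.
Qed.

Lemma degle_cst N c a : @degle N c (fun=> a).
Proof.
apply: (@degle_sum _ _ unit (fun=> a) (fun _ _ => 0%N)) => // x.
by rewrite (big_pred1 tt) => [|[]//]; rewrite big1 ?mulr1.
Qed.

Lemma degle_coord N c i : (0 < c)%N -> @degle N c (fun x => x 0 i).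
Proof.
move=> c0; apply: (@degle_sum _ _ unit (fun=> 1) (fun _ j => nat_of_bool (j == i))).
  by move=> _ j; case: (j == i).
move=> x; rewrite (big_pred1 tt) => [|[]//]; rewrite mul1r (bigD1 i) //= eqxx.
by rewrite big1 ?mulr1 // => j /negPf ->.
Qed.

Lemma degleD N c (f g : 'rV[K]_N -> K) :
  degle c f -> degle c g -> degle c (fun x => f x + g x).
Proof.
move=> [k hk] [l hl]; exists (fun a => k a + l a) => x.
by rewrite hk hl -big_split /=; apply: eq_bigr => a _; rewrite mulrDl.
Qed.

Lemma degleM N c d (f g : 'rV[K]_N -> K) :
  degle c f -> degle d g -> degle (c + d)%N (fun x => f x * g x).
Proof.
move=> [k hk] [l hl].
pose I := ({ffun 'I_N -> 'I_c.+1} * {ffun 'I_N -> 'I_d.+1})%type.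
apply: (@degle_sum _ _ I (fun p => k p.1 * l p.2) (fun p j => p.1 j + p.2 j)%N).
  by move=> p j; rewrite leq_add // -ltnS ltn_ord.
move=> x; rewrite hk hl big_distrl /= -(pair_big xpredT xpredT
  (fun a b => k a * l b * \prod_j x 0 j ^+ (a j + b j))) /=.
apply: eq_bigr => a _; rewrite big_distrr /=; apply: eq_bigr => b _.
rewrite mulrACA -big_split /=; congr (_ * _).
by apply: eq_bigr => j _; rewrite exprD.
Qed.

Lemma degle_mono N c d (f : 'rV[K]_N -> K) : (c <= d)%N -> degle c f -> degle d f.
Proof.
move=> cd [k hk]; apply: (degle_sum _ hk) => a j.
by rewrite (leq_trans _ cd) // -ltnS.
Qed.

Lemma eq_degle N c (f g : 'rV[K]_N -> K) : f =1 g -> degle c f -> degle c g.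
Proof. by move=> fg [t ft]; exists t => x; rewrite -fg. Qed.

Lemma degle_prod N c I (r : seq I) (P : pred I) (f : I -> 'rV[K]_N -> K) :
  (forall i, degle c (f i)) ->
  degle (c * size r)%N (fun x => \prod_(i <- r | P i) f i x).
Proof.
move=> hf; elim: r => [|i r IH].
  by apply: (eq_degle _ (degle_cst _ _ 1)) => x; rewrite big_nil.
have [Pi|nPi] := boolP (P i).
  rewrite /= mulnS; apply: (eq_degle _ (degleM (hf i) IH)) => x.
  by rewrite big_cons Pi.
apply: (@degle_mono _ (c * size r)%N); first by rewrite leq_mul2l leqnSn orbT.
by apply: (eq_degle _ IH) => x; rewrite big_cons (negPf nPi).
Qed.

Lemma pexp_degle N (t : pexp N) : exists c, degle c (fun x => pev id (x 0) t).
Proof.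
elim: t => [a|i|t1 [c1 h1] t2 [c2 h2]|t1 [c1 h1] t2 [c2 h2]] /=.
- by exists 0%N; apply: degle_cst.
- by exists 1%N; apply: degle_coord.
- exists (maxn c1 c2); apply: degleD.
    by apply: degle_mono h1; apply: leq_maxl.
  by apply: degle_mono h2; apply: leq_maxr.
- by exists (c1 + c2)%N; apply: degleM.
Qed.

Lemma left_kernel (I J : finType) (k : I -> J -> K) : (#|J| < #|I|)%N ->
  exists a : I -> K, (exists i, a i != 0) /\ forall j, \sum_i a i * k i j = 0.
Proof.
move=> lt; pose A := \matrix_(i < #|I|, j < #|J|) k (enum_val i) (enum_val j).
have : kermx A != 0.
  rewrite -mxrank_eq0 mxrank_ker subn_eq0 -ltnNge.
  exact: leq_ltn_trans (rank_leq_col A) lt.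
case/rowV0Pn => v /sub_kermxP vA vn0.
exists (fun i => v 0 (enum_rank i)); split.
  have /existsP[i hi] : [exists i, v 0 i != 0].
    apply: contraNT vn0; rewrite negb_exists => /forallP h.
    by apply/eqP/rowP => i; rewrite mxE; apply/eqP; move: (h i); rewrite negbK.
  by exists (enum_val i); rewrite enum_valK.
move=> j; transitivity ((v *m A) 0 (enum_rank j)); last by rewrite vA mxE.
rewrite mxE (reindex_onto enum_val enum_rank) => [|i _]; last exact: enum_rankK.
rewrite (eq_bigl xpredT) => [|i]; last by rewrite enum_valK eqxx.
by apply: eq_bigr => i _; rewrite mxE enum_rankK enum_valK.
Qed.

(* For large [D] the [D^(N+1)] products of one-variable polynomials of degree
   less than [D] evaluated at the [T i] and at the coordinate outnumber the
   monomials they can involve, so they satisfy a linear relation. The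
   polynomials [prod_(b <> a) (y - b)] are used instead of monomials because
   their products are visibly nonzero functions on a grid. *)
Lemma coord_algebraic N (T : 'I_N -> pexp N) (j : 'I_N) :
  exists D (P : 'I_D -> 'rV[K]_N -> K), [/\ forall k, polyfun (P k),
    exists k y, P k y != 0 &
    forall x, \sum_k P k (evmap T x) * x 0 j ^+ k = 0].
Proof.
have [c0 hc0] := choice (fun i => pexp_degle (T i)).
pose c := (\max_i c0 i)%N.
have hc i : degle c (fun x => pev id (x 0) (T i)).
  by apply: degle_mono (hc0 i); apply: leq_bigmax.
(* Chosen so that with [L] below [L + 1 <= m * D] and [m ^ N < D]: the [(L + 1) ^ N] monomials are
   then fewer than the [D ^ N * D] products. *)
pose m := (c * N + 2)%N; pose D := (m ^ N + 1)%N.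
have D0 : (0 < D)%N by rewrite /D addn1.
pose I := ({ffun 'I_N -> 'I_D} * 'I_D)%type.
pose l (y : 'rV[K]_N) (a : {ffun 'I_N -> 'I_D}) : K :=
  \prod_i \prod_(b < D | b != a i) (y 0 i - b%:R).
pose g (ak : I) (x : 'rV[K]_N) := l (evmap T x) ak.1 * x 0 j ^+ ak.2.
pose L := (c * D * N + D)%N.
have hg ak : degle L (g ak).
  apply: degleM.
    have szN : size (index_enum 'I_N) = N by rewrite /index_enum -enumT size_enum_ord.
    have szD : size (index_enum 'I_D) = D by rewrite /index_enum -enumT size_enum_ord.
    rewrite -[X in (_ * X)%N]szN; apply: degle_prod => i.
    rewrite -[X in (_ * X)%N]szD; apply: degle_prod => b.
    apply: degleD; last exact: degle_cst.
    by apply: (eq_degle _ (hc i)) => x; rewrite mxE.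
  apply: (@degle_mono _ ak.2); first exact: ltnW.
  elim: (nat_of_ord ak.2) => [|k IH]; first exact: degle_cst.
  have := degleM (@degle_coord N 1 j isT) IH; rewrite add1n.
  by apply: eq_degle => x; rewrite exprS.
have [k hk] := choice hg.
have lt : (#|{ffun 'I_N -> 'I_L.+1}| < #|{: I}|)%N.
  rewrite card_prod !card_ffun !card_ord.
  apply: (@leq_ltn_trans ((m * D) ^ N)%N).
    case: (posnP N) => [->//|N0]; rewrite leq_exp2r //.
    rewrite /L /m mulnDl -mulnA [(D * N)%N]mulnC mulnA -addnS leq_add2l.
    by rewrite mul2n -addnn -addn1 leq_add2l.
  by rewrite expnMn mulnC ltn_mul2l expn_gt0 D0 /= /D addn1 ltnS.
have [al [[[a0 k0] aln0] hal]] := left_kernel k lt.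
exists D, (fun k y => \sum_a al (a, k) * l y a); split.
- move=> k'; apply: polyfun_sum => a; apply: polyfunM; first exact: polyfun_cst.
  apply: polyfun_prod => i.
  apply: (@eq_polyfun _ (fun y : 'rV[K]_N => \prod_(b <- [seq b <- index_enum 'I_D | b != a i]) (y 0 i - b%:R))).
    by move=> y; rewrite big_filter.
  apply: polyfun_prod => b; apply: polyfunD; first exact: polyfun_coord.
  exact: polyfun_cst.
(* At the grid point [a0] every [l y a] with [a] different from [a0] has a vanishing factor, so a
   single term survives. *)
- exists k0, (\row_i (a0 i)%:R); rewrite (bigD1 a0) //= big1 ?addr0.
    rewrite mulf_neq0 //; apply/prodf_neq0 => i _; apply/prodf_neq0 => b ba.
    by rewrite mxE subr_eq0 eqr_nat eq_sym.
  move=> a aa0; have /existsP[i ai] : [exists i, a0 i != a i].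
    apply: contraNT aa0; rewrite negb_exists => /forallP h.
    by apply/eqP/ffunP => i; apply/eqP; move: (h i); rewrite negbK eq_sym.
  rewrite /l (bigD1 i) //= [X in _ * (X * _)](bigD1 (a0 i)) //=.
  by rewrite mxE subrr !mul0r mulr0.
move=> x; transitivity (\sum_ak al ak * g ak x).
  rewrite (eq_bigr (fun ak => al (ak.1, ak.2) * g (ak.1, ak.2) x)); last by case.
  rewrite -(pair_big xpredT xpredT (fun a b => al (a, b) * g (a, b) x)) exchange_big /=.
  apply: eq_bigr => b _; rewrite big_distrl /=.
  by apply: eq_bigr => a _; rewrite mulrA.
under eq_bigr => ak _ do rewrite hk big_distrr /=.
rewrite exchange_big big1 //= => a _.
under eq_bigr => ak _ do rewrite mulrA.
by rewrite -big_distrl /= hal mul0r.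
Qed.

(* The relation [sum_k P k (T x) x_j^k = 0] may vanish identically over [w];
   lift a line through [w] to an arc through [p] and divide by the common power
   of the parameter first. *)
Lemma nondegenerate_coord N (T : 'I_N -> pexp N) (j : 'I_N) :
  exists D, forall w, exists Q : {poly K}, [/\ Q != 0, (size Q <= D)%N &
    forall p, evmap T p = w -> jac T p \in unitmx -> root Q (p 0 j)].
Proof.
have [D [P [pP [k0 [y0 P0]] hP]]] := coord_algebraic T j.
exists D => w; have [tP htP] := choice pP.
pose b := y0 - w.
pose l i : {poly K} := (w 0 i)%:P + 'X * (b 0 i)%:P.
pose p k := pev (@polyC K) l (tP k).
have pk0 : p k0 != 0.
  apply: contra_neq P0 => p0; have := congr1 (fun P => P.[1]) p0.
  rewrite /= horner0 pev_horner htP => <-; apply: eq_pev => i.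
  by rewrite !hornerE [b 0 i]mxE [X in _ + (_ + X)]mxE addrC subrK.
pose dv e := [forall k, 'X^e %| p k].
have ex_dv : exists e, dv e by exists 0%N; apply/forallP => k; rewrite expr0 dvd1p.
have ub e : dv e -> (e <= size (p k0))%N.
  move/forallP/(_ k0) => /(dvdp_leq pk0); rewrite size_polyXn; exact: ltnW.
case: (ex_maxnP ex_dv ub) => e /forallP de max_e.
have /choice[q hq] k : exists q, p k = q * 'X^e by apply/dvdpP.
pose Q := \poly_(k < D) (if insub k is Some i then (q i).[0] else 0).
have coefQ (k : 'I_D) : Q`_k = (q k).[0].
  by rewrite coef_poly ltn_ord valK.
exists Q; split; last 1 first.
(* Lifting to order [e.+1] leaves a factor ['X] in the error after division by ['X^e], so at
   parameter 0 the relation reads [Q.[x 0 j] = 0]. *)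
- move=> x Tx Jx; have [u [u0 hu]] := arc_lifting (b 0) e Jx.
  have [r hr] := choice hu.
  have hr' k := pev_cong (@polyC K) l r ('X ^+ e.+1) (tP k).
  have {hr'} [r' hr'] := choice hr'.
  have E : \sum_k pev (@polyC K) (fun j => pev (@polyC K) u (T j)) (tP k) *
            u j ^+ k = 0.
    apply: poly_ext0 => s; rewrite horner_sum.
    pose us : 'rV[K]_N := \row_i (u i).[s].
    rewrite -[RHS](hP us); apply: eq_bigr => k _.
    rewrite hornerM pev_horner horner_exp mxE htP; congr (_ * _).
    apply: eq_pev => i; rewrite mxE pev_horner.
    by apply: eq_pev => i'; rewrite mxE.
  have E2 : 'X^e * \sum_k (q k + 'X * r' k) * u j ^+ k = 0.
    rewrite -[RHS]E big_distrr /=; apply: eq_bigr => k _.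
    rewrite mulrA; congr (_ * _).
    transitivity (p k + 'X^(e.+1) * r' k); first by rewrite hq exprS; ring.
    rewrite -hr'; apply: eq_pev => i; rewrite hr /l; congr (_%:P + _ + _).
    by rewrite -Tx mxE.
  move/eqP: E2; rewrite mulf_eq0 expf_eq0 polyX_eq0 andbF /= => /eqP E2.
  have := congr1 (fun P => P.[0]) E2; rewrite /= horner0 horner_sum => E3.
  rewrite /root horner_poly; apply/eqP; rewrite -[RHS]E3; apply: eq_bigr => k _.
  by rewrite valK !hornerE u0 ?mul0r ?addr0.
(* By maximality of [e] the constant terms of the quotients [q k] cannot all vanish. *)
- apply/eqP => Q0; have : dv e.+1.
    apply/forallP => k; have := coefQ k; rewrite Q0 coef0 => /esym q0.
    have /factor_theorem[q' hq'] : root (q k) 0 by apply/eqP.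
    by rewrite hq hq' subr0 -mulrA -exprS dvdp_mull.
  by move/max_e; rewrite ltnn.
- exact: size_poly.
Qed.

(** A zero is determined by the positions of its coordinates in lists of roots, of length at most
    [M]. Since [M] comes from [T] only, [B] serves all [w] at once. *)
Lemma nondegenerate_bound N (T : 'I_N -> pexp N) :
  exists B, forall w (s : seq 'rV[K]_N), uniq s ->
    (forall p, p \in s -> evmap T p = w /\ jac T p \in unitmx) -> (size s <= B)%N.
Proof.
have [D hD] := choice (nondegenerate_coord T).
pose M := (\max_j D j)%N; exists (M.+1 ^ N)%N => w s us hs.
have [Q hQ] := choice (fun j => hD j w).
pose rs j := undup [seq p 0 j | p : 'rV[K]_N <- s].
have sz j : (size (rs j) <= M)%N.
  have [Qn0 szQ rQ] := hQ j.
  apply: leq_trans (leq_trans szQ (leq_bigmax j)); apply: ltnW.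
  apply: max_poly_roots => //; last exact: undup_uniq.
  by apply/allP => x; rewrite mem_undup => /mapP[p /hs[h1 h2] ->]; apply: rQ.
pose f (p : 'rV[K]_N) : {ffun 'I_N -> 'I_M.+1} := [ffun j => inord (index (p 0 j) (rs j))].
have injf : {in s &, injective f}.
  move=> p p' ps ps' /ffunP ff; apply/rowP => j; have := ff j; rewrite !ffunE.
  have mp (p1 : 'rV[K]_N) : p1 \in s -> p1 0%R j \in rs j.
    by move=> p1s; rewrite mem_undup; apply/mapP; exists p1.
  have ip (p1 : 'rV[K]_N) : p1 \in s -> (index (p1 0%R j) (rs j) < M.+1)%N.
    by move=> p1s; rewrite ltnS ltnW // (leq_trans _ (sz j)) // index_mem mp.
  move/(congr1 val); rewrite /= !inordK ?ip // => e.
  by rewrite -(nth_index 0 (mp _ ps)) e nth_index // mp.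
rewrite -(size_map f) -(card_uniqP _); last by rewrite map_inj_in_uniq.
by apply: leq_trans (max_card _) _; rewrite card_ffun !card_ord.
Qed.

(** * Tangent vectors, transversal slices and finiteness of classes *)

Definition dder N (f : 'rV[K]_N -> K) (x v : 'rV[K]_N) (b : K) : Prop :=
  exists c : {poly K}, forall s, f (x + s *: v) = f x + s * b + s ^+ 2 * c.[s].

Definition tangent N M (f : 'rV[K]_N -> 'rV[K]_M)
    (x v : 'rV[K]_N) (w : 'rV[K]_M) : Prop :=
  forall j, dder (fun y => f y 0 j) x v (w 0 j).

(** Along a line both expansions are polynomials in the parameter; comparing coefficients of degree
    1 shows that the first-order term is unique. *)
Lemma tangent_evmap N M (T : 'I_M -> pexp N) x v w :
  tangent (evmap T) x v w <-> w = v *m jac T x.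
Proof.
have main j : exists r : {poly K}, forall s, evmap T (x + s *: v) 0 j =
    evmap T x 0 j + s * (v *m jac T x) 0 j + s ^+ 2 * r.[s].
  have [r hr] := pev_taylor (@polyC K) (fun i => (x 0 i)%:P) (fun i => (v 0 i)%:P) 'X (T j).
  exists r => s; have := congr1 (fun P => P.[s]) hr.
  rewrite /= !hornerE pev_horner [pev _ _ (T j)](_ : _ = (evmap T (x + s *: v)) 0 j); last first.
    by rewrite mxE; apply: eq_pev => i; rewrite !hornerE !mxE.
  move=> ->; congr (_ + _ * _ + _).
    by rewrite pev_horner mxE; apply: eq_pev => i; rewrite hornerC.
  rewrite horner_sum mxE; apply: eq_bigr => i _.
  rewrite hornerM hornerC pev_horner !mxE; congr (_ * _).
  by apply: eq_pev => i'; rewrite hornerC.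
split=> [h|-> j]; last by have [r hr] := main j; exists r.
apply/rowP => j; have [r hr] := main j; have [c hc] := h j.
have : 'X * (w 0 j - (v *m jac T x) 0 j)%:P + 'X ^+ 2 * (c - r) = 0.
  apply: poly_ext0 => s; have := hr s; rewrite hc !hornerE => /eqP.
  rewrite -!addrA (inj_eq (addrI _)) -subr_eq0 => /eqP <-; ring.
move/(congr1 (fun P : {poly K} => P`_1)); rewrite coefD coefXM coefXnM /= coefC /= coef0 addr0.
by move/eqP; rewrite subr_eq0 => /eqP.
Qed.

Lemma eq_tangent N M (f g : 'rV[K]_N -> 'rV[K]_M) x v w :
  f =1 g -> tangent f x v w -> tangent g x v w.
Proof. by move=> fg h j; have [c hc] := h j; exists c => s; rewrite -!fg. Qed.

Lemma polymapP N M (f : 'rV[K]_N -> 'rV[K]_M) :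
  polymap f -> exists T, f =1 evmap T.
Proof.
by move=> /choice[T hT]; exists T => x; apply/rowP => j; rewrite hT mxE.
Qed.

(** A pairwise inequivalent list of maximal length meets every class. The new point is appended at
    the end, so that the tests [sim q p] come in the order required by [pairwise]. *)
Lemma finite_representatives (T : eqType) (P : T -> Prop) (sim : T -> T -> Prop) B :
  (forall s : seq T, (forall p, p \in s -> P p) ->
     pairwise (fun a b => ~~ `[< sim a b >]) s -> (size s <= B)%N) ->
  exists s : seq T, (forall p, p \in s -> P p) /\
     forall p, P p -> exists2 q, q \in s & sim q p.
Proof.
move=> hB.
pose good m := `[< exists s : seq T, [/\ (forall p, p \in s -> P p),
   pairwise (fun a b => ~~ `[< sim a b >]) s & size s = m] >].
have ex_good : exists m, good m by exists 0%N; apply/asboolP; exists [::].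
have ub m : good m -> (m <= B)%N by move/asboolP => [s [h1 h2 <-]]; apply: hB.
case: (ex_maxnP ex_good ub) => m /asboolP[s [sP sp ss]] mx.
exists s; split=> // p Pp; apply: contrapT => h.
have : good m.+1.
  apply/asboolP; exists (rcons s p); split; last by rewrite size_rcons ss.
    by move=> q; rewrite mem_rcons inE => /predU1P[->|/sP].
  rewrite pairwise_rcons sp andbT; apply/allP => q qs /=.
  by apply/asboolPn => qp; apply: h; exists q.
by move/mx; rewrite ltnn.
Qed.

(** A square system: the [n] coordinates selected by [f] and the [k] equations selected by [g]. The
    pairs [(f, g)] are finite in number. *)
Definition slice n k m (TF : 'I_m -> pexp (n + k))
    (f : 'I_n -> 'I_(n + k)) (g : 'I_k -> 'I_m) (i : 'I_(n + k)) : pexp (n + k) :=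
  match split i with inl j => PVar (f j) | inr j => TF (g j) end.

Lemma jac_slice n k m (TF : 'I_m -> pexp (n + k)) f g x :
  jac (slice TF f g) x =
  row_mx (\matrix_(i, j) (i == f j)%:R) (colsub g (jac TF x)).
Proof.
apply/matrixP => i j; rewrite -[j]splitK; case: (split j) => j' /=.
  by rewrite row_mxEl !mxE /slice (unsplitK (inl j')).
by rewrite row_mxEr !mxE /slice (unsplitK (inr j')).
Qed.

Lemma colsub_unit k m (A : 'M[K]_(k, m)) :
  row_free A -> exists g : {ffun 'I_k -> 'I_m}, colsub g A \in unitmx.
Proof.
move=> fA; have fAt : row_full A^T by rewrite /row_full mxrank_tr.
exists (finfun (fullrankfun fAt)); rewrite -unitmx_tr -row_full_unit.
apply: etrans (fullrowsub_full fAt); congr row_full.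
by apply/matrixP => i j; rewrite !mxE ffunE.
Qed.

(** Select by [f] coordinates on which the row space of [P] projects isomorphically. The vectors
    vanishing in them form a complement [Kr] of dimension [k], which meets the kernel of [J]
    trivially; hence [k] columns of [J] already separate [Kr]. *)
Lemma slice_exists n k m (P : 'M[K]_(n, n + k)) (J : 'M[K]_(n + k, m)) :
  row_free P -> (forall v : 'rV_(n + k), v *m J = 0 -> (v <= P)%MS) ->
  exists (f : {ffun 'I_n -> 'I_(n + k)}) (g : {ffun 'I_k -> 'I_m}),
    colsub f P \in unitmx /\
    row_mx (\matrix_(i, j) (i == f j)%:R) (colsub g J) \in unitmx.
Proof.
move=> fP kJ; have [f uf] := colsub_unit fP.
pose L : 'M[K]_(n + k, n) := \matrix_(i, j) (i == f j)%:R.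
have PL : P *m L = colsub f P.
  apply/matrixP => i j; rewrite !mxE (bigD1 (f j)) //= mxE eqxx mulr1.
  by rewrite big1 ?addr0 // => l /negPf lf; rewrite mxE lf mulr0.
have rL : \rank (kermx L) = k.
  rewrite mxrank_ker; suff -> : \rank L = n by rewrite addKn.
  apply/eqP; rewrite eqn_leq rank_leq_col /=.
  by rewrite -{1}(mxrank_unit uf) -PL mxrankM_maxr.
have [Kr [KrL fK sK]] : exists Kr : 'M[K]_(k, n + k),
    [/\ Kr *m L = 0, row_free Kr & forall v : 'rV_(n + k), v *m L = 0 -> (v <= Kr)%MS].
  have h1 : row_base (kermx L) *m L = 0 by apply/sub_kermxP; rewrite eq_row_base.
  have h2 := row_base_free (kermx L).
  have h3 (v : 'rV_(n + k)) : v *m L = 0 -> (v <= row_base (kermx L))%MS.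
    by move/sub_kermxP; rewrite eq_row_base.
  move: (row_base (kermx L)) h1 h2 h3; rewrite rL => Kr h1 h2 h3.
  by exists Kr.
have /colsub_unit[g ug] : row_free (Kr *m J).
  rewrite -kermx_eq0; apply/eqP/row_matrixP => i; rewrite row0.
  set a := row i _.
  have /eqP : a *m (Kr *m J) = 0 by apply/sub_kermxP; exact: row_sub.
  rewrite mulmxA => /eqP/kJ /submxP[b hb].
  have b0 : b = 0.
    have : b *m colsub f P = 0 by rewrite -PL mulmxA -hb -mulmxA KrL mulmx0.
    by move=> h; rewrite -[b](mulmxK uf) h mul0mx.
  by apply: (row_free_inj fK); rewrite mul0mx hb b0 mul0mx.
exists f, g; split=> //; rewrite -row_free_unit -kermx_eq0.
apply/eqP/row_matrixP => i; rewrite row0; set v := row i _.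
have : v *m row_mx L (colsub g J) = 0 by apply/sub_kermxP; exact: row_sub.
rewrite mul_mx_row => /eqP; rewrite row_mx_eq0 => /andP[/eqP/sK/submxP[b hb] /eqP vJ].
have E : colsub g (Kr *m J) = Kr *m colsub g J.
  by apply/matrixP => a b'; rewrite !mxE; apply: eq_bigr => c _; rewrite mxE.
have b0 : b *m colsub g (Kr *m J) = 0 by rewrite E mulmxA -hb vJ.
by rewrite hb -[b](mulmxK ug) b0 !mul0mx.
Qed.

(** Points are sorted by the type [(f, g)] of a slice transversal at them. Given inequivalent points
    of one type, the projections of their families by [f] contain nonempty open sets, which share a
    value [c]. The slice at [c] meets each family in a nondegenerate zero of one square system, and
    zeros from inequivalent points differ, so [nondegenerate_bound] limits their number. *)
Lemma finite_classes n k m (F : 'rV[K]_(n + k) -> 'rV[K]_m)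
    (X : 'rV[K]_(n + k) -> Prop) (sim : 'rV[K]_(n + k) -> 'rV[K]_(n + k) -> Prop) :
  polymap F ->
  (forall p q, sim p q -> sim q p) ->
  (forall p q r, sim p q -> sim q r -> sim p r) ->
  (forall p, X p -> exists phi : 'rV[K]_n -> 'rV[K]_(n + k),
    [/\ polymap phi, phi 0 = p, forall s, sim p (phi s) /\ F (phi s) = 0,
        forall v, tangent F p v 0 -> exists a, tangent phi 0 a v
      & forall a, tangent phi 0 a 0 -> a = 0]) ->
  exists s : seq 'rV[K]_(n + k), (forall p, p \in s -> X p) /\
    forall p, X p -> exists2 q, q \in s & sim q p.
Proof.
move=> /polymapP[TF hF] simC simT hX.
pose Xt (t : {ffun 'I_n -> 'I_(n + k)} * {ffun 'I_k -> 'I_m}) p :=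
  X p /\ exists phi, [/\ evmap phi 0 = p,
     forall s, sim p (evmap phi s) /\ F (evmap phi s) = 0,
     colsub t.1 (jac phi 0) \in unitmx & jac (slice TF t.1 t.2) p \in unitmx].
have typ p : X p -> exists t, Xt t p.
  move=> Xp; have [phi [/polymapP[T hT] p0 hs hv ha]] := hX p Xp.
  have [||f [g [h1 h2]]] := @slice_exists n k m (jac T 0) (jac TF p).
  - rewrite -kermx_eq0; apply/eqP/row_matrixP => i; rewrite row0; apply: ha.
    apply: (@eq_tangent _ _ (evmap T)); first by move=> x; rewrite hT.
    by apply/tangent_evmap/esym/sub_kermxP; exact: row_sub.
  - move=> v vJ; have [|a] := hv v.
      apply: (@eq_tangent _ _ (evmap TF)); first by move=> x; rewrite hF.
      exact/tangent_evmap.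
    move/(eq_tangent hT)/tangent_evmap ->; exact: submxMl.
  exists (f, g); split=> //; exists T; split=> //; first by rewrite -hT.
    by move=> s; rewrite -hT.
  by rewrite jac_slice.
have bnd t : exists s : seq 'rV[K]_(n + k), (forall p, p \in s -> Xt t p) /\
    forall p, Xt t p -> exists2 q, q \in s & sim q p.
  have [B hB] := nondegenerate_bound (slice TF t.1 t.2).
  apply: (@finite_representatives _ _ _ B) => s hs ps.
  pose p (i : 'I_(size s)) := s`_i.
  have hp i : Xt t (p i) by apply: hs; apply: mem_nth.
  have {hp} /choice[phi hphi] i : exists phi, [/\ evmap phi 0 = p i,
     forall s, sim (p i) (evmap phi s) /\ F (evmap phi s) = 0,
     colsub t.1 (jac phi 0) \in unitmx & jac (slice TF t.1 t.2) (p i) \in unitmx].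
    by case: (hp i).
  (* Nondegeneracy of the slice is known at [p i] only; carrying the determinant along ensures it at
     the point to which [p i] is moved. *)
  pose d i (x : 'rV[K]_n) := \det (jac (slice TF t.1 t.2) (evmap (phi i) x)).
  have /choice[q hq] i : exists q : 'rV[K]_n -> K, [/\ polyfun q, exists y, q y != 0 &
      forall y, q y != 0 ->
        exists2 x, evmap (fun j => phi i (t.1 j)) x = y & d i x != 0].
    have [p0 _ u1 u2] := hphi i.
    apply: (@image_open _ _ 0).
    - apply: etrans u1; congr (_ \in unitmx).
      by apply/matrixP => a b; rewrite !mxE.
    - apply: (@polyfun_comp _ _ (fun y => \det (jac (slice TF t.1 t.2) y)));
        last exact: polymap_evmap.
      by apply: polyfun_det => a b; apply: polyfun_jac.
    - by rewrite /d p0 -unitfE -unitmxE.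
  have [||c hc] := @polyfun_prod_neq0 n (size s) q.
  - by move=> i; case: (hq i).
  - by move=> i; case: (hq i).
  have /choice[x hx] i : exists x,
      evmap (fun j => phi i (t.1 j)) x = c /\ d i x != 0.
    by case: (hq i) => _ _ /(_ c (hc i)) [x h1 h2]; exists x.
  pose p' i := evmap (phi i) (x i).
  rewrite -[size s]card_ord -(size_image p' predT).
  apply: (hB (row_mx c 0)).
    rewrite map_inj_uniq ?enum_uniq // => i j pij.
    apply/val_inj/eqP; apply: contrapT => /negP ne.
    have smij : sim (p i) (p j).
      have [_ /(_ (x i))[s1 _] _ _] := hphi i.
      have [_ /(_ (x j))[s2 _] _ _] := hphi j.
      by apply: simT s1 _; rewrite -/(p' i) pij; apply: simC.
    move/(pairwiseP 0): ps => ps; move: ne; rewrite neq_ltn => /orP[] lt.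
      by have /asboolPn := ps i j (ltn_ord i) (ltn_ord j) lt; apply.
    by have /asboolPn := ps j i (ltn_ord j) (ltn_ord i) lt; apply; apply: simC.
  move=> _ /mapP[i _ ->]; split; last by rewrite unitmxE unitfE; case: (hx i).
  have [hc1 _] := hx i; have [_ /(_ (x i))[_ F0] _ _] := hphi i.
  apply/rowP => j; rewrite -[j]splitK; case: (split j) => j' /=.
    rewrite row_mxEl -hc1 !mxE /slice (unsplitK (inl j')) /=.
    by rewrite mxE.
  rewrite row_mxEr !mxE /slice (unsplitK (inr j')).
  by move/rowP/(_ (t.2 j')): F0; rewrite hF !mxE.
have [S hS] := choice bnd.
exists (flatten [seq S t | t <- enum predT]); split.
  by move=> p /flatten_mapP[t _ /(proj1 (hS t))[]].
move=> p Xp; have [t Xtp] := typ p Xp; have [q qS qp] := proj2 (hS t) p Xtp.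
by exists q => //; apply/flatten_mapP; exists t; rewrite ?mem_enum.
Qed.

End PolynomialExpressions.

(** * Generalized eigenvectors *)

Section LinearAlgebra.
Variable K : numClosedFieldType.

(** Spanning is stated dually: no nonzero functional kills [P]. A free family with fewer than [n]
    rows is killed by a nonzero functional, and any [v] in [P] not killed by it extends the
    family. *)
Lemma basis_of_pred n (P : 'rV[K]_n -> Prop) :
  (forall u : 'cV_n, (forall v, P v -> v *m u = 0) -> u = 0) ->
  exists2 B : 'M[K]_n, B \in unitmx & forall i, P (row i B).
Proof.
move=> hP.
suff main k : (k <= n)%N ->
    exists2 A : 'M[K]_(k, n), row_free A & forall i, P (row i A).
  by have [B fB PB] := main n (leqnn n); exists B; rewrite // -row_free_unit.
elim: k => [|k IH] kn.
  exists 0; last by case.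
  by rewrite /row_free mxrank0.
have [A fA PA] := IH (ltnW kn).
have : kermx A^T != 0.
  by rewrite -mxrank_eq0 mxrank_ker mxrank_tr (eqP fA) subn_eq0 -ltnNge.
case/rowV0Pn => u /sub_kermxP uA un0.
have Au : A *m u^T = 0 by rewrite -[A]trmxK -trmx_mul uA trmx0.
have [v Pv vu] : exists2 v, P v & v *m u^T != 0.
  apply: contrapT => h; case/eqP: un0; apply: trmx_inj; rewrite trmx0.
  by apply: hP => v Pv; apply/eqP; apply: contrapT => /negP vu; apply: h; exists v.
exists (col_mx v A); last first.
  suff rowP (j : 'I_(1 + k)) : P (row j (col_mx v A)) by move=> j; apply: rowP.
  rewrite -[j]splitK; case: (split j) => {}j /=.
    by rewrite ord1 rowKu row_id.
  by rewrite rowKd.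
suff free : @row_free _ (1 + k) n (col_mx v A) by [].
rewrite -kermx_eq0; apply/eqP/row_matrixP => i; rewrite row0; set w := row i _.
have : w *m col_mx v A = 0 by apply/sub_kermxP; exact: row_sub.
rewrite -[w]hsubmxK mul_row_col => h.
have : lsubmx w *m v *m u^T = 0.
  move/(congr1 (mulmx^~ u^T)): h.
  by rewrite mulmxDl -(mulmxA _ A) Au mulmx0 addr0 mul0mx.
rewrite -mulmxA [v *m _]mx11_scalar mul_mx_scalar => /eqP.
rewrite scaler_eq0 => /orP[/eqP h0|/eqP l0].
  by case/eqP: vu; rewrite [LHS]mx11_scalar h0 raddf0.
move: h; rewrite l0 mul0mx add0r => h.
by rewrite (row_free_inj fA (_ : rsubmx w *m A = 0 *m A)) ?mul0mx // row_mx0.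
Qed.

Definition gev n (M : 'M[K]_n) (a : K) (v : 'rV[K]_n) : Prop :=
  exists k, v *m (M - a%:M) ^+ k = 0.

Lemma eigen_gev n (M : 'M[K]_n) a v : v *m M = a *: v -> gev M a v.
Proof. by move=> h; exists 1%N; rewrite expr1 mulmxBr h mul_mx_scalar subrr. Qed.

Lemma gev_commute n (M A : 'M[K]_n) a v : M *m A = A *m M -> gev M a v -> gev M a (v *m A).
Proof.
move=> MA [k hk]; exists k.
have cA : (M - a%:M) *m A = A *m (M - a%:M).
  by rewrite mulmxBl mulmxBr MA scalar_mxC.
have -> : v *m A *m (M - a%:M) ^+ k = v *m (M - a%:M) ^+ k *m A.
  rewrite -!mulmxA; congr (_ *m _); elim: k {hk} => [|k IH].
    by rewrite !expr0 mul1mx mulmx1.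
  by rewrite exprSr -!mulmxE mulmxA IH -!mulmxA cA.
by rewrite hk mul0mx.
Qed.

Lemma gevD n (M : 'M[K]_n) a v w : gev M a v -> gev M a w -> gev M a (v + w).
Proof.
move=> [k hk] [l hl]; exists (k + l)%N.
by rewrite mulmxDl {1}exprD {1}addnC exprD -!mulmxE !mulmxA hk hl !mul0mx addr0.
Qed.

Lemma gev0 n (M : 'M[K]_n) a : gev M a 0.
Proof. by exists 0%N; rewrite mul0mx. Qed.

Lemma gevZ n (M : 'M[K]_n) a b v : gev M a v -> gev M a (b *: v).
Proof. by move=> [k hk]; exists k; rewrite -scalemxAl hk scaler0. Qed.

Lemma gev_sum n (M : 'M[K]_n) a I (r : seq I) (P : pred I) (F : I -> 'rV[K]_n) :
  (forall i, P i -> gev M a (F i)) -> gev M a (\sum_(i <- r | P i) F i).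
Proof.
move=> h; elim: r => [|i r IH]; first by rewrite big_nil; apply: gev0.
by rewrite big_cons; case: ifP => // /h ?; apply: gevD.
Qed.

Lemma gev_kermxpoly n (M : 'M[K]_n) a k (v : 'rV[K]_n) :
  v *m (M - a%:M) ^+ k = 0 -> (v <= kermxpoly M (('X - a%:P) ^+ k))%MS.
Proof.
case: n => [|n] in M v *; first by move=> _; rewrite thinmx0 sub0mx.
move=> h; apply/sub_kermxP.
by rewrite rmorphXn/= rmorphB/= horner_mx_X horner_mx_C.
Qed.

Lemma kermxpoly_gev n (M : 'M[K]_n) a k (v : 'rV[K]_n) :
  (v <= kermxpoly M (('X - a%:P) ^+ k))%MS -> gev M a v.
Proof.
case: n => [|n] in M v *; first by move=> _; rewrite [v]thinmx0; apply: gev0.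
move/sub_kermxP; rewrite rmorphXn/= rmorphB/= horner_mx_X horner_mx_C.
by exists k.
Qed.

Lemma kermxpoly_dvdp n (M : 'M[K]_n) p q :
  p %| q -> (kermxpoly M p <= kermxpoly M q)%MS.
Proof.
case: n => [|n] in M *; first by rewrite thinmx0 sub0mx.
move=> /dvdpP[r ->]; apply/sub_kermxP; rewrite mulrC rmorphM /= -mulmxE mulmxA.
by rewrite mulmx_ker mul0mx.
Qed.

(** The characteristic polynomial splits and divides a power of the product over its distinct roots;
    the kernels of the coprime factors add up to the whole space. *)
Lemma gev_span n (M : 'M[K]_n) (u : 'cV_n) :
  (forall a v, gev M a v -> v *m u = 0) -> u = 0.
Proof.
case: n => [|n] in M u *; first by move=> _; apply/matrixP => -[].
move=> hu; have [r hr] := closed_field_poly_normal (char_poly M).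
rewrite (monicP (char_poly_monic M)) scale1r in hr.
pose s := undup r; pose Q := \prod_(z <- s) ('X - z%:P).
have dvQ : char_poly M %| Q ^+ size r.
  rewrite hr; have : {subset r <= s} by move=> z; rewrite mem_undup.
  elim: (r) => [|z r' IH] //= sub; first by rewrite big_nil dvd1p.
  rewrite big_cons exprS dvdp_mul //.
    by rewrite dvdp_XsubCl root_prod_XsubC sub ?mem_head.
  by apply: IH => t tr; rewrite sub // inE tr orbT.
have full : (1%:M <= \sum_(i < size s) kermxpoly M (('X - (s`_i)%:P) ^+ size r))%MS.
  rewrite -(@kermxpoly_prod _ _ M _ xpredT (fun i : 'I_(size s) => ('X - (s`_i)%:P) ^+ size r)).
    rewrite prodrXl -(big_mkord xpredT (fun i => 'X - (s`_i)%:P)) -(big_nth 0 xpredT (fun z => 'X - z%:P)).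
    by rewrite kermxpoly_min //; apply: dvdp_trans dvQ; apply: mxminpoly_dvd_char.
  move=> i j _ _ ji; rewrite coprimep_expr ?coprimep_expl // coprimep_XsubC root_XsubC.
  by rewrite nth_uniq ?undup_uniq // eq_sym in ji *.
have [c hc] := sub_sumsmxP full.
rewrite -[u]mul1mx hc mulmx_suml big1 // => i _; rewrite -mulmxA.
suff -> : kermxpoly M (('X - (s`_i)%:P) ^+ size r) *m u = 0 by rewrite mulmx0.
apply/row_matrixP => j; rewrite row0 row_mul.
by apply: (hu s`_i); apply: kermxpoly_gev; apply: row_sub.
Qed.

Lemma gev_basis n (M : 'M[K]_n) : exists B (d : 'I_n -> K),
  B \in unitmx /\ forall i, gev M (d i) (row i B).
Proof.
have [|B uB hB] := @basis_of_pred n (fun v => exists a, gev M a v).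
  by move=> u hu; apply: (@gev_span n M) => a v hv; apply: hu; exists a.
by have [d hd] := choice hB; exists B, d.
Qed.

Lemma gev_ext n m (M : 'M[K]_n) (A A' : 'M[K]_(n, m)) :
  (forall a v, gev M a v -> v *m A = v *m A') -> A = A'.
Proof.
move=> h; have [B [d [uB hB]]] := gev_basis M.
apply: (can_inj (mulKmx uB)); apply/row_matrixP => i.
by rewrite !row_mul; apply: h (hB i).
Qed.

(** The annihilating polynomials of [v] and of the sum are coprime, so their kernels meet in 0. The
    values [d i] may repeat among themselves. *)
Lemma gev_indep n (M : 'M[K]_n) a (v : 'rV[K]_n) (I : finType) (P : pred I)
    (d : I -> K) (w : I -> 'rV[K]_n) :
  gev M a v -> (forall i, P i -> gev M (d i) (w i) /\ d i != a) ->
  v = \sum_(i | P i) w i -> v = 0.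
Proof.
move=> [k hk] hw vE.
have /choice[e he] i : exists e, P i -> w i *m (M - (d i)%:M) ^+ e = 0.
  by case: (boolP (P i)) => [/hw[[e he] _]|_]; [exists e | exists 0%N].
pose q := \prod_(i | P i) ('X - (d i)%:P) ^+ e i.
have vq : (v <= kermxpoly M q)%MS.
  rewrite vE summx_sub // => i Pi.
  apply: submx_trans (gev_kermxpoly (he i Pi)) _; apply: kermxpoly_dvdp.
  by rewrite /q (bigD1 i) //= dvdp_mulr.
have vp := gev_kermxpoly hk.
apply/eqP; rewrite -submx0 -(@mxdirect_kermxpoly _ _ M (('X - a%:P) ^+ k) q).
  by rewrite sub_capmx vp vq.
rewrite /q (@big_morph _ _ _ true andb) ?big_all_cond ?coprimep1//; last first.
  by move=> p p'; rewrite coprimepMr.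
apply/allP => i _; apply/implyP => Pi.
rewrite coprimep_expr ?coprimep_expl // coprimep_XsubC root_XsubC.
by have [_] := hw i Pi; rewrite eq_sym.
Qed.

Lemma gev_coord n (M B : 'M[K]_n) (d : 'I_n -> K) a v :
  B \in unitmx -> (forall i, gev M (d i) (row i B)) -> gev M a v ->
  forall i, d i != a -> (v *m invmx B) 0 i = 0.
Proof.
move=> uB hB hv i dia; pose c := v *m invmx B.
have vE : v = \sum_j c 0 j *: row j B by rewrite -mulmx_sum_row mulmxKV.
pose x := \sum_(j | d j != a) c 0 j *: row j B.
have x0 : x = 0.
  apply: (@gev_indep n M a x _ (fun j => d j != a) d (fun j => c 0 j *: row j B)) => //.
    have -> : x = v - \sum_(j | d j == a) c 0 j *: row j B.
      by apply/eqP; rewrite eq_sym subr_eq addrC {1}vE (bigID (fun j => d j == a)).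
    apply: gevD => //; rewrite -scaleN1r; apply/gevZ/gev_sum => j /eqP <-.
    exact/gevZ.
  by move=> j dj; split=> //; apply: gevZ.
pose c' := \row_j (if d j != a then c 0 j else 0).
have c'B : c' *m B = 0.
  transitivity x; last exact: x0.
  rewrite mulmx_sum_row /x [RHS]big_mkcond /=; apply: eq_bigr => j _.
  by rewrite mxE; case: ifP => // _; rewrite scale0r.
have : c' = 0 by rewrite -[c'](mulmxK uB) c'B mul0mx.
by move/rowP/(_ i); rewrite !mxE dia.
Qed.

(** For a basis [B] of generalized eigenvectors of [M], this is [f] applied to the semisimple part
    of [M]. *)
Definition spec n (B : 'M[K]_n) (d : 'I_n -> K) (f : K -> K) : 'M[K]_n :=
  invmx B *m diag_mx (\row_i f (d i)) *m B.

Lemma spec_gev n (M B : 'M[K]_n) (d : 'I_n -> K) f a v :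
  B \in unitmx -> (forall i, gev M (d i) (row i B)) -> gev M a v ->
  v *m spec B d f = f a *: v.
Proof.
move=> uB hB hv; rewrite /spec !mulmxA.
set c := v *m invmx B; have <- : c *m B = v by rewrite mulmxKV.
rewrite scalemxAl; congr (_ *m _); apply/rowP => i.
rewrite mul_mx_diag mxE [X in _ * X]mxE [RHS]mxE.
have [<-|dia] := eqVneq (d i) a; first by rewrite mulrC.
by rewrite (gev_coord uB hB hv dia) mul0r mulr0.
Qed.

Lemma mxtrace_spec n (B : 'M[K]_n) (d : 'I_n -> K) f :
  B \in unitmx -> \tr (spec B d f) = \sum_i f (d i).
Proof.
move=> uB; rewrite /spec -mulmxA mxtrace_mulC -mulmxA mulmxV // mulmx1 mxtrace_diag.
by apply: eq_bigr => i _; rewrite mxE.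
Qed.

Lemma spec_mul n (B : 'M[K]_n) (d : 'I_n -> K) f g :
  B \in unitmx -> spec B d f *m spec B d g = spec B d (fun x => f x * g x).
Proof.
move=> uB; rewrite /spec !mulmxA mulmxK // -[_ *m diag_mx _ *m diag_mx _]mulmxA.
congr (_ *m _ *m _); apply/matrixP => i j; rewrite mul_diag_mx !mxE.
by case: eqP => [->|_]; rewrite ?mulr1n ?mulr0n ?mulr0.
Qed.

Lemma nilpotent_char_poly n (N : 'M[K]_n) k : N ^+ k = 0 -> char_poly N = 'X^n.
Proof.
case: n => [|n] in N *; first by move=> _; rewrite /char_poly [char_poly_mx _]thinmx0 det_mx00.
move=> Nk; have [r hr] := closed_field_poly_normal (char_poly N).
rewrite (monicP (char_poly_monic N)) scale1r in hr.
have r0 z : z \in r -> z = 0.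
  move=> zr; have : root (char_poly N) z by rewrite hr root_prod_XsubC.
  rewrite -eigenvalue_root_char => /eigenvalueP[v hv vn0].
  have : v *m N ^+ k = z ^+ k *: v.
    elim: k {Nk} => [|k IH]; first by rewrite !expr0 mulmx1 scale1r.
    by rewrite exprSr -mulmxE mulmxA IH -scalemxAl hv scalerA exprSr.
  rewrite Nk mulmx0 => /esym/eqP; rewrite scaler_eq0 (negPf vn0) orbF.
  by rewrite expf_eq0 => /andP[_ /eqP].
have sr : size r = n.+1.
  by have := size_char_poly N; rewrite hr size_prod_XsubC => -[].
rewrite hr -sr big_seq (eq_bigr (fun=> 'X)) => [|z /r0 ->]; last by rewrite subr0.
by rewrite -big_seq big_const_seq count_predT iter_mulr_1.
Qed.

Lemma nilpotent_expn n (N : 'M[K]_n) k : N ^+ k = 0 -> N ^+ n = 0.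
Proof.
case: n => [|n] in N *; first by move=> _; rewrite [LHS]thinmx0.
move/nilpotent_char_poly => h; have := Cayley_Hamilton N.
by rewrite h rmorphXn /= horner_mx_X.
Qed.

Lemma mxtrace_nilpotent n (N : 'M[K]_n) k : N ^+ k = 0 -> \tr N = 0.
Proof.
case: n => [|n] in N *; first by move=> _; rewrite [N]thinmx0 mxtrace0.
move/nilpotent_char_poly => h; have := char_poly_trace N (ltn0Sn n).
by rewrite h coefXn /= eqn_leq ltnn andbF => /esym/eqP; rewrite oppr_eq0 => /eqP.
Qed.

Lemma nilpotent_commute n (A N : 'M[K]_n) k :
  A *m N = N *m A -> N ^+ k = 0 -> (A *m N) ^+ k = 0.
Proof.
move=> AN Nk; rewrite mulmxE exprMn_comm; last by rewrite /GRing.comm -!mulmxE.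
by rewrite Nk mulr0.
Qed.

(* The semisimple part of [M] differs from [M] by a commuting nilpotent. *)
Lemma mxtrace_mul_spec n (M B : 'M[K]_n) (d : 'I_n -> K) f :
  B \in unitmx -> (forall i, gev M (d i) (row i B)) ->
  \tr (M *m spec B d f) = \sum_i d i * f (d i).
Proof.
move=> uB hB; pose S := spec B d f; pose D := spec B d id.
have sp := fun f a v => @spec_gev n M B d f a v uB hB.
have MS : M *m S = S *m M.
  apply: (@gev_ext n n M) => a v hv.
  have e1 : v *m S = _ := sp f a v hv.
  have e2 : v *m M *m S = _ := sp f a _ (gev_commute (erefl _) hv).
  by rewrite (mulmxA v M) (mulmxA v S) e1 e2 scalemxAl.
have MD : M *m D = D *m M.
  apply: (@gev_ext n n M) => a v hv.
  have e1 : v *m D = _ := sp id a v hv.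
  have e2 : v *m M *m D = _ := sp id a _ (gev_commute (erefl _) hv).
  by rewrite (mulmxA v M) (mulmxA v D) e1 e2 scalemxAl.
have SD : S *m D = D *m S.
  by rewrite !spec_mul //; congr spec; apply: funext => x; rewrite mulrC.
pose N := M - D.
have SN : S *m N = N *m S by rewrite mulmxBl mulmxBr MS SD.
have [k Nk] : exists k, N ^+ k = 0.
  (* On the generalized eigenspace of [d i] the matrix [D] is the scalar [d i], so [N] acts there as
     [M - d i]. *)
  have hk i : exists k, row i B *m N ^+ k = 0.
    have [k hk] := hB i; exists k; rewrite -[RHS]hk.
    elim: k {hk} => [|k IH]; first by rewrite !expr0.
    rewrite !exprSr -!mulmxE !mulmxA IH mulmxBr mulmxBr; congr (_ - _).
    rewrite (sp id (d i)) ?mul_mx_scalar //.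
    apply: gev_commute; last exact: hB.
    elim: k {IH} => [|k IH]; first by rewrite expr0 mulmx1 mul1mx.
    by rewrite exprSr -mulmxE mulmxA IH -!mulmxA mulmxBl mulmxBr scalar_mxC.
  have [e he] := choice hk; exists (\sum_i e i)%N.
  apply: (can_inj (mulKmx uB)); apply/row_matrixP => i.
  by rewrite row_mul mulmx0 row0 (bigD1 i) //= exprD -mulmxE mulmxA he mul0mx.
have -> : M *m S = S *m N + D *m S by rewrite SN -mulmxDl subrK.
rewrite mxtraceD (mxtrace_nilpotent (nilpotent_commute SN Nk)) add0r.
by rewrite spec_mul // mxtrace_spec.
Qed.

End LinearAlgebra.

(** * Engel's theorem *)

Section LieAlgebra.
Variables (R : realType) (n : nat).
Local Notation C := (complex R).
Local Notation V := 'rV[C]_n.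
Variable br : V -> V -> V.
Hypothesis lie : is_lie_bracket br.

Lemma brDl x y z : br (x + y) z = br x z + br y z.
Proof. by have [h _ _ _] := lie; rewrite -{1}[x]scale1r h scale1r. Qed.
Lemma brDr x y z : br x (y + z) = br x y + br x z.
Proof. by have [_ h _ _] := lie; rewrite -{1}[y]scale1r h scale1r. Qed.
Lemma br0l x : br 0 x = 0.
Proof. by apply: (addrI (br 0 x)); rewrite -brDl !addr0. Qed.
Lemma br0r x : br x 0 = 0.
Proof. by apply: (addrI (br x 0)); rewrite -brDr !addr0. Qed.
Lemma brZl a x y : br (a *: x) y = a *: br x y.
Proof. by have [h _ _ _] := lie; rewrite -[a *: x]addr0 h br0l addr0. Qed.
Lemma brZr a x y : br x (a *: y) = a *: br x y.
Proof. by have [_ h _ _] := lie; rewrite -[a *: y]addr0 h br0r addr0. Qed.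
Lemma brxx x : br x x = 0.
Proof. by have [_ _ h _] := lie. Qed.
Lemma brC x y : br x y = - br y x.
Proof.
apply/eqP; rewrite -addr_eq0; apply/eqP.
by have := brxx (x + y); rewrite brDl !brDr !brxx add0r addr0.
Qed.
Lemma brNl x y : br (- x) y = - br x y.
Proof. by rewrite -scaleN1r brZl scaleN1r. Qed.
Lemma brNr x y : br x (- y) = - br x y.
Proof. by rewrite -scaleN1r brZr scaleN1r. Qed.
Lemma brBl x y z : br (x - y) z = br x z - br y z.
Proof. by rewrite brDl brNl. Qed.
Lemma brBr x y z : br x (y - z) = br x y - br x z.
Proof. by rewrite brDr brNr. Qed.
Lemma br_suml I (r : seq I) P (F : I -> V) x :
  br (\sum_(i <- r | P i) F i) x = \sum_(i <- r | P i) br (F i) x.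
Proof. by apply: (big_morph (fun y => br y x)) => [y z|]; rewrite ?brDl ?br0l. Qed.
Lemma br_sumr I (r : seq I) P (F : I -> V) x :
  br x (\sum_(i <- r | P i) F i) = \sum_(i <- r | P i) br x (F i).
Proof. by apply: (big_morph (br x)) => [y z|]; rewrite ?brDr ?br0r. Qed.

Lemma jacobi x y z : br x (br y z) = br (br x y) z + br y (br x z).
Proof.
have [_ _ _ h] := lie; have /eqP := h x y z.
rewrite -addrA addr_eq0 => /eqP ->.
by rewrite opprD addrC (brC (br x y) z) (brC z x) brNr opprK.
Qed.

Lemma mul_adm x v : v *m adm br x = br x v.
Proof.
rewrite [v in RHS]row_sum_delta br_sumr mulmx_sum_row; apply: eq_bigr => i _.
by rewrite brZr; congr (_ *: _); apply/rowP => j; rewrite !mxE.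
Qed.

Lemma adm_ext (A : 'M[C]_n) x : (forall v, v *m A = br x v) -> adm br x = A.
Proof.
by move=> h; apply/row_matrixP => i; rewrite !rowE mul_adm h.
Qed.

(** Matrices act on the right, which reverses the order in the usual commutator. *)
Lemma adm_br x y : adm br (br x y) = adm br y *m adm br x - adm br x *m adm br y.
Proof.
apply: adm_ext => v; rewrite mulmxBr !mulmxA !mul_adm.
by rewrite (jacobi x y v) addrK.
Qed.

Lemma admD x y : adm br (x + y) = adm br x + adm br y.
Proof. by apply: adm_ext => v; rewrite mulmxDr !mul_adm brDl. Qed.
Lemma admZ a x : adm br (a *: x) = a *: adm br x.
Proof. by apply: adm_ext => v; rewrite -scalemxAr mul_adm brZl. Qed.
Lemma adm0 : adm br 0 = 0.
Proof. by apply: adm_ext => v; rewrite mulmx0 br0l. Qed.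
Lemma admN x : adm br (- x) = - adm br x.
Proof. by rewrite -scaleN1r admZ scaleN1r. Qed.
Lemma adm_sum I (r : seq I) P (F : I -> V) :
  adm br (\sum_(i <- r | P i) F i) = \sum_(i <- r | P i) adm br (F i).
Proof. by apply: (big_morph (adm br)) => [y z|]; rewrite ?admD ?adm0. Qed.

Definition is_der (D : 'M[C]_n) :=
  forall x y, br x y *m D = br (x *m D) y + br x (y *m D).

Lemma adm_der x : is_der (adm br x).
Proof. by move=> y z; rewrite !mul_adm jacobi. Qed.

Lemma der_adm D : is_der D -> forall y, adm br (y *m D) = adm br y *m D - D *m adm br y.
Proof.
move=> hD y; apply: adm_ext => v; rewrite mulmxBr !mulmxA !mul_adm hD.
by rewrite addrK.
Qed.

(** Induction on the sum of the exponents, since [D - (a + b)] sends [[x, y]] to [[(D - a) x, y] +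
    [x, (D - b) y]]. *)
Lemma gev_der D a b x y : is_der D -> gev D a x -> gev D b y -> gev D (a + b) (br x y).
Proof.
move=> hD [k hk] [l hl]; exists (k + l)%N.
move: {-1}(k + l)%N (erefl (k + l)%N) => m.
elim: m k l x y hk hl => [|m IH] [|k] [|l] x y //.
- by rewrite expr0 mulmx1 => -> _ _; rewrite br0l mul0mx.
- by rewrite expr0 mulmx1 => -> _ _; rewrite br0l mul0mx.
- by move=> _; rewrite expr0 mulmx1 => -> _; rewrite br0r mul0mx.
move=> hk hl [e].
have E : br x y *m (D - (a + b)%:M) =
    br (x *m (D - a%:M)) y + br x (y *m (D - b%:M)).
  rewrite !mulmxBr hD raddfD /= mulmxDr !mul_mx_scalar brBl brBr brZl brZr.
  by rewrite opprD addrACA.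
rewrite exprS -mulmxE mulmxA E mulmxDl.
rewrite (IH k l.+1 _ _ _ hl); last 2 first.
- by rewrite -mulmxA mulmxE -exprS.
- exact: e.
rewrite (IH k.+1 l) ?addr0 //; first by rewrite -mulmxA mulmxE -exprS.
by rewrite addSnnS.
Qed.

(** As for derivations, with [(g - a b) [x, y] = [(g - a) x, g y] + a [x, (g - b) y]]; the exponent
    of [g y] is that of [y] because [g] commutes with [g - b]. *)
Lemma gev_aut g a b x y : (forall u v, br u v *m g = br (u *m g) (v *m g)) ->
  gev g a x -> gev g b y -> gev g (a * b) (br x y).
Proof.
move=> hg [k hk] [l hl]; exists (k + l)%N.
move: {-1}(k + l)%N (erefl (k + l)%N) => m.
elim: m k l x y hk hl => [|m IH] [|k] [|l] x y //.
- by rewrite expr0 mulmx1 => -> _ _; rewrite br0l mul0mx.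
- by rewrite expr0 mulmx1 => -> _ _; rewrite br0l mul0mx.
- by move=> _; rewrite expr0 mulmx1 => -> _; rewrite br0r mul0mx.
move=> hk hl [e].
have E : br x y *m (g - (a * b)%:M) =
    br (x *m (g - a%:M)) (y *m g) + a *: br x (y *m (g - b%:M)).
  rewrite !mulmxBr hg !mul_mx_scalar brBl brBr brZl brZr scalerBr scalerA.
  by rewrite addrA subrK.
rewrite exprS -mulmxE mulmxA E mulmxDl.
rewrite (IH k l.+1); last 3 first.
- by rewrite -mulmxA mulmxE -exprS.
- have cg : g *m (g - b%:M) ^+ l.+1 = (g - b%:M) ^+ l.+1 *m g.
    apply: commrX; rewrite /GRing.comm -!mulmxE mulmxBl mulmxBr.
    by rewrite scalar_mxC.
  by rewrite -mulmxA cg mulmxA hl mul0mx.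
- exact: e.
rewrite -scalemxAl (IH k.+1 l) ?scaler0 ?addr0 //; first by rewrite -mulmxA mulmxE -exprS.
by rewrite addSnnS.
Qed.

Lemma der_ext M S :
  (forall a b x y, gev M a x -> gev M b y ->
     br x y *m S = br (x *m S) y + br x (y *m S)) -> is_der S.
Proof.
move=> h x y.
have half a u v : gev M a u -> br u v *m S = br (u *m S) v + br u (v *m S).
  move=> hu; rewrite -!mul_adm -mulmxA -[v *m S *m _]mulmxA -mulmxDr; congr (v *m _).
  apply: (@gev_ext _ n n M) => b w hw.
  by rewrite mulmxDr !mulmxA !mul_adm (h a b).
rewrite (brC x) (brC (x *m S)) (brC x (y *m S)) mulNmx -opprD; congr (- _).
rewrite -!mul_adm -(mulmxA x (adm br y)) -(mulmxA x S) -mulmxDr; congr (x *m _).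
apply: (@gev_ext _ n n M) => b w hw.
rewrite mulmxDr !mulmxA !mul_adm.
by rewrite (brC y w) mulNmx (half b) // (brC y (w *m S)) (brC (y *m S) w) opprD.
Qed.

Lemma mxtraceB (A B : 'M[C]_n) : \tr (A - B) = \tr A - \tr B.
Proof. exact: raddfB. Qed.

Lemma mxtrace_commutator (X Y Z : 'M[C]_n) :
  \tr ((Y *m X - X *m Y) *m Z) = \tr (X *m (Z *m Y - Y *m Z)).
Proof.
rewrite mulmxBl mulmxBr !mxtraceB -!mulmxA; congr (_ - _).
by rewrite mxtrace_mulC -mulmxA.
Qed.

Definition killing x y : C := \tr (adm br x *m adm br y).

Lemma killingC x y : killing x y = killing y x.
Proof. exact: mxtrace_mulC. Qed.
Lemma killingDl x y z : killing (x + y) z = killing x z + killing y z.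
Proof. by rewrite /killing admD mulmxDl mxtraceD. Qed.
Lemma killingZl a x z : killing (a *: x) z = a * killing x z.
Proof. by rewrite /killing admZ -scalemxAl mxtraceZ. Qed.
Lemma killing0l z : killing 0 z = 0.
Proof. by rewrite /killing adm0 mul0mx mxtrace0. Qed.
Lemma killing_suml I (r : seq I) P (F : I -> V) x :
  killing (\sum_(i <- r | P i) F i) x = \sum_(i <- r | P i) killing (F i) x.
Proof. by apply: (big_morph (fun y => killing y x)) => [y z|]; rewrite ?killingDl ?killing0l. Qed.

Lemma killing_inv x y z : killing (br x y) z = killing x (br y z).
Proof.
by rewrite /killing (adm_br x y) (adm_br y z) mxtrace_commutator.
Qed.

Lemma killing_mx : exists G : 'M[C]_n, forall x y, x *m G *m y^T = (killing x y)%:M.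
Proof.
exists (\matrix_(i, j) killing (delta_mx 0 i) (delta_mx 0 j)) => x y.
rewrite [LHS]mx11_scalar; congr (_%:M); rewrite mxE.
rewrite [y in RHS]row_sum_delta killingC killing_suml; apply: eq_bigr => j _.
rewrite killingZl killingC mxE [in RHS]mulrC mxE; congr (_ * _).
rewrite [x in RHS]row_sum_delta killing_suml; apply: eq_bigr => i _.
by rewrite killingZl mxE.
Qed.

Definition word (s : seq V) : 'M[C]_n := \prod_(x <- s) adm br x.

Definition subalg (H : 'M[C]_n) := forall x y, (x <= H)%MS -> (y <= H)%MS -> (br x y <= H)%MS.

Definition inside (H : 'M[C]_n) (s : seq V) := forall x, x \in s -> (x <= H)%MS.

Definition word_nilp (H : 'M[C]_n) := exists N, forall s, inside H s -> size s = N -> word s = 0.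

Lemma word_cons x s : word (x :: s) = adm br x *m word s.
Proof. by rewrite /word big_cons. Qed.

Lemma inside_cons H x s : inside H (x :: s) <-> (x <= H)%MS /\ inside H s.
Proof.
split=> [h|[h1 h2] y]; first by split=> [|y ys]; apply: h; rewrite inE ?eqxx ?ys ?orbT.
by rewrite inE => /predU1P[->|/h2].
Qed.

(* [U j], the vectors killed by all words of length [j] in [H], is stable under
   [ad y] because [y] normalizes [H]; modulo [U j] a word in [H + y] acts on
   [U j.+1] as a multiple of a power of [ad y]. *)
Lemma word_nilp_add (H : 'M[C]_n) y :
  subalg H -> word_nilp H -> ad_nilpotent br y ->
  (forall x, (x <= H)%MS -> (br x y <= H)%MS) ->
  word_nilp (H + y)%MS.
Proof.
move=> aH [N hN] yn Hy.
pose U j (v : V) := forall s, inside H s -> size s = j -> v *m word s = 0.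
have U0 v : U 0%N v -> v = 0.
  by move=> /(_ [::]); rewrite /word big_nil mulmx1; apply.
have UD j v w : U j v -> U j w -> U j (v + w).
  by move=> hv hw s h1 h2; rewrite mulmxDl hv ?hw ?addr0.
have UZ j a v : U j v -> U j (a *: v).
  by move=> hv s h1 h2; rewrite -scalemxAl hv ?scaler0.
have US j v : U j v -> U j.+1 v.
  move=> hv s; elim/last_ind: s => [//|s x _] hs; rewrite size_rcons => -[sj].
  rewrite /word -cats1 big_cat /= -mulmxE mulmxA hv ?mul0mx // => z zs.
  by apply: hs; rewrite mem_rcons inE zs orbT.
have Uh j v x : (x <= H)%MS -> U j.+1 v -> U j (v *m adm br x).
  move=> xH hv s sH sj; rewrite -mulmxA -word_cons; apply: hv => /=; last by rewrite sj.
  exact/inside_cons.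
have Uy j : forall v, U j v -> U j (v *m adm br y).
  elim: j => [|j IH] v hv; first by rewrite (U0 _ hv) mul0mx => s _ _; rewrite mul0mx.
  case=> [//|x s] /inside_cons[xH sH] /= [sj].
  have -> : v *m adm br y *m word (x :: s) =
     v *m adm br x *m adm br y *m word s + v *m adm br (br x y) *m word s.
    rewrite -mulmxDl -mulmxA word_cons mulmxA mulmxA; congr (_ *m _).
    by rewrite adm_br mulmxBr !mulmxA addrC subrK.
  rewrite (IH _ (Uh _ _ _ xH hv)) // add0r.
  by rewrite (Uh _ _ _ (Hy _ xH) hv).
have step j v s : U j.+1 v -> inside (H + y)%MS s ->
    exists c, U j (v *m word s - c *: (v *m adm br y ^+ size s)).
  move=> hv; elim/last_ind: s => [|s x IH] hs.
    exists 1; rewrite /word big_nil expr0 scale1r subrr.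
    by move=> s' _ _; rewrite mul0mx.
  have [|c hc] := IH; first by move=> z zs; apply: hs; rewrite mem_rcons inE zs orbT.
  have /sub_addsmxP[[u1 u2] /= xE] : (x <= H + y)%MS by apply: hs; rewrite mem_rcons mem_head.
  have hvs : U j.+1 (v *m word s).
    rewrite -[_ *m _](subrK (c *: (v *m adm br y ^+ size s))); apply: UD; first exact: US.
    apply: UZ; elim: (size s) => [|k IHk]; first by rewrite expr0 mulmx1.
    by rewrite exprSr -mulmxE mulmxA; apply: Uy.
  exists (u2 0 0 * c); rewrite size_rcons /word -cats1 big_cat /= big_seq1.
  have -> : adm br x = adm br (u1 *m H) + u2 0 0 *: adm br y.
    by rewrite xE admD [u2]mx11_scalar mul_scalar_mx admZ [in RHS]mxE eqxx mulr1n.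
  rewrite -mulmxE mulmxA mulmxDr exprSr -mulmxE mulmxA -addrA; apply: UD.
    by apply: Uh => //; apply: submxMl.
  rewrite -scalemxAr -scalerA -scalerBr; apply: UZ.
  by rewrite scalemxAl -mulmxBl; apply: Uy.
(* Each block of [n] letters lowers the level by one, as the [n]-th power of [ad y] is 0. *)
have main j : forall s v, inside (H + y)%MS s -> size s = (j * n)%N -> U j v -> v *m word s = 0.
  elim: j => [|j IH] s v sH ss hv.
    by rewrite (U0 _ hv) mul0mx.
  rewrite -[s](cat_take_drop n) /word big_cat /= -mulmxE mulmxA.
  have hn : size (take n s) = n.
    by rewrite size_take_min ss mulSn; apply/minn_idPl; apply: leq_addr.
  have [|c] := step j v (take n s) hv; first by move=> z /mem_take; apply: sH.
  rewrite hn yn mulmx0 scaler0 subr0 => hvn; apply: IH hvn.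
    by move=> z /mem_drop; apply: sH.
  by rewrite size_drop ss mulSn addKn.
exists (N * n)%N => s sH ss; apply/row_matrixP => i; rewrite row0 rowE.
apply: (main N) => // s' h1 h2.
by rewrite hN ?mulmx0.
Qed.

(** Grow [H] inside [L] one vector at a time. Among words in [H] that move some [x] in [L] to a
    vector outside [H], take a longest one: its value [y] lies in [L] but not in [H], and one more
    letter brings it into [H], so [y] normalizes [H]. *)
Lemma engel (L : 'M[C]_n) :
  subalg L -> (forall x, (x <= L)%MS -> ad_nilpotent br x) -> word_nilp L.
Proof.
move=> aL nL.
suff main k : (k <= \rank L)%N ->
    exists H : 'M[C]_n, [/\ (H <= L)%MS, subalg H, word_nilp H & (k <= \rank H)%N].
  have [H [HL aH [N hN] rH]] := main _ (leqnn _).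
  have LH : (L <= H)%MS by rewrite -(geq_leqif (mxrank_leqif_sup HL)).
  by exists N => s sL; apply: hN => x /sL xL; apply: submx_trans xL LH.
elim: k => [|k IH] kL.
  exists 0; split=> //; first exact: sub0mx.
    by move=> x y /submx0null -> _; rewrite br0l sub0mx.
  by exists 1%N => -[|x []] // /(_ x (mem_head _ _)) /submx0null ->; rewrite /word big_seq1 adm0.
have [H [HL aH hH rH]] := IH (ltnW kL).
have [|rk] := ltnP k (\rank H); first by exists H.
have LnH : ~~ (L <= H)%MS.
  by rewrite -(geq_leqif (mxrank_leqif_sup HL)) -ltnNge (leq_ltn_trans rk).
pose P m := `[< exists (x : V) s, [/\ (x <= L)%MS, inside H s, size s = m & ~~ (x *m word s <= H)%MS] >].
have exP : exists m, P m.
  have /row_subPn[i hi] := LnH; exists 0%N; apply/asboolP; exists (row i L), [::].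
  by split=> //; [exact: row_sub|rewrite /word big_nil mulmx1].
have [N hN] := hH.
have ubP m : P m -> (m <= N)%N.
  move/asboolP => [x [s [xL sH sm]]]; rewrite leqNgt; apply: contra => Nm.
  rewrite -[s](cat_take_drop N) /word big_cat /= -mulmxE mulmxA -/(word _).
  rewrite hN ?mulmx0 ?mul0mx ?sub0mx //; first by move=> z /mem_take /sH.
  by rewrite size_take_min sm; apply/minn_idPl/ltnW.
case: (ex_maxnP exP ubP) => m /asboolP[x [s [xL sH sm ny]]] mx.
set y := x *m word s in ny.
have yL : (y <= L)%MS.
  rewrite /y; elim: s {sm ny mx y} x xL sH => [|h s IHs] x xL sH.
    by rewrite /word big_nil mulmx1.
  rewrite word_cons mulmxA mul_adm; case/inside_cons: sH => hH' sH; apply: IHs => //.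
  by apply: aL => //; apply: submx_trans HL.
have Hy h : (h <= H)%MS -> (br h y <= H)%MS.
  move=> hh; apply/negPn/negP => nh.
  have : P m.+1.
    apply/asboolP; exists x, (rcons s h); split=> //.
    - move=> z; rewrite mem_rcons inE => /predU1P[->//|]; exact: sH.
    - by rewrite size_rcons sm.
    - by rewrite /word -cats1 big_cat big_seq1 /= -mulmxE mulmxA mul_adm.
  by move/mx; rewrite ltnn.
have HyL : (H + y <= L)%MS by rewrite addsmx_sub HL.
exists (H + y)%MS; split=> //.
- move=> a b /sub_addsmxP[[a1 a2] /= ->] /sub_addsmxP[[b1 b2] /= ->].
  rewrite [a2]mx11_scalar [b2]mx11_scalar !mul_scalar_mx.
  rewrite brDl !brDr !brZl !brZr brxx !scaler0 addr0.
  apply: submx_trans (addsmxSl _ _).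
  have sa : (a1 *m H <= H)%MS by apply: submxMl.
  have sb : (b1 *m H <= H)%MS by apply: submxMl.
  apply: addmx_sub; last by rewrite scalemx_sub // brC eqmx_opp Hy.
  by rewrite addmx_sub ?aH // scalemx_sub // Hy.
- by apply: word_nilp_add => //; apply: nL.
- apply: leq_ltn_trans rH _; apply: rank_ltmx; rewrite ltmxE addsmxSl /=.
  by rewrite addsmx_sub negb_and ny orbT.
Qed.

End LieAlgebra.

(** * Cartan's criterion *)

Section Cartan.
Variables (R : realType) (n : nat).
Local Notation C := (complex R).
Local Notation V := 'rV[C]_n.
Variable br : V -> V -> V.
Hypothesis lie : is_lie_bracket br.
Local Notation killing := (killing br).
Local Notation is_der := (is_der br).

Lemma derived_ind (I : 'M[C]_n) (P : V -> Prop) :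
  P 0 -> (forall x y, P x -> P y -> P (x + y)) -> (forall a x, P x -> P (a *: x)) ->
  (forall a b, (a <= I)%MS -> (b <= I)%MS -> P (br a b)) ->
  forall x, (x <= derived br I)%MS -> P x.
Proof.
move=> P0 PD PZ Pbr x /sub_sumsmxP[u ->].
apply: (big_ind P) => // i _.
have /sub_sumsmxP[w ->] := submxMl (u i) (\sum_(j < n) <<br (row i I) (row j I)>>)%MS.
apply: (big_ind P) => // j _.
have : (w j *m <<br (row i I) (row j I)>> <= br (row i I) (row j I))%MS.
  by rewrite -(genmxE (br _ _)) submxMl.
by move=> /sub_rVP[a ->]; apply: PZ; apply: Pbr; apply: row_sub.
Qed.

Lemma derived_mem (I : 'M[C]_n) a b :
  (a <= I)%MS -> (b <= I)%MS -> (br a b <= derived br I)%MS.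
Proof.
move=> /submxP[u ->] /submxP[w ->].
rewrite !mulmx_sum_row (br_suml lie) summx_sub // => i _.
rewrite (br_sumr lie) summx_sub // => j _.
rewrite (brZl lie) (brZr lie) !scalemx_sub //.
rewrite (submx_trans _ (sumsmx_sup i _ (submx_refl _))) //.
rewrite (submx_trans _ (sumsmx_sup j _ (submx_refl _))) //.
by rewrite genmxE.
Qed.

Lemma derived_ideal (I : 'M[C]_n) : is_ideal br I -> is_ideal br (derived br I).
Proof.
move=> hI x y.
apply: (@derived_ind I (fun y => (br x y <= derived br I)%MS)).
- by rewrite (br0r lie) sub0mx.
- by move=> a b ha hb; rewrite (brDr lie) addmx_sub.
- by move=> a b hb; rewrite (brZr lie) scalemx_sub.
- move=> a b ha hb; rewrite (jacobi lie) addmx_sub //; apply: derived_mem => //;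
  exact: hI.
Qed.

Lemma derived_sub (I : 'M[C]_n) : is_ideal br I -> (derived br I <= I)%MS.
Proof.
move=> hI; apply/row_subP => i.
apply: (@derived_ind I (fun y => (y <= I)%MS)); last exact: row_sub.
- exact: sub0mx.
- by move=> x y; apply: addmx_sub.
- by move=> a x; apply: scalemx_sub.
- by move=> a b _; apply: hI.
Qed.

Lemma spec_der D B (d : 'I_n -> C) (f : C -> C) :
  is_der D -> B \in unitmx -> (forall i, gev D (d i) (row i B)) ->
  {morph f : x y / x + y} -> is_der (spec B d f).
Proof.
move=> hD uB hB fD; apply: (der_ext lie (M := D)) => a b x y hx hy.
rewrite (spec_gev f uB hB hx) (spec_gev f uB hB hy).
rewrite (spec_gev f uB hB (gev_der lie hD hx hy)) fD.
by rewrite (brZl lie) (brZr lie) scalerDl.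
Qed.

Lemma gev0_nilpotent (M B : 'M[C]_n) :
  B \in unitmx -> (forall i, gev M 0 (row i B)) -> M ^+ n = 0.
Proof.
move=> uB hB; have /choice[k hk] i : exists k, row i B *m M ^+ k = 0.
  by have [k] := hB i; rewrite raddf0 subr0; exists k.
apply: (@nilpotent_expn _ _ _ (\sum_i k i)%N).
apply: (can_inj (mulKmx uB)); apply/row_matrixP => i.
by rewrite row_mul mulmx0 row0 (bigD1 i) //= exprD -mulmxE mulmxA hk mul0mx.
Qed.

(* For [x = [a, b]] with [a] in the radical of the Killing form, pairing [ad x]
   with the conjugate of its own semisimple part (again a derivation) gives 0;
   so the eigenvalues of [ad x] vanish. *)
Lemma perfect_radical_nilpotent (I : 'M[C]_n) :
  (forall x y, (x <= I)%MS -> killing x y = 0) -> (I <= derived br I)%MS ->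
  forall x, (x <= I)%MS -> ad_nilpotent br x.
Proof.
move=> hI II x xI; have [B [d [uB hB]]] := gev_basis (adm br x).
pose S := spec B d Num.conj.
have hS : is_der S by apply: spec_der uB hB _; [exact: adm_der|exact: rmorphD].
have trS : \tr (adm br x *m S) = 0.
  have := submx_trans xI II; apply: (@derived_ind I (fun z => \tr (adm br z *m S) = 0)).
  - by rewrite (adm0 lie) mul0mx mxtrace0.
  - by move=> a b ha hb; rewrite (admD lie) mulmxDl mxtraceD ha hb addr0.
  - by move=> a b hb; rewrite (admZ lie) -scalemxAl mxtraceZ hb mulr0.
  move=> a b aI bI; rewrite (adm_br lie) mxtrace_commutator.
  rewrite -opprB -(der_adm lie hS) mulmxN raddfN /=.
  by have := hI a (b *m S) aI; rewrite /killing => ->; rewrite oppr0.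
have d0 i : d i = 0.
  have : \sum_i d i * (d i)^* = 0 by rewrite -(mxtrace_mul_spec Num.conj uB hB).
  move/psumr_eq0P => h; have /eqP := h (fun j _ => mul_conjC_ge0 (d j)) i isT.
  by rewrite mul_conjC_eq0 => /eqP.
by apply: (gev0_nilpotent uB) => i; rewrite -(d0 i).
Qed.

(** As [I] is perfect, its elements are combinations of iterated brackets of any prescribed length,
    that is, of values of words in [I]; long words vanish by Engel's theorem. *)
Lemma perfect_radical_eq0 (I : 'M[C]_n) : is_ideal br I ->
  (forall x y, (x <= I)%MS -> killing x y = 0) -> (I <= derived br I)%MS -> I = 0.
Proof.
move=> idI hI II.
have sI : subalg br I by move=> x y _; apply: idI.
have [N hN] := engel lie sI (perfect_radical_nilpotent hI II).
(* The test matrix [A] turns the claim into a linear condition that absorbs one more letter at each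
   step of the induction. *)
have main k (A : 'M[C]_n) : (forall s, inside I s -> size s = k ->
     forall b : V, (b <= I)%MS -> b *m word br s *m A = 0) ->
   forall b : V, (b <= I)%MS -> b *m A = 0.
  elim: k A => [|k IH] A hA b bI.
    by have := hA [::] _ erefl b bI; rewrite /word big_nil mulmx1; apply.
  have := submx_trans bI II; apply: (@derived_ind I (fun b => b *m A = 0)).
  - by rewrite mul0mx.
  - by move=> x y hx hy; rewrite mulmxDl hx hy addr0.
  - by move=> a x hx; rewrite -scalemxAl hx scaler0.
  move=> x y xI yI; rewrite -(mul_adm lie) -mulmxA; apply: IH yI => s sI' ss z zI.
  have := hA (rcons s x) _ _ z zI; rewrite /word -cats1 big_cat big_seq1 /= -mulmxE.
  rewrite !mulmxA; apply; last by rewrite size_cat ss addn1.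
  by move=> w; rewrite mem_cat inE => /orP[/sI'//|/eqP ->].
apply/row_matrixP => i; rewrite row0 -[row i I]mulmx1.
apply: (main N) (row_sub _ _) => s sI' ss b bI.
by rewrite (hN s) // mulmx0 mul0mx.
Qed.

(** The derived series of the radical of the form stops, by rank, at an ideal [I k] with [I k =
    [I k, I k]]. That ideal is 0, so the radical is solvable and vanishes by semisimplicity. *)
Lemma killing_nondegenerate : semisimple br ->
  forall x, (forall y, killing x y = 0) -> x = 0.
Proof.
move=> ss x hx; have [G hG] := killing_mx lie.
have radP z : (z <= kermx G)%MS <-> forall y, killing z y = 0.
  split=> [/sub_kermxP zG y|h].
    have := hG z y; rewrite zG mul0mx => /esym/eqP.
    by rewrite -scalemx1 scaler_eq0 oner_eq0 orbF => /eqP.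
  apply/sub_kermxP/rowP => j; have := hG z (delta_mx 0 j).
  rewrite h raddf0 trmx_delta -colE => /matrixP/(_ 0 0).
  by rewrite [LHS]mxE [RHS]mxE => ->; rewrite mxE.
have idK : is_ideal br (kermx G).
  move=> a b /radP hb; apply/radP => y.
  by rewrite (brC lie) (_ : - br b a = br b (- a)) ?(killing_inv lie) ?hb // (brNr lie).
pose I k := iter k (derived br) (kermx G).
have idI k : is_ideal br (I k) by elim: k => // k IH; apply: derived_ideal.
have IK k : (I k <= kermx G)%MS.
  elim: k => [|k IH]; first exact: submx_refl.
  exact: submx_trans (derived_sub (idI k)) IH.
have [k hk] : exists k, (I k <= derived br (I k))%MS.
  apply: contrapT => h.
  have lt k : (\rank (I k.+1) < \rank (I k))%N.
    rewrite ltnNge (geq_leqif (mxrank_leqif_sup (derived_sub (idI k)))).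
    by apply/negP => hk; apply: h; exists k.
  have le k : (\rank (I k) + k <= \rank (I 0%N))%N.
    elim: k => [|k IH]; first by rewrite addn0.
    by apply: leq_trans IH; rewrite addnS -addSn leq_add2r lt.
  have := leq_trans (leq_addl _ _) (le (\rank (I 0%N)).+1).
  by rewrite ltnn.
have I0 : I k = 0.
  by apply: perfect_radical_eq0 => // a b /submx_trans/(_ (IK k))/radP.
have : (kermx G == (0 : 'M[C]_n))%MS.
  by apply: ss => //; exists k; rewrite -/(I k) I0; apply/andP; rewrite !submx_refl.
case/andP => h _; apply/eqP; rewrite -submx0; apply: submx_trans h.
exact/radP.
Qed.

Hypothesis nondeg : forall x, (forall y, killing x y = 0) -> x = 0.

Lemma killing_repr (u : 'cV[C]_n) : exists h, forall y, (killing h y)%:M = y *m u.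
Proof.
have [G hG] := killing_mx lie.
have uG : G \in unitmx.
  rewrite -row_free_unit -kermx_eq0; apply/eqP/row_matrixP => i; rewrite row0.
  apply: nondeg => y; have := hG (row i (kermx G)) y.
  have -> : row i (kermx G) *m G = 0 by apply/sub_kermxP; exact: row_sub.
  by rewrite mul0mx => /matrixP/(_ 0 0); rewrite !mxE mulr1n.
exists (u^T *m invmx G) => y; rewrite -hG mulmxKV //.
by rewrite -trmx_mul [y *m u]mx11_scalar tr_scalar_mx.
Qed.

(** Let [h] represent the functional [y -> tr (D ad y)]. Then [E = D - ad h] is trace-orthogonal to
    all [ad y], and since [ad (E x)] is a commutator of [E] and [ad x], the vector [E x] is in the
    radical of the Killing form. *)
Lemma der_inner D : is_der D -> exists h, adm br h = D.
Proof.
move=> hD; have [h hh] := killing_repr (\col_j \tr (D *m adm br (delta_mx 0 j))).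
exists h; pose E := D - adm br h.
have hE : is_der E.
  move=> x y; rewrite !mulmxBr hD (adm_der lie) (brBl lie) (brBr lie).
  by rewrite opprD addrACA.
have trE y : \tr (E *m adm br y) = 0.
  rewrite mulmxBl mxtraceB; apply/eqP; rewrite subr_eq0; apply/eqP.
  have /matrixP/(_ 0 0) := hh y; rewrite !mxE mulr1n /killing => ->.
  rewrite [y in LHS]row_sum_delta (adm_sum lie) mulmx_sumr raddf_sum /=.
  by apply: eq_bigr => i _; rewrite (admZ lie) -scalemxAr mxtraceZ mxE.
apply/eqP; rewrite eq_sym -subr_eq0; apply/eqP/row_matrixP => i.
rewrite row0 rowE; apply: nondeg => y; rewrite /killing (der_adm lie hE).
by rewrite -/E mxtrace_commutator -(adm_br lie) trE.
Qed.

End Cartan.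

(** * The adjoint group *)

(** A Cauchy product of finite families: [p + p] antidiagonals cover the square that supports
    [f]. *)
Lemma diagonal_sum (W : zmodType) p (f : nat -> nat -> W) :
  (forall i j, (p <= i)%N -> f i j = 0) -> (forall i j, (p <= j)%N -> f i j = 0) ->
  \sum_(0 <= k < p + p) \sum_(0 <= i < k.+1) f i (k - i)%N =
  \sum_(0 <= i < p) \sum_(0 <= j < p) f i j.
Proof.
move=> f1 f2.
have -> : \sum_(0 <= k < p + p) \sum_(0 <= i < k.+1) f i (k - i)%N =
    \sum_(0 <= i < p + p) \sum_(0 <= j < p + p - i) f i j.
  elim: (p + p)%N => [|m IH]; first by rewrite !big_geq.
  rewrite big_nat_recr //= IH [RHS]big_nat_recr //= subSnn big_nat1.
  rewrite [X in _ + X]big_nat_recr //= subnn addrA; congr (_ + _).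
  rewrite -big_split /=; apply: eq_big_nat => i /andP[_ im].
  by rewrite subSn ?(ltnW im) // big_nat_recr.
rewrite (big_cat_nat (n := p)) ?leq_addr //= [X in _ + X]big_nat_cond [X in _ + X]big1.
  rewrite addr0; apply: eq_big_nat => i /andP[_ ip].
  have pi : (p <= p + p - i)%N by rewrite -addnBA ?leq_addr // ltnW.
  rewrite (big_cat_nat (n := p)) //= [X in _ + X]big_nat_cond [X in _ + X]big1 ?addr0 //.
  by move=> j /andP[/andP[pj _] _]; apply: f2.
move=> i /andP[/andP[pi _] _]; rewrite big1 // => j _; exact: f1.
Qed.

Section AdjointGroup.
Variables (R : realType) (n : nat).
Local Notation C := (complex R).
Local Notation V := 'rV[C]_n.
Variable br : V -> V -> V.
Hypothesis lie : is_lie_bracket br.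
Local Notation is_der := (is_der br).
Local Notation G := (in_adjoint_group br).

Definition dpow (A : 'M[C]_n) (k : nat) : 'M[C]_n := (k`!)%:R^-1 *: A ^+ k.

Lemma exp_adE x : exp_ad br x = \sum_(0 <= k < n.+1) dpow (adm br x) k.
Proof. by rewrite big_mkord. Qed.

Lemma dpowS A k : dpow A k *m A = k.+1%:R *: dpow A k.+1.
Proof.
rewrite /dpow -scalemxAl mulmxE -exprSr scalerA; congr (_ *: _).
rewrite factS natrM invfM mulrA mulfV ?mul1r //.
by rewrite pnatr_eq0.
Qed.

Lemma dpowSl A k : A *m dpow A k = k.+1%:R *: dpow A k.+1.
Proof.
rewrite -dpowS /dpow -scalemxAr -scalemxAl; congr (_ *: _).
by rewrite mulmxE -exprS exprSr.
Qed.

Lemma dpow0 A : dpow A 0 = 1%:M.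
Proof. by rewrite /dpow expr0 fact0 invr1 scale1r. Qed.

Lemma dpow_big A k : A ^+ n = 0 -> (n.+1 <= k)%N -> dpow A k = 0.
Proof.
move=> An /ltnW nk; rewrite /dpow -(subnK nk) exprD An mulr0.
by rewrite scaler0.
Qed.

Lemma natS_inj (W : lmodType C) k (v w : W) : k.+1%:R *: v = k.+1%:R *: w -> v = w.
Proof. by apply: scalerI; rewrite pnatr_eq0. Qed.

(** Divided powers absorb the binomial coefficients. The induction step is checked after
    multiplication by [k.+1 = i + (k.+1 - i)]. *)
Lemma leibniz A u v k : is_der A ->
  br u v *m dpow A k = \sum_(0 <= i < k.+1) br (u *m dpow A i) (v *m dpow A (k - i)).
Proof.
move=> hA; elim: k => [|k IH]; first by rewrite big_nat1 !dpow0 !mulmx1.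
apply: (@natS_inj _ k); rewrite scalemxAr -dpowS mulmxA IH mulmx_suml.
pose F i := br (u *m dpow A i) (v *m dpow A (k.+1 - i)).
transitivity (\sum_(0 <= i < k.+1) (i.+1%:R *: F i.+1) +
              \sum_(0 <= i < k.+1) ((k.+1 - i)%:R *: F i)).
  rewrite -big_split /=; apply: eq_big_nat => i /andP[_ ik].
  rewrite hA -!mulmxA !dpowS -(scalemxAr i.+1%:R) -(scalemxAr (k - i).+1%:R).
  by rewrite (brZl lie) (brZr lie) /F subSS subSn.
have -> : \sum_(0 <= i < k.+1) (i.+1%:R *: F i.+1) = \sum_(0 <= i < k.+2) (i%:R *: F i).
  by rewrite [RHS]big_nat_recl //= scale0r add0r.
have -> : \sum_(0 <= i < k.+1) ((k.+1 - i)%:R *: F i) =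
          \sum_(0 <= i < k.+2) ((k.+1 - i)%:R *: F i).
  by rewrite [RHS]big_nat_recr //= subnn scale0r addr0.
rewrite -big_split /= scaler_sumr; apply: eq_big_nat => i /andP[_ ik].
by rewrite -scalerDl -natrD subnKC.
Qed.

Lemma exp_ad_aut x : ad_nilpotent br x -> forall u v,
  br u v *m exp_ad br x = br (u *m exp_ad br x) (v *m exp_ad br x).
Proof.
move=> xn u v; set A := adm br x.
have big_zero k : (n.+1 <= k)%N -> dpow A k = 0 by apply: dpow_big.
rewrite exp_adE !mulmx_sumr.
transitivity (\sum_(0 <= k < n.+1 + n.+1) br u v *m dpow A k).
  rewrite [RHS](big_cat_nat (n := n.+1)) ?leq_addr //= [X in _ = _ + X]big_nat_cond.
  rewrite [X in _ = _ + X]big1 ?addr0 // => k /andP[/andP[nk _] _].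
  by rewrite big_zero ?mulmx0.
under eq_bigr => k _ do rewrite (leibniz u v k (adm_der lie x)).
rewrite (diagonal_sum (f := fun i j => br (u *m dpow A i) (v *m dpow A j))).
- by rewrite (br_suml lie); apply: eq_bigr => i _; rewrite (br_sumr lie).
- by move=> i j /big_zero ->; rewrite mulmx0 (br0l lie).
- by move=> i j /big_zero ->; rewrite mulmx0 (br0r lie).
Qed.

Lemma exp_adN x : ad_nilpotent br x -> exp_ad br (- x) *m exp_ad br x = 1%:M.
Proof.
move=> xn; set A := adm br x.
have NA : adm br (- x) = - A by apply: admN.
have big_zero k : (n.+1 <= k)%N -> dpow A k = 0 by apply: dpow_big.
have big_zeroN k : (n.+1 <= k)%N -> dpow (- A) k = 0.
  by apply: dpow_big; rewrite exprNn (_ : A ^+ n = 0) ?mulr0.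
rewrite !exp_adE NA mulmx_suml.
under eq_bigr => i _ do rewrite mulmx_sumr.
rewrite -(diagonal_sum (f := fun i j => dpow (- A) i *m dpow A j)); first last.
- by move=> i j /big_zero ->; rewrite mulmx0.
- by move=> i j /big_zeroN ->; rewrite mul0mx.
rewrite addSn big_nat_recl //= big_nat1 !dpow0 mulmx1 [X in _ + X]big1 ?addr0 // => k _.
apply: (@natS_inj _ k); rewrite scaler0 scaler_sumr.
pose F i := dpow (- A) i *m dpow A (k.+1 - i).
(* Splitting [k.+1] as [i + (k.+1 - i)] mimics the derivative of [exp (- A) exp A]: the two halves
   cancel. *)
transitivity (\sum_(0 <= i < k.+2) (i%:R *: F i) +
          \sum_(0 <= i < k.+2) ((k.+1 - i)%:R *: F i)).
  rewrite -big_split /=; apply: eq_big_nat => i /andP[_ ik].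
  by rewrite -scalerDl -natrD subnKC.
rewrite big_nat_recl //= scale0r add0r [X in _ + X]big_nat_recr //= subnn scale0r addr0.
rewrite -big_split /= big_nat_cond big1 // => i /andP[/andP[_ ik] _].
rewrite /F subSS scalemxAl -dpowS mulmxN mulNmx.
have -> : (k.+1 - i)%:R *: (dpow (- A) i *m dpow A (k.+1 - i)) =
   dpow (- A) i *m A *m dpow A (k - i).
  by rewrite -mulmxA dpowSl scalemxAr subSn.
by rewrite addNr.
Qed.

Lemma ad_nilpotentN x : ad_nilpotent br x -> ad_nilpotent br (- x).
Proof. by rewrite /ad_nilpotent (admN lie) exprNn => ->; rewrite mulr0. Qed.

Lemma G1 : G 1%:M.
Proof. by exists [::]; split=> //; rewrite big_nil. Qed.

Lemma G_exp x : ad_nilpotent br x -> G (exp_ad br x).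
Proof. by exists [:: x]; split=> [y|]; rewrite ?inE ?big_seq1 // => /eqP ->. Qed.

Lemma GM g h : G g -> G h -> G (g *m h).
Proof.
move=> [s [hs ->]] [t [ht ->]]; exists (s ++ t); split; last by rewrite big_cat.
by move=> x; rewrite mem_cat => /orP[/hs|/ht].
Qed.

Lemma GV g : G g -> exists g', [/\ G g', g *m g' = 1%:M & g' *m g = 1%:M].
Proof.
move=> [s [hs ->]]; elim: s hs => [|x s IH] hs.
  by exists 1%:M; rewrite big_nil mulmx1; split=> //; apply: G1.
have [|g' [Gg' gg' g'g]] := IH; first by move=> y ys; apply: hs; rewrite inE ys orbT.
have xn : ad_nilpotent br x by apply: hs; rewrite mem_head.
have nxn := ad_nilpotentN xn.
exists (g' *m exp_ad br (- x)); rewrite big_cons -mulmxE; split.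
- exact: GM (G_exp nxn).
- rewrite mulmxA -(mulmxA (exp_ad br x)) gg' mulmx1.
  by have := exp_adN nxn; rewrite opprK.
- by rewrite mulmxA -(mulmxA g') exp_adN // mulmx1.
Qed.

Lemma G_aut g : G g -> forall u v, br u v *m g = br (u *m g) (v *m g).
Proof.
move=> [s [hs ->]]; elim: s hs => [|x s IH] hs u v.
  by rewrite big_nil !mulmx1.
rewrite big_cons -mulmxE !mulmxA exp_ad_aut; last by apply: hs; rewrite mem_head.
by rewrite IH // => y ys; apply: hs; rewrite inE ys orbT.
Qed.

Lemma adm_aut g y : G g -> g *m adm br (y *m g) = adm br y *m g.
Proof.
move=> Gg; apply/row_matrixP => i; rewrite !row_mul [row i (adm br y)]rowE (mul_adm lie) (mul_adm lie).
by rewrite (G_aut Gg) rowE.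
Qed.

Lemma ad_nilpotent_aut g y : G g -> ad_nilpotent br y -> ad_nilpotent br (y *m g).
Proof.
move=> Gg; rewrite /ad_nilpotent => yn; have [g' [_ gg' g'g]] := GV Gg.
have E k : g *m adm br (y *m g) ^+ k = adm br y ^+ k *m g.
  elim: k => [|k IH]; first by rewrite !expr0 mulmx1 mul1mx.
  by rewrite !exprS -!mulmxE mulmxA adm_aut // -!mulmxA IH.
by rewrite -[LHS]mul1mx -g'g -mulmxA E yn mul0mx mulmx0.
Qed.

End AdjointGroup.

(** * Extracting a grading element from a principal nilpotent pair *)

Section Irrational.
Variable R : realType.
Local Notation C := (complex R).

(* The degree [a + b * rt2] encodes the bidegree [(a, b)], cf. [rt2_indep]. *)
Definition rt2 : C := real_complex R (Num.sqrt 2).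

Lemma rt2_sqr : rt2 ^+ 2 = 2.
Proof. by rewrite -rmorphXn /= sqr_sqrtr // rmorph_nat. Qed.

Lemma rt2_ge0 : 0 <= rt2.
Proof. by rewrite ler0c sqrtr_ge0. Qed.

(** The exponents of 2 on the two sides have different parity. *)
Lemma double_square (p q : nat) : (p ^ 2 = 2 * q ^ 2)%N -> q = 0%N.
Proof.
move=> e; case: (posnP q) => // q0.
have p0 : (0 < p)%N.
  have : (0 < p ^ 2)%N by rewrite e muln_gt0 expn_gt0 q0.
  by rewrite expn_gt0 orbF.
have := congr1 (logn 2) e; rewrite lognM ?expn_gt0 ?q0 // !lognX (@logn_prime 2 2) //.
by move/(congr1 odd); rewrite oddD !oddM.
Qed.

Lemma rt2_indep (p q p' q' : nat) :
  p%:R + q%:R * rt2 = p'%:R + q'%:R * rt2 -> p = p' /\ q = q'.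
Proof.
wlog qq : p q p' q' / (q <= q')%N => [hw|] e.
  by have [/hw|/ltnW/hw] := leqP q q'; [apply|case/(_ p' p (esym e))].
have e2 : p%:R - p'%:R = (q' - q)%:R * rt2.
  by rewrite natrB // mulrBl; apply/eqP; rewrite subr_eq addrAC eq_sym subr_eq e addrC.
have pp : (p' <= p)%N.
  by rewrite -(ler_nat C) -subr_ge0 e2 mulr_ge0 ?ler0n ?rt2_ge0.
have /double_square/eqP : ((p - p') ^ 2 = 2 * (q' - q) ^ 2)%N.
  apply/eqP; rewrite -(eqr_nat C) natrM !natrX [(p - p')%:R]natrB // e2 exprMn rt2_sqr.
  by rewrite mulrC.
rewrite subn_eq0 => q'q; have qE : q = q' by apply/eqP; rewrite eqn_leq qq.
split=> //; move: e; rewrite qE => /addIr/eqP; by rewrite eqr_nat => /eqP.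
Qed.

End Irrational.

Section Characteristic.
Variables (R : realType) (n : nat).
Local Notation C := (complex R).
Local Notation V := 'rV[C]_n.
Variable br : V -> V -> V.
Hypothesis lie : is_lie_bracket br.
Hypothesis nondeg : forall x, (forall y, killing br x y = 0) -> x = 0.

(* [ln |g|] of an automorphism [g] is a derivation, because ln |.| turns
   products of eigenvalues into sums. *)
Lemma log_aut (g : 'M[C]_n) : g \in unitmx ->
  (forall u v, br u v *m g = br (u *m g) (v *m g)) ->
  exists S B (d : 'I_n -> R), [/\ is_der br S, B \in unitmx,
    forall i, row i B *m S = real_complex R (d i) *: row i B &
    forall (t : R) (v : V), v *m g = real_complex R (sequences.expR t) *: v ->
      v *m S = real_complex R t *: v].
Proof.
move=> ug hg; have [B [d [uB hB]]] := gev_basis g.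
pose f (z : C) : R := exp.ln (Normc.normc z).
pose S := spec B d (fun z => real_complex R (f z)).
have hS a v : gev g a v -> v *m S = real_complex R (f a) *: v.
  by move=> hv; apply: spec_gev uB hB hv.
have a0 a v : gev g a v -> v != 0 -> a != 0.
  move=> [k hk]; apply: contra_neq => a0; move: hk; rewrite a0 raddf0 subr0.
  elim: k => [|k IH]; first by rewrite expr0 mulmx1.
  by rewrite exprSr -mulmxE mulmxA => /(congr1 (mulmx^~ (invmx g))); rewrite mulmxK // mul0mx.
have npos (z : C) : z != 0 -> Normc.normc z \in Num.pos.
  move=> z0; rewrite posrE lt_def; apply/andP; split.
    by apply: contra_neq z0 => /Normc.eq0_normc.
  by case: z {z0} => a b; apply: sqrtr_ge0.
exists S, B, (fun i => f (d i)); split=> //.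
- apply: (der_ext lie (M := g)) => a b x y hx hy.
  (* The zero vector is a generalized eigenvector for every value, even for 0, where [ln] is not
     additive on products. *)
  have [->|x0] := eqVneq x 0; first by rewrite !(br0l lie, mul0mx) addr0.
  have [->|y0] := eqVneq y 0; first by rewrite !(br0r lie, mul0mx) addr0.
  rewrite (hS _ _ hx) (hS _ _ hy) (hS _ _ (gev_aut lie hg hx hy)).
  rewrite /f Normc.normcM exp.lnM ?npos ?(a0 _ _ hx) ?(a0 _ _ hy) //.
  by rewrite rmorphD scalerDl (brZl lie) (brZr lie).
- by move=> i; apply: hS (hB i).
move=> t v /eigen_gev/hS ->; congr (real_complex R _ *: _).
rewrite /f /= expr0n /= addr0 sqrtr_sqr ger0_norm; first by rewrite exp.expRK.
by rewrite ltW // exp.expR_gt0.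
Qed.

Lemma characteristic (e1 e2 : V) : principal_nilpotent_pair br e1 e2 ->
  exists h B (d : 'I_n -> R), [/\ B \in unitmx,
    forall i, br h (row i B) = real_complex R (d i) *: row i B,
    br h e1 = e1 & br h e2 = rt2 R *: e2].
Proof.
move=> [_ _ hG].
have ex0 (t : R) : real_complex R (sequences.expR t) != 0.
  by rewrite -(rmorph0 (real_complex R)) (inj_eq (@complexI _)) gt_eqF // exp.expR_gt0.
have [g [Gg [g1 g2]]] := hG _ _ (ex0 1) (ex0 (Num.sqrt 2)).
have ug : g \in unitmx by have [g' [_ /mulmx1_unit[]]] := GV lie Gg.
have [S [B [d [dS uB hB hS]]]] := log_aut ug (G_aut lie Gg).
have [h hE] := der_inner lie nondeg dS.
have brh v : br h v = v *m S by rewrite -hE (mul_adm lie).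
exists h, B, d; split=> //.
- by move=> i; rewrite brh hB.
- by rewrite brh (hS _ _ g1) rmorph1 scale1r.
- by rewrite brh (hS _ _ g2).
Qed.

End Characteristic.

(** * The Koszul complex of a pair *)

Section DegreeProjection.
Variables (K : fieldType) (n : nat) (d : 'I_n -> K).

Definition proj (Q : pred K) : 'M[K]_n := diag_mx (\row_i (Q (d i))%:R).

Lemma mul_projE (v : 'rV[K]_n) Q j : (v *m proj Q) 0 j = v 0 j *+ Q (d j).
Proof. by rewrite mul_mx_diag !mxE mulr_natr. Qed.

Lemma proj_sub (v : 'rV[K]_n) Q : (v <= proj Q)%MS = (v *m proj Q == v).
Proof.
apply/idP/eqP => [/submxP[u ->]|<-]; last exact: submxMl.
by apply/rowP => j; rewrite !mul_projE; case: (Q _); rewrite ?mulr0n.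
Qed.

Lemma proj_id Q : proj Q *m proj Q = proj Q.
Proof.
apply/row_matrixP => i; rewrite row_mul; apply/eqP; rewrite -proj_sub.
exact: row_sub.
Qed.

Lemma rank_proj Q : \rank (proj Q) = (\sum_i Q (d i))%N.
Proof.
pose S := [set i | Q (d i)].
pose E : 'M[K]_(#|S|, n) := \matrix_(k, j) (enum_val k == j)%:R.
have EE : E *m E^T = 1%:M.
  apply/matrixP => k l; rewrite !mxE (bigD1 (enum_val k)) //= !mxE eqxx mul1r.
  rewrite big1 ?addr0 => [|j /negPf jk]; last by rewrite mxE eq_sym jk mul0r.
  by rewrite (inj_eq enum_val_inj) eq_sym.
have EP : E *m proj Q = E.
  apply/row_matrixP => k; rewrite row_mul; apply/rowP => j; rewrite mul_projE !mxE.
  case: eqP => [<-|_]; last by rewrite mul0rn.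
  by have := enum_valP k; rewrite inE => ->.
have PE : E^T *m E = proj Q.
  apply/matrixP => i j; rewrite !mxE.
  have [iS|niS] := boolP (i \in S).
    rewrite (bigD1 (enum_rank_in iS i)) //= !mxE enum_rankK_in // eqxx mul1r.
    rewrite big1 ?addr0 => [|k ki]; last first.
      rewrite !mxE; case: eqP => [ik|_]; last by rewrite mul0r.
      by case/negP: ki; rewrite -{1}(enum_valK_in iS k) ik.
    by move: iS; rewrite inE => ->; rewrite mulrb; case: (i == j).
  rewrite big1 => [|k _]; last first.
    rewrite !mxE; case: eqP => [ik|_]; last by rewrite mul0r.
    by move: niS; rewrite -ik enum_valP.
  by move: niS; rewrite inE => /negPf ->; rewrite mul0rn.
have -> : \rank (proj Q) = \rank E.
  apply/eqP; rewrite eqn_leq -{1}PE mxrankM_maxr /= -{1}EP.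
  exact: mxrankM_maxr.
have /eqP -> : row_free E by apply/row_freeP; exists E^T.
by rewrite -sum1_card big_mkcond; apply: eq_bigr => i _; rewrite inE; case: (Q _).
Qed.

Lemma proj_shift (A : 'M[K]_n) (a : K) Q :
  (forall i j, A i j != 0 -> d j = d i + a) ->
  proj Q *m A = A *m proj (fun z => Q (z - a)).
Proof.
move=> hA; apply/matrixP => i j; rewrite mul_diag_mx mul_mx_diag !mxE.
have [->|/hA ->] := eqVneq (A i j) 0; first by rewrite mulr0 mul0r.
by rewrite addrK mulrC.
Qed.

Lemma proj_comp (Q Q' : pred K) :
  (forall z, ~~ (Q z && Q' z)) -> proj Q *m proj Q' = 0.
Proof.
move=> h; apply/matrixP => i j; rewrite mul_diag_mx !mxE.
have := h (d j); case: eqP => [->|_]; last by rewrite mulr0.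
by case: (Q _); case: (Q' _) => //= _; rewrite ?mulr0 ?mul0r.
Qed.

End DegreeProjection.

Section Koszul.
Variable R : realType.
Local Notation C := (complex R).
Local Notation w := (rt2 R).

(* Degrees of the terms of the Koszul complexes summed over the quadrant. *)
Definition Q00 (z : C) := `[< exists a b : nat, z = a%:R + b%:R * w >].
Definition Q10 z := Q00 (z - 1).
Definition Q01 z := Q00 (z - w).
Definition Q11 z := Q00 (z - 1 - w).

(** The Euler characteristic in a single degree: a bidegree [(a, b)] of the quadrant counts [1 -
    [a > 0] - [b > 0] + [a > 0][b > 0]], which is 0 except at the origin. *)
Lemma quadrant_count (z : C) : (Q00 z + Q11 z = Q10 z + Q01 z + (z == 0%R))%N.
Proof.
have h10 : Q10 z <-> exists a b : nat, z = a.+1%:R + b%:R * w.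
  split=> [/asboolP[a [b e]]|[a [b ->]]].
    by exists a, b; rewrite -[z](subrK 1) e -natr1 -!addrA (addrC 1).
  by apply/asboolP; exists a, b; rewrite -natr1; ring.
have h01 : Q01 z <-> exists a b : nat, z = a%:R + b.+1%:R * w.
  split=> [/asboolP[a [b e]]|[a [b ->]]].
    by exists a, b; rewrite -[z](subrK w) e -natr1; ring.
  by apply/asboolP; exists a, b; rewrite -natr1; ring.
have h11 : Q11 z <-> exists a b : nat, z = a.+1%:R + b.+1%:R * w.
  split=> [/asboolP[a [b e]]|[a [b ->]]].
    by exists a, b; rewrite -[z](subrK 1) -[z - 1](subrK w) e -!natr1; ring.
  by apply/asboolP; exists a, b; rewrite -!natr1; ring.
have h00 : Q00 z <-> exists a b : nat, z = a%:R + b%:R * w by split=> /asboolP.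
have no (a b : nat) : z = a%:R + b%:R * w -> z == 0 -> a = 0%N /\ b = 0%N.
  by move=> -> /eqP e; apply: (@rt2_indep R); rewrite e mul0r addr0.
have [z0|z0] := boolP (z == 0).
  have -> : Q00 z by apply/h00; exists 0%N, 0%N; rewrite (eqP z0) mul0r addr0.
  have /negPf -> : ~~ Q10 z by apply/negP => /h10[a [b /no/(_ z0)[]]].
  have /negPf -> : ~~ Q01 z by apply/negP => /h01[a [b /no/(_ z0)[]]].
  by have /negPf -> : ~~ Q11 z by apply/negP => /h11[a [b /no/(_ z0)[]]].
rewrite addn0; have [q10|q10] := boolP (Q10 z); have [q01|q01] := boolP (Q01 z).
- have [a [b e]] := proj1 h10 q10; have [a' [b' e']] := proj1 h01 q01.
  have [ea eb] : a.+1 = a' /\ b = b'.+1 by apply: (@rt2_indep R); rewrite -e -e'.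
  have -> : Q00 z by apply/h00; exists a.+1, b.
  by have -> : Q11 z by apply/h11; exists a, b'; rewrite -eb.
- have [a [b e]] := proj1 h10 q10.
  have -> : Q00 z by apply/h00; exists a.+1, b.
  have /negPf -> // : ~~ Q11 z.
  by apply: contra q01 => /h11[a' [b' ->]]; apply/asboolP; exists a'.+1, b'; rewrite -!natr1; ring.
- have [a [b e]] := proj1 h01 q01.
  have -> : Q00 z by apply/h00; exists a, b.+1.
  have /negPf -> // : ~~ Q11 z.
  by apply: contra q10 => /h11[a' [b' ->]]; apply/asboolP; exists a', b'.+1; rewrite -!natr1; ring.
have /negPf -> : ~~ Q11 z.
  by apply: contra q10 => /h11[a' [b' ->]]; apply/asboolP; exists a', b'.+1; rewrite -!natr1; ring.
have /negPf -> // : ~~ Q00 z.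
apply/negP => /h00[[|a] [[|b] e]].
- by move: z0; rewrite e mul0r addr0 eqxx.
- by case/negP: q01; apply/h01; exists 0%N, b.
- by case/negP: q10; apply/h10; exists a, 0%N.
- by case/negP: q10; apply/h10; exists a, b.+1.
Qed.

Lemma quadrant_disjoint (z : C) : ~~ (Q00 z && Q11 (- z)).
Proof.
apply/negP => /andP[/asboolP[a [b e]] /asboolP[a' [b' e']]].
have : (a + a'.+1)%:R + (b + b'.+1)%:R * w = 0%:R + 0%:R * w.
  have -> : (a + a'.+1)%:R + (b + b'.+1)%:R * w =
     (a%:R + b%:R * w) + (a'%:R + b'%:R * w) + 1 + w by rewrite !natrD -!natr1; ring.
  by rewrite -e -e'; ring.
by move/rt2_indep => []; rewrite addnS.
Qed.

(** In the application [A1], [A2] are [ad e1], [ad e2] and [Km] is the Gram matrix of the Killing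
    form, all in a basis of degrees [d]. *)
Variables (n : nat) (d : 'I_n -> C) (A1 A2 Km : 'M[C]_n).
Hypothesis A12 : A1 *m A2 = A2 *m A1.
Hypothesis deg1 : forall i j, A1 i j != 0 -> d j = d i + 1.
Hypothesis deg2 : forall i j, A2 i j != 0 -> d j = d i + w.
Hypothesis uK : Km \in unitmx.
Hypothesis degK : forall i j, Km i j != 0 -> d i + d j = 0.
Hypothesis inv1 : A1 *m Km = - (Km *m A1^T).
Hypothesis inv2 : A2 *m Km = - (Km *m A2^T).
Let L := kermx (row_mx A1 A2).
Hypothesis rankL : (\rank L <= \sum_i (d i == 0%R))%N.

Local Notation P := (proj d).
(** The differentials [d0], [d1] and the middle term [Pi] of the sum of the complexes; [K2] is the
    dual of the cokernel of [d1], realized inside the degrees [Q11]. *)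
Let d0 : 'M[C]_(n, n + n) := P Q00 *m row_mx A1 A2.
Let d1 : 'M[C]_(n + n, n) := col_mx (P Q10 *m A2) (- (P Q01 *m A1)).
Let Pi : 'M[C]_(n + n) := block_mx (P Q10) 0 0 (P Q01).
Let K2 : 'M[C]_n := (P Q11 :&: kermx (row_mx A2^T (- A1^T)))%MS.

Let rankPi : \rank Pi = (\rank (P Q10) + \rank (P Q01))%N.
Proof. by rewrite /Pi rank_diag_block_mx. Qed.

Let eq_proj (Q Q' : pred C) : Q =1 Q' -> P Q = P Q'.
Proof. by move=> h; rewrite /proj; congr diag_mx; apply/rowP => i; rewrite !mxE h. Qed.

Let s1_00 : P Q00 *m A1 = A1 *m P Q10.
Proof. by rewrite (proj_shift _ deg1). Qed.
Let s2_00 : P Q00 *m A2 = A2 *m P Q01.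
Proof. by rewrite (proj_shift _ deg2). Qed.
Let s1_01 : P Q01 *m A1 = A1 *m P Q11.
Proof. by rewrite (proj_shift _ deg1); congr (_ *m _); apply: eq_proj. Qed.
Let s2_10 : P Q10 *m A2 = A2 *m P Q11.
Proof.
rewrite (proj_shift _ deg2); congr (_ *m _); apply: eq_proj => z.
by rewrite /Q10 /Q11 addrAC.
Qed.

Let d0_sub : (d0 <= Pi :&: kermx d1)%MS.
Proof.
rewrite sub_capmx; apply/andP; split.
  have -> : d0 = d0 *m Pi; last exact: submxMl.
  rewrite /d0 /Pi mul_mx_row mul_row_block !mulmx0 addr0 add0r.
  by rewrite s1_00 s2_00 -!mulmxA !proj_id.
apply/sub_kermxP; rewrite /d0 /d1 mul_mx_row mul_row_col mulmxN.
rewrite s1_00 s2_00 -!mulmxA [P Q10 *m (_ *m _)]mulmxA proj_id.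
rewrite [P Q01 *m (_ *m _)]mulmxA proj_id s2_10 s1_01 !mulmxA A12.
by rewrite subrr.
Qed.

Let rank_d1 : (\rank d1 + \rank K2 = \rank (P Q11))%N.
Proof.
rewrite -(mxrank_mul_ker (P Q11) (row_mx A2^T (- A1^T))); congr (_ + _)%N.
rewrite -mxrank_tr; congr mxrank; rewrite /d1 tr_col_mx mul_mx_row.
rewrite s2_10 s1_01 linearN /= !trmx_mul mulmxN.
by rewrite /proj !tr_diag_mx.
Qed.

Let K2' : 'M[C]_n := K2 *m invmx Km.

(** Invariance of the form exchanges [A] and its transpose up to sign, so the dual of [H^2] becomes
    a part of [L], in opposite degrees. *)
Let K2'_sub : (K2' <= L)%MS /\ (K2' <= P (fun z => Q11 (- z)))%MS.
Proof.
have e1 : K2 *m A2^T = 0 /\ K2 *m A1^T = 0.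
  have : K2 *m row_mx A2^T (- A1^T) = 0 by apply/sub_kermxP/capmxSr.
  rewrite mul_mx_row => /eqP; rewrite row_mx_eq0 mulmxN oppr_eq0.
  by move=> /andP[/eqP ? /eqP ?].
have e2 : K2 *m P Q11 = K2.
  apply/row_matrixP => i; rewrite row_mul; apply/eqP; rewrite -proj_sub.
  by apply: submx_trans (row_sub _ _) (capmxSl _ _).
have kill (A : 'M_n) : A *m Km = - (Km *m A^T) -> K2 *m A^T = 0 -> K2' *m A = 0.
  move=> hA h; rewrite -[LHS](mulmxK uK) -(mulmxA K2') hA mulmxN mulmxA.
  by rewrite /K2' mulmxKV // h oppr0 mul0mx.
split.
  by apply/sub_kermxP; rewrite mul_mx_row !kill ?row_mx0 //; case: e1.
have PK : P (fun z => Q11 (- z)) *m Km = Km *m P Q11.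
  apply/matrixP => i j; rewrite mul_diag_mx mul_mx_diag !mxE.
  have [->|/degK] := eqVneq (Km i j) 0; first by rewrite mulr0 mul0r.
  by move/eqP; rewrite addr_eq0 => /eqP ->; rewrite opprK mulrC.
have -> : K2' = K2' *m P (fun z => Q11 (- z)); last exact: submxMl.
by rewrite -[RHS](mulmxK uK) -(mulmxA K2') PK mulmxA /K2' mulmxKV // e2.
Qed.

Let rank_count : (\rank (P Q00) + \rank (P Q11) =
  \rank (P Q10) + \rank (P Q01) + \sum_i (d i == 0%R))%N.
Proof.
rewrite !rank_proj -!big_split /=; apply: eq_bigr => i _.
exact: quadrant_count.
Qed.

Let K1 : 'M[C]_n := (P Q00 :&: L)%MS.

Let rank_sum : \rank (K1 + K2')%MS = (\rank K1 + \rank K2)%N.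
Proof.
rewrite mxrank_disjoint_sum; last first.
  apply/eqP/rowV0P => v; rewrite sub_capmx => /andP[h1 h2].
  have : v *m P Q00 = v by apply/eqP; rewrite -proj_sub (submx_trans h1) ?capmxSl.
  have : v *m P (fun z => Q11 (- z)) = v.
    by apply/eqP; rewrite -proj_sub (submx_trans h2) //; case: K2'_sub.
  move=> e2 e1; rewrite -e2 -e1 -mulmxA proj_comp ?mulmx0 //.
  exact: quadrant_disjoint.
by rewrite /K2' mxrankMfree // row_free_unit unitmx_inv.
Qed.

Let sum_subL : (K1 + K2' <= L)%MS.
Proof. by rewrite addsmx_sub capmxSr; case: K2'_sub. Qed.

Let idPi : Pi *m d1 = d1.
Proof.
rewrite /Pi /d1 mul_block_col !mul0mx addr0 add0r mulmxN.
by rewrite !mulmxA !proj_id.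
Qed.

(** Rank-nullity for [d0] and [d1] combined with [rank_count]. As [K1 + K2'] lies in [L], whose rank
    is at most the number of zero degrees, and the image of [d0] in the kernel of [d1], all these
    inequalities must be equalities; the next three lemmas read this off. *)
Let ineq : (\rank (Pi :&: kermx d1)%MS + \sum_i (d i == 0%R) =
   \rank d0 + \rank (K1 + K2')%MS)%N.
Proof.
have h1 := mxrank_mul_ker (P Q00) (row_mx A1 A2).
have h2 := mxrank_mul_ker Pi d1.
have h3 := rank_count; have h4 := rank_d1; have h5 := rank_sum.
rewrite idPi rankPi in h2; rewrite -/L -/K1 -/d0 in h1.
lia.
Qed.

Lemma koszul_exact (y1 y2 : 'rV[C]_n) :
  y1 *m P Q10 = y1 -> y2 *m P Q01 = y2 -> y1 *m A2 = y2 *m A1 ->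
  exists v, y1 = v *m A1 /\ y2 = v *m A2.
Proof.
move=> h1 h2 h12.
have sub : (Pi :&: kermx d1 <= d0)%MS.
  rewrite -(geq_leqif (mxrank_leqif_sup d0_sub)).
  have := ineq; have := mxrankS sum_subL; have := rankL; lia.
have : (row_mx y1 y2 <= d0)%MS.
  apply: submx_trans sub; rewrite sub_capmx; apply/andP; split.
    have -> : row_mx y1 y2 = row_mx y1 y2 *m Pi; last exact: submxMl.
    by rewrite /Pi mul_row_block !mulmx0 addr0 add0r h1 h2.
  by apply/sub_kermxP; rewrite /d1 mul_row_col mulmxN !mulmxA h1 h2 h12 subrr.
case/submxP => v; rewrite /d0 mulmxA mul_mx_row => /eq_row_mx[-> ->].
by exists (v *m P Q00).
Qed.

Lemma koszul_rank : \rank L = (\sum_i (d i == 0%R))%N.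
Proof.
have := ineq; have := mxrankS sum_subL; have := mxrankS d0_sub; have := rankL.
lia.
Qed.

Lemma koszul_degree (v : 'rV[C]_n) i :
  v *m A1 = 0 -> v *m A2 = 0 -> v 0 i != 0 -> Q00 (d i) || Q11 (- d i).
Proof.
move=> v1 v2 vi.
have sub : (L <= K1 + K2')%MS.
  rewrite -(geq_leqif (mxrank_leqif_sup sum_subL)).
  have := ineq; have := mxrankS d0_sub; have := rankL; lia.
have : (v <= K1 + K2')%MS.
  by apply: submx_trans sub; apply/sub_kermxP; rewrite mul_mx_row v1 v2 row_mx0.
case/sub_addsmxP => -[u1 u2] /= vE; move: vi; apply: contraNT.
rewrite negb_or => /andP[/negPf n1 /negPf n2].
have s1 : (u1 *m K1 <= P Q00)%MS by apply: submx_trans (submxMl _ _) (capmxSl _ _).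
have s2 : (u2 *m K2' <= P (fun z => Q11 (- z)))%MS.
  by apply: submx_trans (submxMl _ _) _; case: K2'_sub.
rewrite proj_sub in s1; rewrite proj_sub in s2.
by rewrite vE mxE -(eqP s1) -(eqP s2) !mul_projE n1 n2 addr0.
Qed.

End Koszul.

(** Apply the linear factors of the characteristic polynomial in turn to a vector of [W]: the last
    nonzero vector is an eigenvector. *)
Lemma stable_eigen (K : numClosedFieldType) n m (W : 'M[K]_(m, n)) (M : 'M[K]_n) :
  W != 0 -> (W *m M <= W)%MS ->
  exists a (v : 'rV_n), [/\ v != 0, (v <= W)%MS & v *m M = a *: v].
Proof.
case: n => [|n] in W M *; first by rewrite [W]thinmx0 eqxx.
move=> /rowV0Pn[v vW v0] sW.
have [r hr] := closed_field_poly_normal (char_poly M).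
rewrite (monicP (char_poly_monic M)) scale1r in hr.
have : v *m \prod_(z <- r) (M - z%:M) = 0.
  have -> : \prod_(z <- r) (M - z%:M) = horner_mx M (char_poly M).
    rewrite hr rmorph_prod; apply: eq_bigr => z _.
    by rewrite rmorphB /= horner_mx_X horner_mx_C.
  by rewrite Cayley_Hamilton mulmx0.
elim: r v vW v0 {hr} => [|z r IH] v vW v0.
  by rewrite big_nil mulmx1 => v00; rewrite v00 eqxx in v0.
rewrite big_cons -mulmxE mulmxA => h.
have [e|ne] := eqVneq (v *m (M - z%:M)) 0.
  exists z, v; split=> //; apply/eqP; rewrite -subr_eq0 -mul_mx_scalar -mulmxBr.
  exact/eqP.
apply: IH h => //; rewrite mulmxBr mul_mx_scalar addmx_sub ?eqmx_opp ?scalemx_sub //.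
exact: submx_trans (submxMr _ vW) sW.
Qed.

(** * Change of basis *)

Section Conjugation.
Variables (K : fieldType) (n : nat) (B : 'M[K]_n).
Hypothesis uB : B \in unitmx.

Definition cj (X : 'M[K]_n) := B *m X *m invmx B.

Lemma cjM X Y : cj X *m cj Y = cj (X *m Y).
Proof. by rewrite /cj !mulmxA mulmxKV. Qed.

Lemma mxtrace_cj X : \tr (cj X) = \tr X.
Proof. by rewrite /cj mxtrace_mulC mulmxA mulVmx // mul1mx. Qed.

Lemma cj_nilpotent X k : cj X ^+ k = 0 -> X ^+ k = 0.
Proof.
have E m : B *m X ^+ m = cj X ^+ m *m B.
  elim: m => [|m IH]; first by rewrite !expr0 mulmx1 mul1mx.
  by rewrite !exprSr -!mulmxE mulmxA IH /cj -!mulmxA mulVmx // mulmx1.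
by move=> hk; rewrite -[LHS](mulKmx uB) E hk mul0mx mulmx0.
Qed.

Lemma mul_cj (v : 'rV_n) X : v *m invmx B *m cj X = v *m X *m invmx B.
Proof. by rewrite /cj !mulmxA mulmxKV. Qed.

Lemma cj_solve (y v : 'rV_n) X : y *m invmx B = v *m cj X -> y = v *m B *m X.
Proof. by move=> e; rewrite -[y](mulmxKV uB) e /cj !mulmxA mulmxKV. Qed.

Lemma proj_row (d : 'I_n -> K) Q (v : 'rV_n) :
  v *m proj d Q *m B = \sum_(i | Q (d i)) v 0 i *: row i B.
Proof.
rewrite mulmx_sum_row [RHS]big_mkcond; apply: eq_bigr => i _.
by rewrite mul_projE; case: (Q _); rewrite ?mulr0n ?scale0r.
Qed.

Lemma cj_gram X G : X *m G = - (G *m X^T) ->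
  cj X *m (B *m G *m B^T) = - ((B *m G *m B^T) *m (cj X)^T).
Proof.
move=> XG; rewrite /cj !trmx_mul !mulmxA mulmxKV // -(mulmxA B X) XG.
rewrite mulmxN mulNmx; congr (- _); rewrite trmx_inv !mulmxA.
by rewrite -(mulmxA _ B^T) mulmxV ?unitmx_tr // mulmx1.
Qed.

Lemma rank_ker_cj X Y :
  \rank (kermx (row_mx (cj X) (cj Y))) = \rank (kermx (row_mx X Y)).
Proof.
rewrite !mxrank_ker; congr (_ - _)%N.
have -> : row_mx (cj X) (cj Y) =
    B *m row_mx X Y *m block_mx (invmx B) 0 0 (invmx B).
  by rewrite mul_mx_row mul_row_block !mulmx0 addr0 add0r.
rewrite mxrankMfree; first by rewrite eqmxMfull // row_full_unit.
rewrite row_free_unit unitmxE det_ublock unitrM -!unitmxE unitmx_inv.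
by rewrite uB.
Qed.

End Conjugation.

(** * Exactness for a principal nilpotent pair *)

Section PrincipalPair.
Variables (R : realType) (n : nat).
Local Notation C := (complex R).
Local Notation V := 'rV[C]_n.
Local Notation w := (rt2 R).
Variable br : V -> V -> V.
Hypothesis lie : is_lie_bracket br.
Hypothesis nondeg : forall x, (forall y, killing br x y = 0) -> x = 0.
Variables (e1 e2 : V) (r : nat).
Hypothesis e12 : br e1 e2 = 0.
Hypothesis rk : is_lie_rank br r.
Hypothesis dimz : dim_z2 br e1 e2 = r.

Lemma killing_skew x u v : killing br (br x u) v = - killing br u (br x v).
Proof.
by rewrite -(killing_inv lie) (brC lie x u) -[- br u x]scaleN1r killingZl // mulN1r.
Qed.

Lemma killing_gram : exists2 G : 'M[C]_n, G \in unitmx &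
  (forall x y, x *m G *m y^T = (killing br x y)%:M) /\
  (forall x, adm br x *m G = - (G *m (adm br x)^T)).
Proof.
have [G hG] := killing_mx lie; exists G.
  rewrite -row_free_unit -kermx_eq0; apply/eqP/row_matrixP => i; rewrite row0.
  apply: nondeg => y; have := hG (row i (kermx G)) y.
  have -> : row i (kermx G) *m G = 0 by apply/sub_kermxP; exact: row_sub.
  by rewrite mul0mx => /matrixP/(_ 0 0); rewrite !mxE mulr1n.
split=> // x; apply/matrixP => i j; pose di : V := delta_mx 0 i; pose dj : V := delta_mx 0 j.
have e (A : 'M[C]_n) : A i j = (di *m A *m dj^T) 0 0.
  by rewrite -rowE trmx_delta -colE !mxE.
rewrite e mulmxA (mul_adm lie) hG [RHS]mxE e mulmxA -mulmxA -trmx_mul (mul_adm lie) hG.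
by rewrite killing_skew !mxE.
Qed.

Section Grading.
Variables (h : V) (B : 'M[C]_n) (d : 'I_n -> C).
Hypothesis h1 : br h e1 = e1.
Hypothesis h2 : br h e2 = w *: e2.
Hypothesis uB : B \in unitmx.
Hypothesis hB : forall i, gev (adm br h) (d i) (row i B).

Local Notation A1 := (cj B (adm br e1)).
Local Notation A2 := (cj B (adm br e2)).

Let gev_e1 : gev (adm br h) 1 e1.
Proof. by apply: eigen_gev; rewrite (mul_adm lie) h1 scale1r. Qed.
Let gev_e2 : gev (adm br h) w e2.
Proof. by apply: eigen_gev; rewrite (mul_adm lie) h2. Qed.

Let coord (x : V) a : gev (adm br h) a x ->
  forall i j, cj B (adm br x) i j != 0 -> d j = d i + a.
Proof.
move=> hx i j; apply: contraNeq => dj.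
have -> : cj B (adm br x) i j = (br x (row i B) *m invmx B) 0 j.
  by rewrite -(mul_adm lie) -!row_mul [RHS]mxE.
rewrite (gev_coord uB hB (gev_der lie (adm_der lie h) hx (hB i))) //.
by rewrite addrC.
Qed.

(** The product of the two [ad] shifts degrees by [d i + d j]; if this is nonzero, there are no
    diagonal entries. *)
Lemma killing_degree i j : killing br (row i B) (row j B) != 0 -> d i + d j = 0.
Proof.
apply: contraNeq => dij; rewrite /killing.
rewrite -(mxtrace_cj uB) -(cjM uB).
rewrite /mxtrace big1 // => k _; rewrite mxE big1 // => l _.
have [/eqP ->|/(coord (hB i)) dl] := boolP (cj B (adm br (row i B)) k l == 0).
  by rewrite mul0r.
have [/eqP ->|/(coord (hB j)) dk] := boolP (cj B (adm br (row j B)) l k == 0).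
  by rewrite mulr0.
case/eqP: dij; apply: (addrI (d k)).
by rewrite addr0 addrA -dl -dk.
Qed.

Let A12 : A1 *m A2 = A2 *m A1.
Proof.
have e : adm br e1 *m adm br e2 = adm br e2 *m adm br e1.
  by apply/eqP; rewrite eq_sym -subr_eq0 -(adm_br lie) e12 (adm0 lie).
by rewrite (cjM uB) e -(cjM uB).
Qed.

Let gram : exists Km : 'M[C]_n, [/\ Km \in unitmx,
  forall i j, Km i j != 0 -> d i + d j = 0 &
  forall x, cj B (adm br x) *m Km = - (Km *m (cj B (adm br x))^T)].
Proof.
have [G uG [hG adG]] := killing_gram.
exists (B *m G *m B^T); split.
- by rewrite !unitmx_mul unitmx_tr uB uG.
- move=> i j; have -> : (B *m G *m B^T) i j = killing br (row i B) (row j B).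
    have /matrixP/(_ 0 0) := hG (row i B) (row j B); rewrite [RHS]mxE mulr1n => <-.
    by rewrite -row_mul !mxE; apply: eq_bigr => l _; rewrite !mxE.
  exact: killing_degree.
by move=> x; apply: cj_gram.
Qed.

Lemma rank_ker_coord : \rank (kermx (row_mx A1 A2)) = r.
Proof.
by rewrite (rank_ker_cj uB).
Qed.

(** Only an inequality, because [ad h] may have Jordan blocks here: the section is also applied to
    the modified element in [centralizer_eigenvalue]. *)
Lemma dimz_le_count : (dim_z br h <= \sum_i (d i == 0%R))%N.
Proof.
rewrite -(rank_proj d (fun z => z == 0)) /dim_z.
rewrite -(mxrankMfree _ (_ : row_free (invmx B))); last by rewrite row_free_unit unitmx_inv.
apply: mxrankS; apply/row_subP => i; rewrite proj_sub; apply/eqP/rowP => j.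
have kz : gev (adm br h) 0 (row i (kermx (adm br h))).
  by apply: eigen_gev; rewrite scale0r; apply/sub_kermxP; exact: row_sub.
rewrite mul_projE row_mul; have [dj|dj] := boolP (d j == 0); first by rewrite mulr1n.
by rewrite mulr0n (gev_coord uB hB kz dj).
Qed.

Let rankL : (\rank (kermx (row_mx A1 A2)) <= \sum_i (d i == 0%R))%N.
Proof.
rewrite rank_ker_coord; apply: leq_trans dimz_le_count.
by case: rk => _; apply.
Qed.

Lemma zero_degree_count : (\sum_i (d i == 0%R))%N = r.
Proof.
have [Km [uK dK iK]] := gram.
rewrite -rank_ker_coord.
exact/esym/(koszul_rank A12 (coord gev_e1) (coord gev_e2) uK dK (iK e1) (iK e2) rankL).
Qed.

Lemma killing_complex_exact y1 y2 :
  gev (adm br h) 1 y1 -> gev (adm br h) w y2 -> br e2 y1 = br e1 y2 ->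
  exists x, [/\ gev (adm br h) 0 x, y1 = br e1 x & y2 = br e2 x].
Proof.
move=> g1 g2 e; have [Km [uK dK iK]] := gram.
have fix_proj a (y : V) (Q : pred C) : gev (adm br h) a y -> Q a ->
    y *m invmx B *m proj d Q = y *m invmx B.
  move=> gy Qa; apply/rowP => j; rewrite mul_projE.
  have [->|dj] := eqVneq (d j) a; first by rewrite Qa.
  by rewrite (gev_coord uB hB gy dj) mul0rn.
have Q0 : Q00 (0 : C) by apply/asboolP; exists 0%N, 0%N; rewrite mul0r addr0.
have [|||v [v1 v2]] := koszul_exact A12 (coord gev_e1) (coord gev_e2) uK dK (iK e1) (iK e2)
   rankL (y1 := y1 *m invmx B) (y2 := y2 *m invmx B).
- have q : Q10 (1 : C) by rewrite /Q10 (subrr (1 : C)).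
  exact: fix_proj g1 q.
- have q : Q01 w by rewrite /Q01 (subrr w).
  exact: fix_proj g2 q.
- by rewrite !(mul_cj uB) !(mul_adm lie) e.
(* Exactness gives some [v] of mixed degrees; as [y1] and [y2] have the degrees of [e1] and [e2],
   its part of degree 0 already works. *)
pose x := v *m proj d (fun z => z == 0) *m B.
have hx k (y : V) a : gev (adm br h) a k -> gev (adm br h) a y ->
    y *m invmx B = v *m cj B (adm br k) -> y = br k x.
  move=> gk gy yv; rewrite -(mul_adm lie); apply: (cj_solve uB).
  have ps := proj_shift (fun z => z == 0) (coord gk).
  rewrite -(fix_proj a y (fun z => z - a == 0) gy (introT eqP (subrr a))) yv.
  exact: etrans (esym (mulmxA _ _ _)) (etrans (congr1 (mulmx v) (esym ps)) (mulmxA _ _ _)).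
exists x; split.
- have xE : x = \sum_(i | d i == 0) v 0 i *: row i B := proj_row B d _ v.
  rewrite xE.
  apply: gev_sum => i.
  move=> /eqP di.
  by have g := hB i; rewrite di in g; apply: gevZ.
- exact: hx gev_e1 g1 v1.
- exact: hx gev_e2 g2 v2.
Qed.

Lemma centralizer_degree y a : gev (adm br h) a y ->
  br e1 y = 0 -> br e2 y = 0 -> y != 0 -> Q00 a || Q11 (- a).
Proof.
move=> gy y1 y2 y0; have [Km [uK dK iK]] := gram.
have [i yi] : exists i, (y *m invmx B) 0 i != 0.
  apply: contrapT => hn; case/eqP: y0; rewrite -[y](mulmxKV uB).
  suff -> : y *m invmx B = 0 by rewrite mul0mx.
  apply/rowP => i; rewrite [RHS]mxE; apply/eqP/negPn/negP => hi.
  by apply: hn; exists i.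
have <- : d i = a by apply: contraNeq yi => /(gev_coord uB hB gy) ->.
apply: (koszul_degree A12 (coord gev_e1) (coord gev_e2) uK dK (iK e1) (iK e2) rankL _ _ yi).
  by rewrite (mul_cj uB) (mul_adm lie) y1 mul0mx.
by rewrite (mul_cj uB) (mul_adm lie) y2 mul0mx.
Qed.

End Grading.
End PrincipalPair.

(** * Rigidity *)

Lemma avoid_finite_nat (K : numDomainType) (l : seq K) : exists m : nat, m%:R \notin l.
Proof.
apply: contrapT => h.
have sub : {subset [seq (i%:R : K) | i <- iota 0 (size l).+1] <= l}.
  by move=> x /mapP[i _ ->]; apply/negPn/negP => xl; apply: h; exists i.
have ul : uniq [seq (i%:R : K) | i <- iota 0 (size l).+1].
  by rewrite map_inj_uniq ?iota_uniq // => i j /eqP; rewrite eqr_nat => /eqP.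
by have := uniq_leq_size ul sub; rewrite size_map size_iota ltnn.
Qed.

Section Diagonalizable.
Variables (K : numClosedFieldType) (n : nat) (M B : 'M[K]_n) (d : 'I_n -> K).
Hypothesis uB : B \in unitmx.
Hypothesis MB : forall i, row i B *m M = d i *: row i B.

Lemma diag_gev_basis i : gev M (d i) (row i B).
Proof. exact: eigen_gev (MB i). Qed.

Lemma diag_spec : M = spec B d id.
Proof.
apply: (can_inj (mulKmx uB)); apply/row_matrixP => i; rewrite !row_mul.
by rewrite (spec_gev id uB diag_gev_basis (diag_gev_basis i)) MB.
Qed.

Lemma diag_gev a v : gev M a v -> v *m M = a *: v.
Proof. by move=> hv; rewrite {1}diag_spec (spec_gev id uB diag_gev_basis hv). Qed.

Lemma diag_decomp (v : 'rV_n) : exists y y0, v = y0 + y *m M /\ y0 *m M = 0.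
Proof.
(* Since [0^-1 = 0], this is a pseudo-inverse of [M]. *)
pose S := spec B d (fun z => z^-1).
have SMM : S *m M *m M = M.
  rewrite diag_spec /S !(spec_mul _ _ _ uB); congr spec; apply: funext => x.
  by have [->|x0] := eqVneq x 0; [rewrite mulr0|rewrite mulVf // mul1r].
exists (v *m S), (v - v *m S *m M); split; first by rewrite subrK.
by rewrite mulmxBl -!(mulmxA v) SMM subrr.
Qed.

Lemma diag_kernel (v : 'rV_n) :
  (forall i, d i != 0 -> v *m spec B d (fun z => (z == d i)%:R) = 0) -> v *m M = 0.
Proof.
move=> hv; rewrite diag_spec /spec !mulmxA.
suff -> : v *m invmx B *m diag_mx (\row_i d i) = 0 by rewrite mul0mx.
apply/rowP => i; rewrite mul_mx_diag mxE [X in _ * X]mxE [RHS]mxE.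
have [->|di] := eqVneq (d i) 0; first by rewrite mulr0.
have := hv i di; rewrite /spec !mulmxA => /(congr1 (mulmx^~ (invmx B))).
rewrite mulmxK // mul0mx mul_mx_diag => /rowP/(_ i).
by rewrite mxE [X in _ * X]mxE eqxx mulr1 [RHS]mxE => ->; rewrite mul0r.
Qed.

(** A kernel vector of [M + s X] with a component for [d i != 0] would make [- d i / s] an
    eigenvalue of [X]; [s] avoids the finitely many values that allow this. *)
Lemma diag_perturb (X : 'M[K]_n) : X *m M = M *m X ->
  exists2 s : K, s != 0 & forall v : 'rV_n, v *m (M + s *: X) = 0 -> v *m M = 0.
Proof.
move=> XM; have [B' [d' [uB' hB']]] := gev_basis X.
have [m hm] := avoid_finite_nat (0 :: [seq - d p.1 / d' p.2 | p <- enum {: 'I_n * 'I_n}]).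
pose s : K := m%:R; move: hm; rewrite inE negb_or -/s => /andP[s0 hs].
exists s => // v hv; apply: diag_kernel => i di.
set S := spec _ _ _; pose u := v *m S.
have commS A : A *m M = M *m A -> A *m S = S *m A.
  move=> AM; apply: (@gev_ext _ n n M) => a x hx.
  have gA : gev M a (x *m A) by apply: gev_commute.
  have eA : x *m A *m S = _ := spec_gev _ uB diag_gev_basis gA.
  have ex : x *m S = _ := spec_gev _ uB diag_gev_basis hx.
  by rewrite (mulmxA x A) (mulmxA x S) eA ex scalemxAl.
have uX : u *m (M + s *: X) = 0.
  rewrite /u -mulmxA -commS; first by rewrite mulmxA hv mul0mx.
  by rewrite mulmxDl mulmxDr -scalemxAl -scalemxAr XM.
have uM : u *m M = d i *: u.
  rewrite /u -mulmxA {1}diag_spec spec_mul // scalemxAr; congr (_ *m _).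
  rewrite /spec scalemxAl; congr (_ *m _); rewrite scalemxAr; congr (_ *m _).
  apply/matrixP => a b; rewrite !mxE mulrnAr; congr (_ *+ _).
  by have [->|_] := eqVneq (d a) (d i); rewrite ?mul1r ?mulr1 ?mul0r ?mulr0.
have gu : gev X (- d i / s) u.
  apply: eigen_gev; apply: (scalerI s0); rewrite scalerA mulrCA mulfV // mulr1 scaleNr.
  by apply/eqP; rewrite -addr_eq0 addrC -uM scalemxAr -mulmxDr uX.
apply: contrapT => /eqP un0.
have [j uj] : exists j, (u *m invmx B') 0 j != 0.
  apply: contrapT => hn; case/eqP: un0; rewrite -/u -[u](mulmxKV uB').
  suff -> : u *m invmx B' = 0 by rewrite mul0mx.
  apply/rowP => j; rewrite [RHS]mxE; apply/eqP/negPn/negP => hj.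
  by apply: hn; exists j.
have dj : d' j = - d i / s by apply: contraNeq uj => /(gev_coord uB' hB' gu) ->.
case/negP: hs; apply/mapP; exists (i, j); rewrite ?mem_enum //= dj.
by rewrite invfM invrK mulrA mulfV ?mul1r // oppr_eq0.
Qed.

End Diagonalizable.

(** A nonzero entry of [X ^+ k] forces [k = (d j - d i) / a], and some natural number is none of
    these finitely many quotients. *)
Lemma shift_nilpotent (K : numClosedFieldType) n (d : 'I_n -> K) (X : 'M[K]_n) (a : K) :
  a != 0 -> (forall i j, X i j != 0 -> d j = d i + a) -> exists k, X ^+ k = 0.
Proof.
move=> a0 hX.
have pw k i j : (X ^+ k) i j != 0 -> d j = d i + k%:R * a.
  elim: k j => [|k IH] j.
    rewrite expr0 mxE mul0r addr0; case: (eqVneq i j) => [->|] //.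
    by rewrite eqxx.
  rewrite exprSr -mulmxE mxE => h.
  have [l hl] : exists l, (X ^+ k) i l * X l j != 0.
    apply: contrapT => hn; case/eqP: h; apply: big1 => l _.
    by apply/eqP/negPn/negP => hl; apply: hn; exists l.
  move: hl; rewrite mulf_eq0 negb_or => /andP[/IH dl /hX ->].
  by rewrite dl -natr1 mulrDl mul1r addrA.
have [m hm] := avoid_finite_nat [seq (d p.2 - d p.1) / a | p <- enum {: 'I_n * 'I_n}].
exists m; apply/matrixP => i j; rewrite [RHS]mxE; apply/eqP/negPn/negP => /pw dj.
case/negP: hm; apply/mapP; exists (i, j); rewrite ?mem_enum //= dj.
by rewrite addrC addKr mulfK.
Qed.

Lemma spec_idem (K : numClosedFieldType) n (B : 'M[K]_n) (d : 'I_n -> K) (Q : pred K)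
    (v : 'rV[K]_n) : B \in unitmx ->
  (v <= spec B d (fun z => (Q z)%:R))%MS -> v *m spec B d (fun z => (Q z)%:R) = v.
Proof.
move=> uB /submxP[u ->]; rewrite -mulmxA spec_mul //; congr (_ *m spec _ _ _).
by apply: funext => z; case: (Q z); rewrite ?mulr1 ?mulr0.
Qed.

Lemma spec_commute (K : numClosedFieldType) n (M B A : 'M[K]_n) (d : 'I_n -> K) f :
  B \in unitmx -> (forall i, gev M (d i) (row i B)) -> A *m M = M *m A ->
  A *m spec B d f = spec B d f *m A.
Proof.
move=> uB hB AM; apply: (@gev_ext _ n n M) => a x hx.
have gA : gev M a (x *m A) by apply: gev_commute.
by rewrite (mulmxA x A) (mulmxA x (spec B d f)) (spec_gev f uB hB gA) (spec_gev f uB hB hx) scalemxAl.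
Qed.

Lemma nilpotent_eigen (K : fieldType) n (N : 'M[K]_n) (v : 'rV[K]_n) a :
  N ^+ n = 0 -> v != 0 -> v *m N = a *: v -> v *m N = 0.
Proof.
move=> Nn v0 va; have E k : v *m N ^+ k = a ^+ k *: v.
  elim: k => [|k IH]; first by rewrite !expr0 mulmx1 scale1r.
  by rewrite exprSr -mulmxE mulmxA IH -scalemxAl va scalerA exprSr.
have := E n; rewrite Nn mulmx0 => /esym/eqP; rewrite scaler_eq0 (negPf v0) orbF expf_eq0.
by move=> /andP[_ /eqP a0]; rewrite va a0 scale0r.
Qed.

Lemma spec_eq0 (K : numClosedFieldType) n (M B : 'M[K]_n) (d : 'I_n -> K) :
  B \in unitmx -> (forall i, gev M (d i) (row i B)) ->
  spec B d (fun z => (z != 0)%:R) = 0 -> forall i, gev M 0 (row i B).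
Proof.
move=> uB hB S0 i; have := spec_gev (fun z => (z != 0)%:R) uB hB (hB i).
rewrite S0 mulmx0; have [/eqP di _|di] := boolP (d i == 0); first by rewrite -di.
rewrite scale1r => r0; have : delta_mx 0 i *m B = (0 : 'rV_n) *m B by rewrite mul0mx -rowE -r0.
by move/(can_inj (mulmxK uB))/rowP/(_ i)/eqP; rewrite !mxE !eqxx oner_eq0.
Qed.

Lemma cap_kerP (K : fieldType) n (A M : 'M[K]_n) (v : 'rV[K]_n) :
  (v <= A :&: kermx M)%MS <-> (v <= A)%MS /\ v *m M = 0.
Proof.
by rewrite sub_capmx; split=> [/andP[-> /sub_kermxP]|[-> /sub_kermxP]].
Qed.

Lemma cap_ker_neq0 (K : fieldType) n (A M : 'M[K]_n) (v : 'rV[K]_n) :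
  (v <= A)%MS -> v *m M = 0 -> v != 0 -> (A :&: kermx M)%MS != 0.
Proof. by move=> vA vM v0; apply/rowV0Pn; exists v => //; apply/cap_kerP. Qed.

Lemma cap_eigenP (K : fieldType) n (A M : 'M[K]_n) a (v : 'rV[K]_n) :
  (v <= A :&: kermx (M - a%:M))%MS <-> (v <= A)%MS /\ v *m M = a *: v.
Proof.
split=> [/cap_kerP[vA]|[vA vM]].
  by rewrite mulmxBr mul_mx_scalar => /eqP; rewrite subr_eq0 => /eqP.
by apply/cap_kerP; rewrite mulmxBr mul_mx_scalar vM subrr.
Qed.

Lemma exprZmx (K : fieldType) n (a : K) (A : 'M[K]_n) k :
  (a *: A) ^+ k = a ^+ k *: A ^+ k.
Proof.
elim: k => [|k IH]; first by rewrite !expr0 scale1r.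
by rewrite !exprS IH -!mulmxE -scalemxAl -scalemxAr scalerA.
Qed.

Lemma row_stable (K : fieldType) n m (W : 'M[K]_(m, n)) (M : 'M[K]_n) :
  (forall v : 'rV_n, (v <= W)%MS -> (v *m M <= W)%MS) -> (W *m M <= W)%MS.
Proof.
by move=> h; apply/row_subP => i; rewrite row_mul; apply: h; apply: row_sub.
Qed.

(** * Infinitesimal rigidity of a triple *)

Section CharacteristicPair.
Variables (R : realType) (n : nat).
Local Notation C := (complex R).
Local Notation V := 'rV[C]_n.
Local Notation w := (rt2 R).
Variable br : V -> V -> V.
Hypothesis lie : is_lie_bracket br.
Hypothesis nondeg : forall x, (forall y, killing br x y = 0) -> x = 0.
Variables (e1 e2 : V) (r : nat).
Hypothesis e12 : br e1 e2 = 0.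
Hypothesis rk : is_lie_rank br r.
Hypothesis dimz : dim_z2 br e1 e2 = r.
Variables (h : V) (B : 'M[C]_n) (d : 'I_n -> C).
Hypothesis h1 : br h e1 = e1.
Hypothesis h2 : br h e2 = w *: e2.
Hypothesis uB : B \in unitmx.
Hypothesis hB : forall i, br h (row i B) = d i *: row i B.
Hypothesis d_real : forall i, d i \is Num.real.

Let MB i : row i B *m adm br h = d i *: row i B.
Proof. by rewrite (mul_adm lie) hB. Qed.

Let gB := diag_gev_basis MB.

Lemma gev_br a v : gev (adm br h) a v -> br h v = a *: v.
Proof. by move=> /(diag_gev uB MB); rewrite (mul_adm lie). Qed.

Lemma br_gev a v : br h v = a *: v -> gev (adm br h) a v.
Proof. by move=> hv; apply: eigen_gev; rewrite (mul_adm lie). Qed.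

Lemma dimz_char : dim_z br h = r.
Proof.
apply/eqP; rewrite eqn_leq; case: rk => _ -> //; rewrite andbT.
rewrite -(zero_degree_count lie nondeg e12 rk dimz h1 h2 uB gB).
exact: (dimz_le_count uB gB).
Qed.

(** For a suitable [s != 0], [z(h + s x)] lies in [z(h)]. The first has dimension at least [r], the
    second exactly [r], so they agree and [y] commutes with [s x]. *)
Lemma char_abelian x y : br h x = 0 -> br h y = 0 -> br x y = 0.
Proof.
move=> hx hy.
have XM : adm br x *m adm br h = adm br h *m adm br x.
  apply/eqP; rewrite -subr_eq0 -(adm_br lie) hx.
  by rewrite (adm0 lie).
have [s s0 hs] := diag_perturb uB MB XM.
have adE : adm br (h + s *: x) = adm br h + s *: adm br x by rewrite (admD lie) (admZ lie).
have sub : (kermx (adm br (h + s *: x)) <= kermx (adm br h))%MS.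
  apply/row_subP => i; apply/sub_kermxP; apply: hs; rewrite -adE.
  by apply/sub_kermxP; exact: row_sub.
have sub' : (kermx (adm br h) <= kermx (adm br (h + s *: x)))%MS.
  rewrite -(geq_leqif (mxrank_leqif_sup sub)).
  have := (proj2 rk) (h + s *: x); rewrite -dimz_char; exact: id.
have : (y <= kermx (adm br h))%MS by apply/sub_kermxP; rewrite (mul_adm lie).
move=> /submx_trans/(_ sub')/sub_kermxP.
rewrite (mul_adm lie) (brDl lie) hy add0r (brZl lie) => /eqP.
by rewrite scaler_eq0 (negPf s0) => /eqP.
Qed.

Lemma killing_row x : (forall i, killing br x (row i B) = 0) -> x = 0.
Proof.
move=> hx; apply: nondeg => y; rewrite killingC -[y](mulmxKV uB) mulmx_sum_row.
rewrite (killing_suml lie) big1 // => i _.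
by rewrite (killingZl lie) killingC hx mulr0.
Qed.

(** Invariance makes [x] orthogonal to all nonzero degrees. For [y] in [z(h)], [ad y] commutes with
    the nilpotent [ad x], so the trace of the product is 0. *)
Lemma char_nilpotent_eq0 x k : br h x = 0 -> adm br x ^+ k = 0 -> x = 0.
Proof.
move=> hx xk; apply: killing_row => i.
have [/eqP di|di] := boolP (d i == 0).
  have hi : br h (row i B) = 0 by rewrite hB di scale0r.
  have c : adm br (row i B) *m adm br x = adm br x *m adm br (row i B).
    apply/eqP; rewrite -subr_eq0 -(adm_br lie) (char_abelian hx hi).
    by rewrite (adm0 lie).
  rewrite killingC /killing; exact: mxtrace_nilpotent (nilpotent_commute c xk).
have e : d i * killing br x (row i B) = 0.
  rewrite killingC -(killingZl lie) -hB killingC -(killing_inv lie) (brC lie x) hx.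
  by rewrite oppr0 killing0l.
by move/eqP: e; rewrite mulf_eq0 (negPf di) => /eqP.
Qed.

Lemma degree_nilpotent a y : a != 0 -> br h y = a *: y -> ad_nilpotent br y.
Proof.
move=> a0 hy.
have sh i j : cj B (adm br y) i j != 0 -> d j = d i + a.
  apply: contraNeq => dj.
  have -> : cj B (adm br y) i j = (br y (row i B) *m invmx B) 0 j.
    by rewrite -(mul_adm lie) -!row_mul [RHS]mxE.
  rewrite (gev_coord uB gB (gev_der lie (adm_der lie h) (br_gev hy) (gB i))) //.
  by rewrite addrC.
have [k hk] := shift_nilpotent a0 sh.
apply: (@nilpotent_expn _ _ _ k).
exact: (cj_nilpotent uB hk).
Qed.

(* [h + ('i / b) x] would be another grading element, of which [y] is an
   eigenvector with a nonreal eigenvalue. *)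
Lemma centralizer_eigenvalue x y a b : br h x = 0 -> br x e1 = 0 -> br x e2 = 0 ->
  br e1 y = 0 -> br e2 y = 0 -> br h y = a *: y -> br x y = b *: y -> y != 0 -> b = 0.
Proof.
move=> hx x1 x2 y1 y2 hy xy y0; apply/eqP/negPn/negP => b0.
pose c := 'i / b; pose h' := h + c *: x.
have h'1 : br h' e1 = e1 by rewrite (brDl lie) (brZl lie) x1 scaler0 addr0.
have h'2 : br h' e2 = w *: e2 by rewrite (brDl lie) (brZl lie) x2 scaler0 addr0.
have [B' [d' [uB' hB']]] := gev_basis (adm br h').
have gy : gev (adm br h') (a + 'i) y.
  apply: eigen_gev; rewrite (mul_adm lie) (brDl lie) (brZl lie) hy xy scalerA /c.
  by rewrite mulfVK // scalerDl.
have a_real : a \is Num.real.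
  have [i yi] : exists i, (y *m invmx B) 0 i != 0.
    apply: contrapT => hn; case/eqP: y0; rewrite -[y](mulmxKV uB).
    suff -> : y *m invmx B = 0 by rewrite mul0mx.
    apply/rowP => i; rewrite [RHS]mxE; apply/eqP/negPn/negP => hi.
    by apply: hn; exists i.
  have <- : d i = a by apply: contraNeq yi => /(gev_coord uB gB (br_gev hy)) ->.
  exact: d_real.
have w_real : w \is Num.real by apply: ger0_real; apply: rt2_ge0.
have nreal (z : C) : z \is Num.real -> ~ (z = a + 'i).
  move=> zr e; have : 'i \isn't @Num.real C := nonRealCi C.
  by rewrite -[X in X \isn't _](addKr a) -e addrC rpredB.
have qreal p q : (p%:R + q%:R * w) \is Num.real.
  by rewrite rpredD ?rpredM ?realn.
have := centralizer_degree lie nondeg e12 rk dimz h'1 h'2 uB' hB' gy y1 y2 y0.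
case/orP => /asboolP[p [q e]].
  by apply: (nreal (p%:R + q%:R * w)).
apply: (nreal (- (p.+1%:R + q.+1%:R * w))); first by rewrite rpredN qreal.
have -> : p.+1%:R + q.+1%:R * w = (p%:R + q%:R * w) + w + 1 by rewrite -!natr1; ring.
by rewrite -e subrK subrK opprK.
Qed.

(* The image [S] of [ad x] away from its zero eigenvalue is stable under [h], [e1],
   [e2]; if nonzero, it meets [z(e1, e2)] in an eigenvector contradicting
   [centralizer_eigenvalue]. So [ad x] is nilpotent. *)
Lemma char_centralizer_eq0 x : br h x = 0 -> br x e1 = 0 -> br x e2 = 0 -> x = 0.
Proof.
move=> hx x1 x2.
have comm y : br x y = 0 -> adm br y *m adm br x = adm br x *m adm br y.
  by move=> xy; apply/eqP; rewrite -subr_eq0 -(adm_br lie) xy (adm0 lie).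
have [B' [d' [uB' hB']]] := gev_basis (adm br x).
pose S := spec B' d' (fun z => (z != 0)%:R).
have gS a v : gev (adm br x) a v -> v *m S = (a != 0)%:R *: v.
  exact: spec_gev.
have S_idem v : (v <= S)%MS -> v *m S = v := spec_idem (v := v) uB'.
have S_comm y (v : V) : br x y = 0 -> (v <= S)%MS -> (v *m adm br y <= S)%MS.
  move=> xy /S_idem vS; rewrite -vS.
  have c : adm br y *m S = S *m adm br y by apply: spec_commute uB' hB' (comm y xy).
  by rewrite -(mulmxA v S) -c mulmxA submxMl.
have [S0|Sn0] := boolP (S == 0).
  apply: (@char_nilpotent_eq0 x n hx); apply: (gev0_nilpotent uB').
  exact: spec_eq0 uB' hB' (eqP S0).
have nilp1 : ad_nilpotent br e1.
  by apply: (@degree_nilpotent 1); rewrite ?oner_eq0 // h1 scale1r.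
have w0 : w != 0.
  by apply/eqP => w0; have := rt2_sqr R; rewrite w0 expr0n /= => /eqP; rewrite eq_sym pnatr_eq0.
have nilp2 : ad_nilpotent br e2 by apply: (@degree_nilpotent w).
(* Pass to smaller stable subspaces one operator at a time. For [e1] and [e2] nilpotency makes the
   eigenvalue 0, so their kernels may be intersected; then come eigenvectors of [h] and of [x]. *)
have [a1 [v1 [v1n0 v1S v1e]]] : exists a (v : V), [/\ v != 0, (v <= S)%MS & v *m adm br e1 = a *: v].
  by apply: stable_eigen Sn0 _; apply: row_stable => v; exact: S_comm x1.
have v1k := nilpotent_eigen nilp1 v1n0 v1e.
pose Z1 := (S :&: kermx (adm br e1))%MS.
have Z1n0 : Z1 != 0 := cap_ker_neq0 v1S v1k v1n0.
have Z1P (v : V) : (v <= Z1)%MS <-> (v <= S)%MS /\ br e1 v = 0.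
  by rewrite -(mul_adm lie); apply: cap_kerP.
have [a2 [v2 [v2n0 v2Z v2e]]] : exists a (v : V), [/\ v != 0, (v <= Z1)%MS & v *m adm br e2 = a *: v].
  apply: stable_eigen Z1n0 _; apply: row_stable => v /Z1P[vS ve]; apply/Z1P; split.
    exact: S_comm.
  by rewrite (mul_adm lie) (jacobi lie) e12 ve (br0l lie) (br0r lie) addr0.
have v2k := nilpotent_eigen nilp2 v2n0 v2e.
pose Z2 := (Z1 :&: kermx (adm br e2))%MS.
have Z2n0 : Z2 != 0 := cap_ker_neq0 v2Z v2k v2n0.
have Z2P (v : V) : (v <= Z2)%MS <-> [/\ (v <= S)%MS, br e1 v = 0 & br e2 v = 0].
  have := cap_kerP Z1 (adm br e2) v; rewrite (mul_adm lie) => h3.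
  split; first by case/h3 => /Z1P[].
  by case=> *; apply/h3; split=> //; apply/Z1P.
have [a3 [v3 [v3n0 v3Z v3e]]] : exists a (v : V), [/\ v != 0, (v <= Z2)%MS & v *m adm br h = a *: v].
  apply: stable_eigen Z2n0 _; apply: row_stable => v /Z2P[vS ve1 ve2].
  have xh : br x h = 0 by rewrite (brC lie) hx oppr0.
  apply/Z2P; split; first exact: S_comm.
    by rewrite (mul_adm lie) (jacobi lie) (brC lie e1 h) h1 (brNl lie) ve1 (br0r lie) oppr0 addr0.
  by rewrite (mul_adm lie) (jacobi lie) (brC lie e2 h) h2 (brNl lie) (brZl lie) ve2 (br0r lie) scaler0 oppr0 addr0.
pose Z3 := (Z2 :&: kermx (adm br h - a3%:M))%MS.
have Z3P (v : V) : (v <= Z3)%MS <-> (v <= Z2)%MS /\ br h v = a3 *: v.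
  by rewrite -(mul_adm lie); apply: cap_eigenP.
have Z3n0 : Z3 != 0.
  by apply/rowV0Pn; exists v3; [apply/Z3P; split=> //; rewrite -(mul_adm lie)|exact: v3n0].
have [a4 [v4 [v4n0 v4Z v4e]]] : exists a (v : V), [/\ v != 0, (v <= Z3)%MS & v *m adm br x = a *: v].
  apply: stable_eigen Z3n0 _; apply: row_stable => v /Z3P[/Z2P[vS ve1 ve2] vh].
  rewrite (mul_adm lie).
  have ex1 : br e1 x = 0 by rewrite (brC lie) x1 oppr0.
  have ex2 : br e2 x = 0 by rewrite (brC lie) x2 oppr0.
  apply/Z3P; split; last by rewrite (jacobi lie) hx (br0l lie) add0r vh (brZr lie).
  apply/Z2P; split.
  - by rewrite -(mul_adm lie); apply: S_comm => //; apply: brxx.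
  - by rewrite (jacobi lie) ex1 ve1 (br0l lie) (br0r lie) addr0.
  - by rewrite (jacobi lie) ex2 ve2 (br0l lie) (br0r lie) addr0.
have [/Z2P[vS ve1 ve2] vh] := proj1 (Z3P v4) v4Z.
have vx : br x v4 = a4 *: v4 by rewrite -(mul_adm lie).
have a40 := centralizer_eigenvalue hx x1 x2 ve1 ve2 vh vx v4n0.
have := gS a4 v4 (eigen_gev v4e); rewrite S_idem // a40 eqxx scale0r => v40.
by rewrite v40 eqxx in v4n0.
Qed.

(** Moving along the orbit reduces [y] to its part [y0] in [z(h)]. Then [y0] centralizes the triple
    and vanishes, and the remaining pair [(p1, p2)] is a cocycle of the Koszul complex, hence a
    coboundary. *)
Lemma tangent_solve y x1 x2 :
  br y e1 + br h x1 = x1 -> br y e2 + br h x2 = w *: x2 ->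
  br x1 e2 + br e1 x2 = 0 ->
  exists x, [/\ y = br x h, x1 = br x e1 & x2 = br x e2].
Proof.
move=> t1 t2 t3; have [z [y0 [yE]]] := diag_decomp uB MB y.
rewrite (mul_adm lie) in yE *; rewrite (mul_adm lie) => hy0.
pose u := - z; pose p1 := x1 - br u e1; pose p2 := x2 - br u e2.
have uh : br u h = br h z by rewrite (brC lie) (brNr lie) opprK.
have yE' : y = y0 + br u h by rewrite uh.
have q1 : br y0 e1 + br h p1 = p1.
  rewrite /p1 (brBr lie) (jacobi lie h u e1) h1 (brC lie h u) (brNl lie) opprD opprK.
  by rewrite -[in RHS]t1 yE' (brDl lie) !addrA [br y0 e1 + br h x1 + _]addrAC.
have q2 : br y0 e2 + br h p2 = w *: p2.
  rewrite /p2 (brBr lie) (jacobi lie h u e2) h2 (brC lie h u) (brNl lie) opprD opprK.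
  rewrite scalerBr -[in RHS]t2 yE' (brDl lie) (brZr lie).
  by rewrite !addrA [br y0 e2 + br h x2 + _]addrAC.
have q3 : br p1 e2 + br e1 p2 = 0.
  rewrite /p1 /p2 (brBl lie) (brBr lie) (jacobi lie e1 u e2) e12 (br0r lie) addr0.
  by rewrite (brC lie e1 u) (brNl lie) opprK addrACA t3 add0r addNr.
(* Both [(ad h - a) p = - [y0, e]] and [(ad h - a) [y0, e] = 0] hold; as [ad h] is diagonalizable,
   [[y0, e] = 0]. *)
have kill (p : V) a e : br h e = a *: e -> br y0 e + br h p = a *: p ->
    br y0 e = 0 /\ br h p = a *: p.
  move=> he hp.
  have Dz : br h (br y0 e) = a *: br y0 e.
    by rewrite (jacobi lie) hy0 (br0l lie) add0r he (brZr lie).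
  have gp : gev (adm br h) a p.
    exists 2%N; rewrite expr2 -mulmxE mulmxA.
    have -> : p *m (adm br h - a%:M) = - br y0 e.
      rewrite mulmxBr (mul_adm lie) mul_mx_scalar -hp opprD addrCA.
      by rewrite subrr addr0.
    by rewrite mulNmx mulmxBr (mul_adm lie) mul_mx_scalar Dz subrr oppr0.
  have hp' := gev_br gp; split=> //.
  by move: hp; rewrite hp' -[X in _ = X]add0r => /addIr.
have he1 : br h e1 = 1 *: e1 by rewrite h1 scale1r.
have q1' : br y0 e1 + br h p1 = 1 *: p1 by rewrite scale1r.
have [k1 g1] := kill _ _ _ he1 q1'.
have [k2 g2] := kill _ _ _ h2 q2.
have y00 : y0 = 0 by apply: char_centralizer_eq0.
have e21 : br e2 p1 = br e1 p2.
  by apply/esym/eqP; rewrite (brC lie e2 p1) -addr_eq0 addrC q3.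
have [x [gx px1 px2]] := killing_complex_exact lie nondeg e12 rk dimz h1 h2 uB gB
   (br_gev g1) (br_gev g2) e21.
exists (u - x); split.
- rewrite yE' y00 add0r (brBl lie) [br x h](brC lie) (gev_br gx) scale0r oppr0.
  by rewrite subr0.
- by rewrite (brBl lie) -[br x e1]opprK -(brC lie) -px1 opprK /p1 addrC subrK.
- by rewrite (brBl lie) -[br x e2]opprK -(brC lie) -px2 opprK /p2 addrC subrK.
Qed.

(** Let [z] represent a functional that kills all nilpotent elements. Basis vectors [b_i], [b_j] of
    nonzero degree are nilpotent, and so is [exp (s ad b_i) b_j]; its coefficient of [s] shows that
    [z] is orthogonal to [[b_i, b_j]]. Brackets involving degree 0 vanish or are nilpotent. So [z]
    is orthogonal to all brackets, [ad z = 0] and [z = 0]. *)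
Lemma nilpotent_basis : exists2 Y : 'M[C]_n, Y \in unitmx &
  forall i, ad_nilpotent br (row i Y).
Proof.
apply: basis_of_pred => u hu.
have [z hz] := killing_repr lie nondeg u.
have zn y : ad_nilpotent br y -> killing br z y = 0.
  by move=> /hu; rewrite -hz => /matrixP/(_ 0 0); rewrite !mxE mulr1n.
have bn i : d i != 0 -> ad_nilpotent br (row i B).
  by move=> di; apply: degree_nilpotent di (hB i).
have zb i j : killing br z (br (row i B) (row j B)) = 0.
  have deg : br h (br (row i B) (row j B)) = (d i + d j) *: br (row i B) (row j B).
    by rewrite (jacobi lie) !hB (brZl lie) (brZr lie) -scalerDl.
  have [/eqP di|di] := boolP (d i == 0); have [/eqP dj|dj] := boolP (d j == 0).
  - have hi : br h (row i B) = 0 by rewrite hB di scale0r.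
    have hj : br h (row j B) = 0 by rewrite hB dj scale0r.
    rewrite (char_abelian hi hj) killingC; exact: killing0l.
  - by apply: zn; apply: degree_nilpotent deg; rewrite di add0r.
  - by apply: zn; apply: degree_nilpotent deg; rewrite dj addr0.
  pose X := adm br (row i B).
  pose p := \poly_(k < n.+1) ((k`!)%:R^-1 * killing br (row j B *m X ^+ k) z).
  have p0 : p = 0.
    apply: poly_ext0 => s; rewrite horner_poly.
    have ns : ad_nilpotent br (s *: row i B).
      by rewrite /ad_nilpotent (admZ lie) exprZmx (bn i di) scaler0.
    have := zn _ (ad_nilpotent_aut lie (G_exp ns) (bn j dj)).
    rewrite killingC /exp_ad mulmx_sumr (killing_suml lie) => e.
    rewrite -[RHS]e; apply: eq_bigr => k _.
    rewrite (admZ lie) exprZmx -!scalemxAr scalerA (killingZl lie) -/X.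
    by rewrite mulrAC.
  have := congr1 (fun q : {poly C} => q`_1) p0.
  rewrite coef0 coef_poly ltnS; have -> : (0 < n)%N by apply: leq_ltn_trans (ltn_ord i).
  by rewrite (_ : 1`! = 1)%N // invr1 mul1r expr1 (mul_adm lie) killingC.
have z0 : z = 0.
  apply: nondeg => y; rewrite /killing.
  suff -> : adm br z = 0 by rewrite mul0mx mxtrace0.
  apply: (can_inj (mulKmx uB)); apply/row_matrixP => i.
  rewrite !row_mul (mul_adm lie) mulmx0.
  apply: killing_row => j; by rewrite (killing_inv lie) zb.
apply/matrixP => i j; rewrite [RHS]mxE ord1.
have := hz (delta_mx 0 i); rewrite z0 (killing0l lie) -rowE => /matrixP/(_ 0 0).
by rewrite !mxE mul0rn => <-.
Qed.

End CharacteristicPair.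

(** * Finiteness *)

Section FirstOrder.
Variable K : numClosedFieldType.

Definition expansion p q (f : K -> 'M[K]_(p, q)) (A B : 'M[K]_(p, q)) : Prop :=
  exists c : 'M[{poly K}]_(p, q), forall s,
    f s = A + s *: B + s ^+ 2 *: map_mx (horner^~ s) c.

Lemma expansion_cst p q (A : 'M[K]_(p, q)) : expansion (fun=> A) A 0.
Proof.
exists 0 => s; rewrite scaler0 addr0; apply/matrixP => i j.
by rewrite !mxE horner0 mulr0 addr0.
Qed.

Lemma expansion_id p q (A B : 'M[K]_(p, q)) : expansion (fun s => A + s *: B) A B.
Proof.
exists 0 => s; apply/matrixP => i j.
by rewrite !mxE horner0 mulr0 addr0.
Qed.

Lemma expansionD p q (f g : K -> 'M[K]_(p, q)) A B A' B' :
  expansion f A B -> expansion g A' B' ->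
  expansion (fun s => f s + g s) (A + A') (B + B').
Proof.
move=> [c hc] [c' hc']; exists (c + c') => s; rewrite hc hc'.
apply/matrixP => i j; rewrite !mxE hornerD; ring.
Qed.

Lemma expansionZ p q (a : K) (f : K -> 'M[K]_(p, q)) A B :
  expansion f A B -> expansion (fun s => a *: f s) (a *: A) (a *: B).
Proof.
move=> [c hc]; exists (map_mx (fun x => a%:P * x) c) => s; rewrite hc.
apply/matrixP => i j; rewrite !mxE hornerM hornerC; ring.
Qed.

Lemma expansionM p q r (f : K -> 'M[K]_(p, q)) (g : K -> 'M[K]_(q, r)) A B A' B' :
  expansion f A B -> expansion g A' B' ->
  expansion (fun s => f s *m g s) (A *m A') (A *m B' + B *m A').
Proof.
move=> [c hc] [c' hc'].
pose T m1 m2 (X : 'M[K]_(m1, m2)) := map_mx (@polyC K) X.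
exists (T _ _ A *m c' + T _ _ B *m T _ _ B' + 'X *: (T _ _ B *m c') +
   c *m T _ _ A' + 'X *: (c *m T _ _ B') + 'X ^+ 2 *: (c *m c')) => s.
have ev m1 m2 m3 (X : 'M[{poly K}]_(m1, m2)) (Y : 'M[{poly K}]_(m2, m3)) :
    map_mx (horner^~ s) (X *m Y) = map_mx (horner^~ s) X *m map_mx (horner^~ s) Y.
  exact: (map_mxM (horner_eval s)).
have evT m1 m2 (X : 'M[K]_(m1, m2)) : map_mx (horner^~ s) (T _ _ X) = X.
  by apply/matrixP => i j; rewrite !mxE hornerC.
have evD m1 m2 (X Y : 'M[{poly K}]_(m1, m2)) :
    map_mx (horner^~ s) (X + Y) = map_mx (horner^~ s) X + map_mx (horner^~ s) Y.
  exact: (map_mxD (horner_eval s)).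
have evZ m1 m2 (a : {poly K}) (X : 'M[{poly K}]_(m1, m2)) :
    map_mx (horner^~ s) (a *: X) = a.[s] *: map_mx (horner^~ s) X.
  by apply/matrixP => i j; rewrite !mxE hornerM.
rewrite hc hc' !evD !evZ !ev !evT hornerX hornerXn.
rewrite !mulmxDl !mulmxDr -!scalemxAl -!scalemxAr !scalerDr !scalerA.
apply/matrixP => i j; rewrite !mxE; ring.
Qed.

Lemma eq_expansion p q (f g : K -> 'M[K]_(p, q)) A B :
  f =1 g -> expansion f A B -> expansion g A B.
Proof. by move=> fg [c hc]; exists c => s; rewrite -fg. Qed.

Lemma expansion_tangent N M (f : 'rV[K]_N -> 'rV[K]_M) x v w :
  expansion (fun s => f (x + s *: v)) (f x) w -> tangent f x v w.
Proof.
move=> [c hc] j; exists (c 0 j) => s; rewrite hc !mxE; ring.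
Qed.

Lemma tangent_uniq N M (f : 'rV[K]_N -> 'rV[K]_M) x v w w' :
  polymap f -> tangent f x v w -> tangent f x v w' -> w = w'.
Proof.
move=> /polymapP[T hT] h h'.
have /tangent_evmap -> : tangent (evmap T) x v w by apply: eq_tangent h.
by have /tangent_evmap -> : tangent (evmap T) x v w' by apply: eq_tangent h'.
Qed.

Lemma bilinear_expand p q (s : K) (a b c d : 'M[K]_(p, q)) :
  (a + s *: b) + (s *: c + s *: (s *: d)) = a + s *: (c + b) + s ^+ 2 *: d.
Proof. apply/matrixP => i j; rewrite !mxE; ring. Qed.

Lemma expansion_row p q r (f : K -> 'M[K]_(p, q)) (g : K -> 'M[K]_(p, r)) A B A' B' :
  expansion f A B -> expansion g A' B' ->
  expansion (fun s => row_mx (f s) (g s)) (row_mx A A') (row_mx B B').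
Proof.
move=> [c hc] [c' hc']; exists (row_mx c c') => s; rewrite hc hc'.
by rewrite map_row_mx !scale_row_mx !add_row_mx.
Qed.

Definition polymx N p q (f : 'rV[K]_N -> 'M[K]_(p, q)) : Prop :=
  forall i j, polyfun (fun x => f x i j).

Lemma polymxM N p q r (f : 'rV[K]_N -> 'M[K]_(p, q)) (g : 'rV[K]_N -> 'M[K]_(q, r)) :
  polymx f -> polymx g -> polymx (fun x => f x *m g x).
Proof.
move=> pf pg i j.
apply: (@eq_polyfun _ _ (fun x => \sum_k f x i k * g x k j)) => [x|]; first by rewrite mxE.
by apply: polyfun_sum => k; apply: polyfunM.
Qed.

Lemma polymap_row N p q (f : 'rV[K]_N -> 'rV[K]_p) (g : 'rV[K]_N -> 'rV[K]_q) :
  polymap f -> polymap g -> polymap (fun x => row_mx (f x) (g x)).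
Proof.
move=> pf pg j; rewrite -[j]splitK; case: (split j) => i /=.
  by apply: (eq_polyfun _ (pf i)) => x; rewrite row_mxEl.
by apply: (eq_polyfun _ (pg i)) => x; rewrite row_mxEr.
Qed.

Lemma polymapD N p (f g : 'rV[K]_N -> 'rV[K]_p) :
  polymap f -> polymap g -> polymap (fun x => f x + g x).
Proof.
move=> pf pg j; apply: (eq_polyfun _ (polyfunD (pf j) (pg j))) => x.
by rewrite mxE.
Qed.

Lemma polymapZ N p (a : K) (f : 'rV[K]_N -> 'rV[K]_p) :
  polymap f -> polymap (fun x => a *: f x).
Proof.
move=> pf j; apply: (eq_polyfun _ (polyfunM (polyfun_cst _ a) (pf j))) => x.
by rewrite mxE.
Qed.

End FirstOrder.

(** * Orbits of triples *)

Section Assembly.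
Variables (R : realType) (n : nat).
Local Notation C := (complex R).
Local Notation V := 'rV[C]_n.
Local Notation w := (rt2 R).
Local Notation E := 'rV[C]_(n + (n + n)).
Variable br : V -> V -> V.
Hypothesis lie : is_lie_bracket br.
Hypothesis nondeg : forall x, (forall y, killing br x y = 0) -> x = 0.
Local Notation G := (in_adjoint_group br).

Lemma pnp_orbit e1 e2 g : G g -> principal_nilpotent_pair br e1 e2 ->
  principal_nilpotent_pair br (e1 *m g) (e2 *m g).
Proof.
move=> Gg [e12 [r [rk dz]] sc]; have [g' [Gg' gg' g'g]] := GV lie Gg.
have ug' : g' \in unitmx by have [] := mulmx1_unit g'g.
have ig' : invmx g' = g by rewrite -[RHS]mul1mx -(mulVmx ug') -mulmxA g'g mulmx1.
have ad y : adm br (y *m g) = cj g' (adm br y).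
  by rewrite /cj ig' -mulmxA -(adm_aut lie y Gg) mulmxA g'g mul1mx.
split.
- by rewrite -(G_aut lie Gg) e12 mul0mx.
- exists r; split; first exact: rk.
  rewrite /dim_z2 (ad e1) (ad e2); exact: (etrans (rank_ker_cj ug' _ _) dz).
move=> t1 t2 t10 t20; have [g0 [Gg0 [s1 s2]]] := sc t1 t2 t10 t20.
exists (g' *m g0 *m g); split; first by do 2?apply: GM.
by rewrite !mulmxA -!(mulmxA _ g) gg' !mulmx1 s1 s2 -!scalemxAl.
Qed.

Definition hpart (p : E) : V := lsubmx p.
Definition e1part (p : E) : V := lsubmx (rsubmx p).
Definition e2part (p : E) : V := rsubmx (rsubmx p).

Lemma tripleE p : p = row_mx (hpart p) (row_mx (e1part p) (e2part p)).
Proof. by rewrite !hsubmxK. Qed.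

Definition act (p : E) (g : 'M[C]_n) : E :=
  row_mx (hpart p *m g) (row_mx (e1part p *m g) (e2part p *m g)).

Definition relations (p : E) : 'rV[C]_(n + (n + n)) :=
  row_mx (br (hpart p) (e1part p) + (-1) *: e1part p)
   (row_mx (br (hpart p) (e2part p) + (- w) *: e2part p)
           (br (e1part p) (e2part p))).

(** The conditions that are not expressed by equations belong to the class of points in
    [finite_classes]; [relations] supplies the equations. *)
Definition good_triple (p : E) : Prop :=
  principal_nilpotent_pair br (e1part p) (e2part p) /\
  exists B (d : 'I_n -> R), [/\ B \in unitmx,
    forall i, br (hpart p) (row i B) = real_complex R (d i) *: row i B,
    br (hpart p) (e1part p) = e1part p & br (hpart p) (e2part p) = w *: e2part p].

Definition conj_triple (p q : E) : Prop := exists2 g, G g & q = act p g.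

Lemma act_parts p g : [/\ hpart (act p g) = hpart p *m g,
  e1part (act p g) = e1part p *m g & e2part (act p g) = e2part p *m g].
Proof. by rewrite /hpart /e1part /e2part /act !(row_mxKl, row_mxKr). Qed.

Lemma actM p g h : act (act p g) h = act p (g *m h).
Proof. by have [e1 e2 e3] := act_parts p g; rewrite /act e1 e2 e3 !mulmxA. Qed.

Lemma act1 p : act p 1%:M = p.
Proof. by rewrite /act !mulmx1 -tripleE. Qed.

Lemma conj_triple_sym p q : conj_triple p q -> conj_triple q p.
Proof.
move=> [g Gg ->]; have [g' [Gg' gg' _]] := GV lie Gg.
by exists g' => //; rewrite actM gg' act1.
Qed.

Lemma conj_triple_trans p q r : conj_triple p q -> conj_triple q r -> conj_triple p r.
Proof.
by move=> [g Gg ->] [h Gh ->]; exists (g *m h); rewrite ?actM //; apply: GM.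
Qed.

Lemma good_relations p g : good_triple p -> G g -> relations (act p g) = 0.
Proof.
move=> [[e12 _ _] [B [d [_ _ h1 h2]]]] Gg; have [e1 e2 e3] := act_parts p g.
rewrite /relations e1 e2 e3 -!(G_aut lie Gg) h1 h2 e12.
by rewrite -scalemxAl !scaleNr scale1r !addrN mul0mx !row_mx0.
Qed.

Lemma polymap_br N (x y : 'rV[C]_N -> V) : polymap x -> polymap y ->
  polymap (fun p => br (x p) (y p)).
Proof.
move=> px py j.
apply: (@eq_polyfun _ _ (fun p => \sum_i \sum_k x p 0 i * (y p 0 k *
   br (delta_mx 0 i) (delta_mx 0 k) 0 j))) => [p|].
  rewrite [x p in RHS]row_sum_delta (br_suml lie) summxE; apply: eq_bigr => i _.
  rewrite [y p in RHS]row_sum_delta (br_sumr lie) summxE; apply: eq_bigr => k _.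
  by rewrite (brZl lie) (brZr lie) !mxE.
apply: polyfun_sum => i; apply: polyfun_sum => k.
by apply: polyfunM => //; apply: polyfunM => //; apply: polyfun_cst.
Qed.

Lemma polymap_parts : [/\ polymap hpart, polymap e1part & polymap e2part].
Proof.
split=> j.
- by exists (PVar _ (lshift _ j)) => p; rewrite mxE.
- by exists (PVar _ (rshift _ (lshift _ j))) => p; rewrite !mxE.
- by exists (PVar _ (rshift _ (rshift _ j))) => p; rewrite !mxE.
Qed.

Lemma polymap_relations : polymap relations.
Proof.
have [ph p1 p2] := polymap_parts.
apply: polymap_row; last apply: polymap_row.
- by apply: polymapD; [apply: polymap_br|apply: polymapZ].
- by apply: polymapD; [apply: polymap_br|apply: polymapZ].
- exact: polymap_br.
Qed.

(** Exponential coordinates of the second kind. The truncated exponentials are polynomial in [s],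
    and the differential at 0 sends [a] to [ad (a *m Y)]. *)
Definition group_curve (Y : 'M[C]_n) (s : V) : 'M[C]_n :=
  \prod_(i <- enum 'I_n) exp_ad br (s 0 i *: row i Y).

Lemma polymx_exp (y : V) i : polymx (fun s : V => exp_ad br (s 0 i *: y)).
Proof.
move=> a b; apply: (@eq_polyfun _ _ (fun s : V =>
   \sum_(k < n.+1) (s 0 i ^+ k * ((k`!)%:R^-1 * (adm br y ^+ k) a b)))) => [s|].
  rewrite /exp_ad summxE; apply: eq_bigr => k _.
  by rewrite (admZ lie) exprZmx !mxE mulrCA.
apply: polyfun_sum => k; apply: polyfunM; last exact: polyfun_cst.
exact/polyfunX/polyfun_coord.
Qed.

Lemma polymx_curve Y : polymx (group_curve Y).
Proof.
rewrite /group_curve; elim: (enum _) => [|i r IH].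
  move=> a b; apply: (eq_polyfun _ (polyfun_cst _ ((1%:M : 'M[C]_n) a b))) => s.
  by rewrite big_nil.
have h := polymxM (polymx_exp (row i Y) i) IH.
by move=> a b; apply: (eq_polyfun _ (h a b)) => s; rewrite big_cons.
Qed.

Lemma expansion_exp (y : V) : expansion (fun s => exp_ad br (s *: y)) 1%:M (adm br y).
Proof.
(* For [n = 0] the truncated exponential has no linear term to split off, but all matrices are
   empty. *)
case: n br lie y => [|m] br' lie' y.
  by exists 0 => s; apply/matrixP => -[].
pose c := \matrix_(i, j) \sum_(k < m) 'X^k * (((k.+2)`!)%:R^-1 * (adm br' y ^+ k.+2) i j)%:P.
exists c => s; rewrite exp_adE !big_nat_recl //= big_mkord dpow0 (admZ lie') addrA.
have -> : dpow (s *: adm br' y) 1 = s *: adm br' y by rewrite /dpow expr1 invr1 scale1r.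
congr (_ + _); apply/matrixP => i j.
rewrite summxE !mxE horner_sum mulr_sumr; apply: eq_bigr => k _.
rewrite /dpow exprZmx !mxE hornerM hornerXn hornerC [RHS]mulrA -exprD add2n.
by rewrite mulrCA.
Qed.

Lemma expansion_curve Y (a : V) :
  expansion (fun s => group_curve Y (s *: a)) 1%:M (adm br (a *m Y)).
Proof.
have -> : adm br (a *m Y) = \sum_(i <- enum 'I_n) adm br (a 0 i *: row i Y).
  by rewrite mulmx_sum_row (adm_sum lie) big_enum.
rewrite /group_curve; elim: (enum _) => [|i r IH].
  rewrite big_nil; apply: (eq_expansion _ (expansion_cst 1%:M)) => s.
  by rewrite big_nil.
have h := expansionM (expansion_exp (a 0 i *: row i Y)) IH.
rewrite big_cons; move: h; rewrite !mul1mx mulmx1 addrC.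
by apply: eq_expansion => s; rewrite big_cons mxE scalerA.
Qed.

Lemma curve_mem Y s : (forall i, ad_nilpotent br (row i Y)) -> G (group_curve Y s).
Proof.
move=> hY; rewrite /group_curve; elim: (enum _) => [|i r IH].
  by rewrite big_nil; apply: G1.
rewrite big_cons; apply: GM IH; apply: G_exp.
by rewrite /ad_nilpotent (admZ lie) exprZmx (hY i) scaler0.
Qed.

Lemma expansion_act p (g : C -> 'M[C]_n) A B : expansion g A B ->
  expansion (fun s => act p (g s)) (act p A) (act p B).
Proof.
move=> hg.
have part (x : V) : expansion (fun s => x *m g s) (x *m A) (x *m B).
  by have := expansionM (expansion_cst x) hg; rewrite mul0mx addr0.
by apply: expansion_row; last apply: expansion_row.
Qed.

Lemma tangent_relations p v : tangent relations p v
  (row_mx (br (hpart v) (e1part p) + br (hpart p) (e1part v) + (-1) *: e1part v)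
  (row_mx (br (hpart v) (e2part p) + br (hpart p) (e2part v) + (- w) *: e2part v)
          (br (e1part v) (e2part p) + br (e1part p) (e2part v)))).
Proof.
apply: expansion_tangent.
have parts s : [/\ hpart (p + s *: v) = hpart p + s *: hpart v,
   e1part (p + s *: v) = e1part p + s *: e1part v &
   e2part (p + s *: v) = e2part p + s *: e2part v].
  by rewrite /hpart /e1part /e2part !linearD !linearZ.
have bil (x x' y y' : V) : expansion (fun s => br (x + s *: x') (y + s *: y'))
    (br x y) (br x' y + br x y').
  exists (map_mx (@polyC C) (br x' y')) => s.
  have -> : map_mx (horner^~ s) (map_mx (@polyC C) (br x' y')) = br x' y'.
    by apply/matrixP => i j; rewrite !mxE hornerC.
  rewrite (brDl lie) !(brDr lie) !(brZl lie) !(brZr lie).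
  exact: bilinear_expand.
apply: (@eq_expansion _ _ _ (fun s =>
  row_mx (br (hpart p + s *: hpart v) (e1part p + s *: e1part v) + (-1) *: (e1part p + s *: e1part v))
  (row_mx (br (hpart p + s *: hpart v) (e2part p + s *: e2part v) + (- w) *: (e2part p + s *: e2part v))
    (br (e1part p + s *: e1part v) (e2part p + s *: e2part v))))).
  by move=> s; rewrite /relations; have [-> -> ->] := parts s.
apply: expansion_row; last apply: expansion_row; last exact: bil.
- by apply: expansionD; [exact: bil|apply/expansionZ/expansion_id].
- by apply: expansionD; [exact: bil|apply/expansionZ/expansion_id].
Qed.

(** At [p] the exponential family has the tangent vectors [[x, p]] with [x = a *m Y]. By
    [tangent_solve] they exhaust the solutions of the linearized relations, and by
    [char_centralizer_eq0] the vector [a] is determined. *)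
Lemma finite_triples : exists s : seq E, (forall p, p \in s -> good_triple p) /\
  forall p, good_triple p -> exists2 q, q \in s & conj_triple q p.
Proof.
apply: (finite_classes polymap_relations conj_triple_sym conj_triple_trans).
move=> p good; have [[e12 [r [rk dz]] _] [B [d [uB hB h1 h2]]]] := good.
have d_real i : real_complex R (d i) \is Num.real.
  by rewrite realE -(rmorph0 (real_complex R)) !lecR; case: (leP 0 (d i)) => // /ltW.
have [Y uY nY] := nilpotent_basis lie nondeg e12 rk dz h1 h2 uB hB.
exists (fun s => act p (group_curve Y s)).
have tan a : tangent (fun s => act p (group_curve Y s)) 0 a (act p (adm br (a *m Y))).
  apply: expansion_tangent; apply: (eq_expansion (f := fun s => act p (group_curve Y (s *: a)))).
    by move=> s; rewrite add0r.
  have := expansion_act p (expansion_curve Y a).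
  have [c hc] := expansion_curve Y a; have := hc 0.
  by rewrite scale0r scale0r expr0n /= scale0r !addr0 => ->.
have poly : polymap (fun s => act p (group_curve Y s)).
  have part (x : V) : polymap (fun s => x *m group_curve Y s).
    move=> j; apply: (polymxM (f := fun=> x)); last exact: polymx_curve.
    by move=> a b; apply: polyfun_cst.
  by apply: polymap_row; last apply: polymap_row.
have curve0 : act p (group_curve Y 0) = p.
  have [c hc] := expansion_curve Y 0; have := hc 0.
  by rewrite scaler0 mul0mx (adm0 lie) scale0r expr0n /= scale0r !addr0 => ->; rewrite act1.
split=> //.
- move=> s; split; first by exists (group_curve Y s) => //; apply: curve_mem.
  by apply: good_relations => //; apply: curve_mem.
- move=> v hv; have := tangent_uniq polymap_relations hv (tangent_relations p v).
  rewrite -[0](row_mx0) -[X in row_mx _ X](row_mx0).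
  move/esym/eq_row_mx => [t1 /eq_row_mx[t2 t3]].
  have t1' : br (hpart v) (e1part p) + br (hpart p) (e1part v) = e1part v.
    by move/eqP: t1; rewrite scaleN1r subr_eq0 => /eqP.
  have t2' : br (hpart v) (e2part p) + br (hpart p) (e2part v) = w *: e2part v.
    by move/eqP: t2; rewrite scaleNr subr_eq0 => /eqP.
  have [x [xh x1 x2]] := tangent_solve lie nondeg e12 rk dz h1 h2 uB hB d_real t1' t2' t3.
  exists (x *m invmx Y); have := tan (x *m invmx Y); rewrite mulmxKV //.
  by rewrite /act !(mul_adm lie) -xh -x1 -x2 -tripleE.
move=> a ha; have := tangent_uniq poly (tan a) ha.
have e0 : (0 : E) = row_mx 0 (row_mx 0 0) by rewrite !row_mx0.
rewrite /act !(mul_adm lie) [RHS]e0.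
move/eq_row_mx => [th /eq_row_mx[t1 t2]].
have aY : a *m Y = 0.
  apply: (char_centralizer_eq0 lie nondeg e12 rk dz h1 h2 uB hB d_real) => //.
  by rewrite (brC lie) th oppr0.
by rewrite -[a](mulmxK uY) aY mul0mx.
Qed.

End Assembly.

Theorem theorem3p9 (R : realType) (n : nat)
    (br : 'rV[complex R]_n -> 'rV[complex R]_n -> 'rV[complex R]_n) :
  is_lie_bracket br -> semisimple br ->
  exists s : seq ('rV[complex R]_n * 'rV[complex R]_n),
    forall e : 'rV[complex R]_n * 'rV[complex R]_n,
      principal_nilpotent_pair br e.1 e.2 <->
      exists2 p, p \in s & in_diag_orbit br p e.
Proof.
move=> lie ss; have nondeg := killing_nondegenerate lie ss.
have [s [sg hs]] := finite_triples lie nondeg.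
exists [seq (e1part p, e2part p) | p <- s] => -[e1 e2] /=; split=> [pnp|].
  have [h [B [d [uB hB h1 h2]]]] := characteristic lie nondeg pnp.
  pose p := row_mx h (row_mx e1 e2).
  have [ph pe1 pe2] : [/\ hpart p = h, e1part p = e1 & e2part p = e2].
    by rewrite /hpart /e1part /e2part /p !(row_mxKl, row_mxKr).
  have [|q qs [g Gg pE]] := hs p.
    by rewrite /good_triple ph pe1 pe2; split=> //; exists B, d.
  exists (e1part q, e2part q); first by apply/mapP; exists q.
  exists g; split=> //=; rewrite -pe1 -pe2 pE.
  by have [_ -> ->] := act_parts q g.
case=> _ /mapP[q /sg[pnp _] ->] [g [Gg /= [-> ->]]].
exact: pnp_orbit.
Qed.
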